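(* Fix $0<\epsilon<1$, let $q=q(n)$ satisfy $n^{-1}\log^2 n\le q\le 1/2$, put $p=1-q$, and let $P$ be a random poset drawn from $\Omega(n,p)$. Let $\phi(q)=\prod_{i=1}^{\infty}(1-q^i)$ and $z=n^2q\log(1/\phi(q))$. Then asymptotically almost surely (as $n\to\infty$) \[ \dim(P) < \begin{cases} n-(2-\epsilon)\log(qn)/q & \text{if } n^{-1}\log^2 n\le q\le n^{-1/2}\log n,\\ n-qn/(2\log(qn)) & \text{if } n^{-1/2}\log n<q\le n^{-1/3},\\ n-n\log(1/\phi(q))/\log z & \text{if } n^{-1/3}<q\le 1/2. \end{cases} \]
   Context: $\log$ is the natural logarithm. For a positive integer $n$, fix disjoint sets $A$ and $A'$, each of size $n$. $\Omega(n,p)$ is the probability space of posets $P$ on ground set $A\cup A'$ in which $A\subseteq\operatorname{Min}(P)$ (every element of $A$ is minimal) and $A'\subseteq\operatorname{Max}(P)$ (every element of $A'$ is maximal), and such that, independently for each pair $(a,a')\in A\times A'$, one has $a<a'$ in $P$ with probability $p$ (so $a,a'$ are incomparable with probability $q=1-p$). Here $p=p(n)$ may depend on $n$. A statement holds asymptotically almost surely (a.a.s.) if its probability tends to $1$ as $n\to\infty$. The dimension $\dim(P)$ of a poset $P$ is the least positive integer $d$ for which there are linear extensions $L_1,\dots,L_d$ of $P$ such that $x\le y$ in $P$ if and only if $x\le y$ in $L_j$ for each $j\in\{1,\dots,d\}$. *)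

(* Defs.v *)
From HB Require Import structures.
From mathcomp Require Import all_boot all_order all_algebra.
From mathcomp Require Import all_classical all_reals all_analysis.
Import Order.TTheory GRing.Theory Num.Theory.
Import numFieldNormedType.Exports.

Set Implicit Arguments.
Unset Strict Implicit.
Unset Printing Implicit Defensive.

Local Open Scope ring_scope.

(* Posets must be values of a finite type, since they are the outcomes of the
   random experiment; hence this record rather than finPOrderType. *)

Definition is_order (T : finType) (r : rel T) : bool :=
  [&& [forall x, r x x],
      [forall x, forall y, (r x y && r y x) ==> (x == y)] &
      [forall x, forall y, forall z, (r x y && r y z) ==> r x z]].

Record poset (T : finType) := Poset {
  poset_graph : {ffun T * T -> bool};
  poset_axiom : is_order (fun x y => poset_graph (x, y)) }.

HB.instance Definition _ (T : finType) := [isSub for @poset_graph T].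
HB.instance Definition _ (T : finType) := [Finite of poset T by <:].

Definition poset_le (T : finType) (P : poset T) : rel T :=
  fun x y => poset_graph P (x, y).

Definition minimal (T : finType) (P : poset T) (x : T) : bool :=
  [forall y, poset_le P y x ==> (y == x)].

Definition maximal (T : finType) (P : poset T) (x : T) : bool :=
  [forall y, poset_le P x y ==> (y == x)].

Definition linear_extension (T : finType) (P L : poset T) : bool :=
  [forall x, forall y, poset_le P x y ==> poset_le L x y] &&
  [forall x, forall y, poset_le L x y || poset_le L y x].

Definition realizable (T : finType) (P : poset T) (d : nat) : bool :=
  [exists L : {ffun 'I_d -> poset T},
    [forall j, linear_extension P (L j)] &&
    [forall x, forall y, poset_le P x y == [forall j, poset_le (L j) x y]]].

Section realizer_exists.
Variable T : finType.
Implicit Types (P Q L : poset T) (x y z : T).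

Lemma poset_lexx P x : poset_le P x x.
Proof. by case/and3P: (poset_axiom P) => /forallP/(_ x). Qed.

Lemma poset_le_anti P x y : poset_le P x y -> poset_le P y x -> x = y.
Proof.
case/and3P: (poset_axiom P) => _ /forallP/(_ x)/forallP/(_ y)/implyP h _ xy yx.
by apply/eqP/h; apply/andP.
Qed.

Lemma poset_le_trans P y x z :
  poset_le P x y -> poset_le P y z -> poset_le P x z.
Proof.
case/and3P: (poset_axiom P) => _ _.
move=> /forallP/(_ x)/forallP/(_ y)/forallP/(_ z)/implyP h.
by move=> xy yz; apply: h; apply/andP.
Qed.

Lemma poset_add P x y : ~~ poset_le P x y ->
  exists2 Q, (forall u v, poset_le P u v -> poset_le Q u v) & poset_le Q y x.
Proof.
move=> nxy.
pose g := [ffun uv : T * T => poset_le P uv.1 uv.2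
  || (poset_le P uv.1 y && poset_le P x uv.2)].
have gP : is_order (fun u v => g (u, v)).
  apply/and3P; split.
  - by apply/forallP => u; rewrite ffunE poset_lexx.
  - apply/forallP => u; apply/forallP => v; apply/implyP; rewrite !ffunE /=.
    case/andP => /orP[uv|/andP[uy xv]] /orP[vu|/andP[vy xu]].
    + by apply/eqP/(poset_le_anti uv vu).
    + by case/negP: nxy; apply: poset_le_trans xu (poset_le_trans uv vy).
    + by case/negP: nxy; apply: poset_le_trans xv (poset_le_trans vu uy).
    + by case/negP: nxy; apply: poset_le_trans xv vy.
  - apply/forallP => u; apply/forallP => v; apply/forallP => w; apply/implyP.
    rewrite !ffunE /=.
    case/andP => /orP[uv|/andP[uy xv]] /orP[vw|/andP[vy xw]].
    + by rewrite (poset_le_trans uv vw).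
    + by rewrite (poset_le_trans uv vy) xw orbT.
    + by rewrite uy (poset_le_trans xv vw) orbT.
    + by rewrite uy xw orbT.
exists (Poset gP) => [u v uv|]; rewrite /poset_le /= ffunE /= ?uv//.
by rewrite !poset_lexx orbT.
Qed.

Lemma linear_extension_exists P :
  exists L, linear_extension P L.
Proof.
pose ext Q := [forall x, forall y, poset_le P x y ==> poset_le Q x y].
have extP Q : reflect (forall x y, poset_le P x y -> poset_le Q x y) (ext Q).
  by apply: (iffP forallP) => [h x y|h x];
    [exact/implyP/(forallP (h x)) | apply/forallP => y; exact/implyP/h].
have PP : ext P by apply/extP.
pose F Q := #|[pred uv : T * T | poset_le Q uv.1 uv.2]|.
case: (@arg_maxnP _ P ext F PP) => Q /extP PQ Qmax.
exists Q; apply/andP; split; first exact/extP.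
apply/forallP => x; apply/forallP => y; apply/contraT; rewrite negb_or.
case/andP => nxy nyx; have [Q' QQ' Q'yx] := poset_add nxy.
have /Qmax : ext Q' by apply/extP => u v /PQ/QQ'.
rewrite /F /= leqNgt => /negP[]; apply/fintype.proper_card/fintype.properP; split.
  by apply/fintype.subsetP => -[u v]; rewrite !inE => /QQ'.
by exists (y, x); rewrite !inE.
Qed.

Lemma realizer_exists P : exists d, (0 < d)%N && realizable P d.
Proof.
pose A := [pred L | linear_extension P L].
have lext L : L \in A -> forall x y, poset_le P x y -> poset_le L x y.
  by case/andP => /forallP h _ x y; move/forallP: (h x) => /(_ y)/implyP.
exists #|A|; apply/andP; split.
  by have [L PL] := linear_extension_exists P; apply/card_gt0P; exists L.
apply/existsP; exists [ffun j => enum_val j]; apply/andP; split.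
  by apply/forallP => j; rewrite ffunE; exact: (enum_valP j).
apply/forallP => x; apply/forallP => y; apply/eqP; apply/idP/idP => [xy|/forallP h].
  by apply/forallP => j; rewrite ffunE; exact: lext (enum_valP j) _ _ xy.
apply/contraT => nxy; have [Q PQ Qyx] := poset_add nxy.
have [L QL] := linear_extension_exists Q.
have QLle u v : poset_le Q u v -> poset_le L u v.
  by case/andP: QL => /forallP/(_ u)/forallP/(_ v)/implyP.
have PL : L \in A.
  case/andP: QL => _ tot; apply/andP; split => //.
  by apply/forallP => u; apply/forallP => v; apply/implyP => /PQ/QLle.
have := h (enum_rank_in PL L); rewrite ffunE enum_rankK_in// => Lxy.
have xy := poset_le_anti Lxy (QLle _ _ Qyx).
by rewrite -xy poset_lexx in nxy.
Qed.

End realizer_exists.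

Definition poset_dim (T : finType) (P : poset T) : nat :=
  ex_minn (realizer_exists P).

(* The ground set: [inl] tags the elements of A, [inr] those of A'. *)
Definition ground (n : nat) : finType := ('I_n + 'I_n)%type.

Definition Omega (n : nat) : {set poset (ground n)} :=
  [set P | [forall a, minimal P (inl a)] && [forall a', maximal P (inr a')]].

(* [inl a] and [inr a'] are distinct, so [poset_le] between them is strict.
   A member of [Omega n] is determined by these n ^ 2 comparabilities, and
   independence makes its probability the product of theirs. *)
Definition Omega_mass (R : realType) (n : nat) (p : R) (P : poset (ground n)) : R :=
  \prod_(a < n) \prod_(a' < n)
    (if poset_le P (inl a) (inr a') then p else 1 - p).

Definition Omega_prob (R : realType) (n : nat) (p : R)
    (E : pred (poset (ground n))) : R :=
  \sum_(P in Omega n | E P) Omega_mass p P.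

Definition phi (R : realType) (q : R) : R :=
  limn (fun N : nat => \prod_(1 <= i < N.+1) (1 - q ^+ i)).

Definition zfun (R : realType) (n : nat) (q : R) : R :=
  n%:R ^+ 2 * q * ln (1 / phi q).

(* The lower end of each range of q is the failure of the preceding test; that
   of the first range is a hypothesis of the theorem. *)
Definition dim_bound (R : realType) (eps : R) (n : nat) (q : R) : R :=
  if q <= n%:R `^ (- 2^-1) * ln n%:R then
    n%:R - (2 - eps) * ln (q * n%:R) / q
  else if q <= n%:R `^ (- 3^-1) then
    n%:R - q * n%:R / (2 * ln (q * n%:R))
  else
    n%:R - n%:R * ln (1 / phi q) / ln (zfun n q).

(* Main.v *)
Require Import Defs.
From HB Require Import structures.
From mathcomp Require Import all_boot all_order all_algebra.
From mathcomp Require Import all_classical all_reals all_analysis.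
From mathcomp Require Import zify ring lra.
Import mathcomp.boot.fintype mathcomp.boot.finset.
Import Order.TTheory GRing.Theory Num.Theory.
Import numFieldNormedType.Exports.

(** A poset of [Omega n] amounts to the bipartite graph [H] of its incomparable
    pairs [(a, b)], where [a] is minimal and [b] maximal; every pair belongs to
    [H] independently with probability [q]. The pairs that a linear extension
    puts in the order [b < a] form a chain graph, that is, they are given by
    heights as the pairs with [g b < f a], and every chain graph inside [H] is
    reversed by a linear extension. Hence the dimension is at most the number of
    chain graphs needed to cover [H], provided that of any two vertices of a side
    each has a neighbour that the other lacks ([dim_le_cover]). The proviso fails
    with probability at most [2 n^2 e^(-q(1-q)n)] ([sides_separated_prob]).

    The [n] stars at the minimal elements cover [H]. To save [t] of them, fix
    sets [S] and [T] of [t] vertices in the two sides and a perfect matching [mu]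
    of [H] between their complements, which exists with high probability by
    Hall's theorem. The stars at [x] and at [mu x] lie in a common chain graph, so
    [n - t] chain graphs cover all edges outside [S x T] ([cover_of_matching]).
    The three ranges of [q] differ in how the edges inside [S x T] are treated;
    [l] stands for [ln (q n)].

    For small [q] there are none: some box [S x T] of side about [2 l / q] is
    empty ([empty_box_prob]). This is a second moment computation over the boxes
    whose sides are transversals of a partition into blocks. If
    [q < n^(-3/5)] it may only show that the probability is at least [e^(-u)] for
    some large [u]. But changing the edges at one vertex changes the least number
    of chain graphs by at most one, so this number is concentrated, and an event
    of that probability determines it up to the [(eps / 4) l / q] additional
    chain graphs that the bound allows ([cover_number_concentration],
    [empty_box_low]).

    For larger [q] the sets [S] and [T] are arbitrary, and the chain graphs are
    enlarged to cover the edges of [S x T]. If [s_1, ..., s_K] are elements of [S]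
    adjacent to [mu x], the chain graph of [x] can also contain the pairs
    [(s_k, y)] for which [y] is adjacent to [x, s_1, ..., s_k]. An edge [(s, y)]
    is thus covered by a tuple that has [s] at position [k] with probability
    [q^k]. If [s] occurs [N] times at each position, and these tuples share no
    earlier entries, the edge remains uncovered with probability
    [(prod_(k <= K) (1 - q^k))^N]. Such tuples are the translates of a
    difference family in [Z / t], and Hall's theorem assigns them to distinct
    vertices adjacent to all their entries, as long as there are fewer than
    [n - t] of them ([tuple_cover_prob]). So [N] can be nearly [n / t], and with
    high probability no edge remains uncovered if
    [t^2 q (prod_(k <= K) (1 - q^k))^N] tends to [0]. For intermediate [q] single
    entries, [K = 1], suffice and [t] is about [q n / (2 l)]. For large [q] the
    least [K] with [q^K <= 1 / ln n] makes the product as good as [phi q], and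
    [t] is about [n ln (1 / phi q) / ln z]. *)

Set Implicit Arguments.
Unset Strict Implicit.
Unset Printing Implicit Defensive.
Local Open Scope ring_scope.

(** * Hall's theorem *)

(** The argument of Rado: the neighbourhoods are thinned out until each of them
    is a singleton. *)
Lemma hall_marriage (T1 T2 : finType) (X : {set T1}) (r : T1 -> T2 -> bool) :
  (forall I : {set T1}, I \subset X ->
     (#|I| <= #|[set y | [exists x in I, r x y]]|)%N) ->
  exists f : T1 -> option T2,
    {in X &, injective f} /\
    forall x, x \in X -> exists2 y, f x = Some y & r x y.
Proof.
pose nb (N : {ffun T1 -> {set T2}}) (I : {set T1}) := (\bigcup_(x in I) N x)%SET.
pose hall N := forall I : {set T1}, I \subset X -> (#|I| <= #|nb N I|)%N.
suff main : forall k (N : {ffun T1 -> {set T2}}), (\sum_x #|N x| <= k)%N ->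
    hall N -> exists f : T1 -> option T2, {in X &, injective f} /\
    forall x, x \in X -> exists2 y, f x = Some y & y \in N x.
  move=> hr; pose N := [ffun x => [set y | r x y]].
  have [|f [injf fN]] := main _ N (leqnn _).
    move=> I /hr; rewrite /nb; congr (_ <= _)%N; apply: eq_card => y.
    rewrite inE; apply/exists_inP/bigcupP => -[x xI].
      by move=> rxy; exists x; rewrite // ffunE inE.
    by rewrite ffunE inE => rxy; exists x.
  by exists f; split => // x /fN[y fx]; rewrite ffunE inE; exists y.
elim=> [|k IH] N hN Nhall.
  exists (fun=> None); split => [x y xX|x xX].
    have := Nhall [set x]; rewrite sub1set cards1 => /(_ xX).
    rewrite /nb big_set1; have : (#|N x| <= \sum_x #|N x|)%N by rewrite (bigD1 x) //= leq_addr.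
    by move=> h1 h2; have := leq_trans h2 (leq_trans h1 hN).
  have := Nhall [set x]; rewrite sub1set cards1 => /(_ xX).
  rewrite /nb big_set1; have : (#|N x| <= \sum_x #|N x|)%N by rewrite (bigD1 x) //= leq_addr.
  by move=> h1 h2; have := leq_trans h2 (leq_trans h1 hN).
have [/exists_inP[x xX N2]|] := boolP [exists x in X, (1 < #|N x|)%N]; last first.
  rewrite negb_exists_in => /forall_inP N1.
  exists (fun x => [pick y in N x]).
  have NE x : x \in X -> exists2 y, [pick y in N x] = Some y & N x = [set y].
    move=> xX; have := Nhall [set x]; rewrite sub1set cards1 => /(_ xX).
    rewrite /nb big_set1 => h; have : #|N x| == 1%N.
      by rewrite eqn_leq h andbT leqNgt N1.
    case/cards1P => y Ny; exists y => //; rewrite Ny; case: pickP => [z|/(_ y)].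
      by rewrite inE => /eqP->.
    by rewrite inE eqxx.
  split => [x y xX yX|x /NE[y Ey Ny]]; last by exists y; rewrite // Ny inE.
  have [u -> Nu] := NE x xX; have [v -> Nv] := NE y yX => -[uv].
  apply/eqP/negPn/negP => xy; have := Nhall [set x; y].
  rewrite subUset !sub1set xX yX cards2 xy => /(_ isT).
  by rewrite /nb bigcup_setU !big_set1 Nu Nv uv setUid cards1.
(* Of two neighbours of [x], one can be dropped without violating Hall's
   condition: two violators would contradict the submodularity of the number
   of neighbours. *)
pose drop y : {ffun T1 -> {set T2}} := [ffun z => if z == x then N x :\ y else N z].
have dropS y z : drop y z \subset N z.
  by rewrite ffunE; case: eqP => [->|]//; rewrite subD1set.
have sumdrop y : y \in N x -> (\sum_z #|drop y z| <= k)%N.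
  move=> yN; rewrite -ltnS; apply: leq_trans hN.
  rewrite (bigD1 x) //= [X in (_ < X)%N](bigD1 x) //= -addSn.
  rewrite leq_add//; first by rewrite ffunE eqxx [X in (_ <= X)%N](cardsD1 y) yN.
  by apply: leq_sum => z _; apply: subset_leq_card.
have useIH y : y \in N x -> hall (drop y) -> exists f : T1 -> option T2, {in X &, injective f} /\
    forall x, x \in X -> exists2 y, f x = Some y & y \in N x.
  move=> yN /(IH _ (sumdrop y yN))[f [fi fN]]; exists f; split => // z /fN[w fz wN].
  by exists w => //; exact: (subsetP (dropS y z)).
have /card_gt1P[y1 [y2 [y1N y2N y12]]] := N2.
case: (pselect (hall (drop y1))) => [|nh1]; first exact: useIH.
case: (pselect (hall (drop y2))) => [|nh2]; first exact: useIH.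
exfalso.
have viol y : y \in N x -> ~ hall (drop y) ->
    exists2 I : {set T1}, (I \subset X) && (x \notin I) &
      (#|nb N I :|: (N x :\ y)| <= #|I|)%N.
  move=> yN; rewrite -existsNP => -[I] /not_implyP[IX] /negP; rewrite -ltnNge => hI.
  have xI : x \in I.
    apply/negPn/negP => xI; have := Nhall I IX; rewrite leqNgt => /negP; apply.
    suff -> : nb N I = nb (drop y) I by [].
    apply: eq_bigr => z zI; rewrite ffunE; case: eqP => // zx.
    by rewrite -zx zI in xI.
  exists (I :\ x); first by rewrite !inE eqxx /= andbT (subset_trans (subD1set _ _)).
  have -> : nb N (I :\ x) :|: (N x :\ y) = nb (drop y) I.
    rewrite [RHS](big_setD1 x) //= ffunE eqxx setUC; congr (_ :|: _).
    by apply: eq_bigr => z; rewrite !inE ffunE => /andP[/negbTE->].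
  by rewrite -ltnS; apply: leq_trans hI _; rewrite (cardsD1 x) xI.
have [I1 /andP[I1X xI1] h1] := viol _ y1N nh1.
have [I2 /andP[I2X xI2] h2] := viol _ y2N nh2.
set A1 := nb N I1 :|: _ in h1; set A2 := nb N I2 :|: _ in h2.
have hU : (#|x |: (I1 :|: I2)| <= #|A1 :|: A2|)%N.
  apply: leq_trans (Nhall _ _) _.
    by rewrite !subUset sub1set xX I1X.
  apply: subset_leq_card; rewrite /nb !bigcup_setU big_set1.
  apply/subsetP => z; rewrite !inE.
  case/or3P => [zx|->|->]; rewrite ?orbT//.
  by rewrite zx !andbT; case: (eqVneq z y1) => [->|]; rewrite ?y12 ?orbT.
have hI : (#|I1 :&: I2| <= #|A1 :&: A2|)%N.
  apply: leq_trans (Nhall _ _) _.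
    by apply: subset_trans I1X; rewrite subsetIl.
  apply: subset_leq_card; apply/subsetP => z /bigcupP[w].
  rewrite !inE => /andP[w1 w2] zw.
  by apply/andP; split; apply/orP; left; apply/bigcupP; exists w.
have := leq_add hU hI; rewrite cardsUI => h.
have := leq_trans h (leq_add h1 h2).
by rewrite cardsU1 !inE negb_or xI1 xI2 /= -addnA cardsUI add1n ltnn.
Qed.

(** * Covers by chain graphs and the dimension of a bipartite poset *)

Definition graph n := {ffun 'I_n * 'I_n -> bool}.

(** A chain graph is encoded by heights of the vertices: its edges are the pairs
    with [g b < f a], so that the neighbourhoods of one side are nested. *)
Definition chain_in n (H : graph n) (f g : 'I_n -> nat) :=
  forall a b, (g b < f a)%N -> H (a, b).

Definition coverable n (H : graph n) (d : nat) :=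
  exists f g : 'I_d -> 'I_n -> nat,
    (forall i, chain_in H (f i) (g i)) /\
    (forall a b, H (a, b) -> exists i, (g i b < f i a)%N).

Definition sides_separated n (H : graph n) :=
  (forall a a', a != a' -> exists b, H (a, b) && ~~ H (a', b)) /\
  (forall b b', b != b' -> exists a, H (a, b) && ~~ H (a, b')).

Definition poset_rel n (H : graph n) : {ffun ground n * ground n -> bool} :=
  [ffun xy : ground n * ground n => (xy.1 == xy.2) ||
    match xy with (inl a, inr b) => ~~ H (a, b) | _ => false end].

Lemma poset_relP n (H : graph n) : is_order (fun x y => poset_rel H (x, y)).
Proof.
apply/and3P; split.
- by apply/forallP => x; rewrite ffunE eqxx.
- apply/forallP => x; apply/forallP => y; apply/implyP; rewrite !ffunE /=.
  by case: x y => [a|b] [a'|b']; rewrite ?orbF// => /andP[] //; rewrite orbF.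
- apply/forallP => x; apply/forallP => y; apply/forallP => z; apply/implyP.
  rewrite !ffunE /=.
  case/andP => /orP[/eqP->|xy] /orP[/eqP<-|yz]; rewrite ?eqxx ?yz ?xy ?orbT//.
  by case: x y z xy yz => [a|b] [a'|b'] [a''|b''].
Qed.

Definition poset_of n (H : graph n) : poset (ground n) := Poset (poset_relP H).

Lemma poset_ofE n (H : graph n) x y : poset_le (poset_of H) x y = (x == y) ||
    match x, y with inl a, inr b => ~~ H (a, b) | _, _ => false end.
Proof. by rewrite /poset_le /= ffunE. Qed.

Definition incomp n (P : poset (ground n)) : graph n :=
  [ffun ab => ~~ poset_le P (inl ab.1) (inr ab.2)].

Lemma poset_ofK n : cancel (@poset_of n) (@incomp n).
Proof.
by move=> H; apply/ffunP => -[a b]; rewrite ffunE poset_ofE /= negbK.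
Qed.

Lemma poset_of_Omega n (H : graph n) : poset_of H \in Omega n.
Proof.
rewrite inE; apply/andP; split; apply/forallP => a; apply/forallP => y;
  by rewrite poset_ofE; case: y => b /=; rewrite ?orbF ?implybb// eq_sym implybb.
Qed.

Lemma incompK n (P : poset (ground n)) : P \in Omega n -> poset_of (incomp P) = P.
Proof.
rewrite inE => /andP[/forallP mi /forallP ma]; apply/val_inj/ffunP => -[x y] /=.
rewrite ffunE /=; change (poset_graph P (x, y)) with (poset_le P x y).
case: eqVneq => [->|xy] /=; first by rewrite poset_lexx.
have miP a z : z != inl a -> poset_le P z (inl a) = false.
  by move=> za; have /forallP/(_ z) := mi a; rewrite (negbTE za) implybF => /negbTE.
have maP a z : z != inr a -> poset_le P (inr a) z = false.
  by move=> za; have /forallP/(_ z) := ma a; rewrite (negbTE za) implybF => /negbTE.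
case: x y xy => [a|b] [a'|b'] xy; rewrite ?miP// ?maP// 1?eq_sym//.
by rewrite ffunE negbK.
Qed.

Section Extension.
Variables (n : nat) (H : graph n) (f g : 'I_n -> nat).
Hypothesis fg : chain_in H f g.

(** Doubling the heights and adding one on the second side turns [g b < f a] into
    the comparison that puts [inr b] below [inl a], and otherwise [inl a] below
    [inr b]. Ties, which only occur within a side, are broken by the index. *)
Let ht (x : ground n) : nat * nat :=
  match x with inl a => (2 * f a, val a)%N | inr b => (2 * g b + 1, val b)%N end.

Let ler x y := let: (u, v) := ht x in let: (u', v') := ht y in
  (u < u')%N || ((u == u') && (v <= v')%N).

Let gr : {ffun ground n * ground n -> bool} := [ffun xy => ler xy.1 xy.2].

Lemma chain_orderP : is_order (fun x y => gr (x, y)).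
Proof.
apply/and3P; split.
- by apply/forallP => x; rewrite ffunE /ler; case: (ht x) => u v; rewrite eqxx leqnn orbT.
- apply/forallP => x; apply/forallP => y; apply/implyP; rewrite !ffunE /ler /=.
  case: x y => [a|b] [a'|b'] /= h; try (exfalso; lia).
    by apply/eqP; congr inl; apply/val_inj => /=; lia.
  by apply/eqP; congr inr; apply/val_inj => /=; lia.
- apply/forallP => x; apply/forallP => y; apply/forallP => z; apply/implyP.
  rewrite !ffunE /ler /=; case: (ht x) (ht y) (ht z) => [u v] [u' v'] [u'' v''].
  lia.
Qed.

Definition chain_order := Poset chain_orderP.

Lemma chain_order_AB a b : poset_le chain_order (inl a) (inr b) = (f a <= g b)%N.
Proof. by rewrite /poset_le /= ffunE /ler /=; lia. Qed.
Lemma chain_order_AA a a' : (f a < f a')%N ->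
  poset_le chain_order (inl a') (inl a) = false.
Proof. by rewrite /poset_le /= ffunE /ler /=; lia. Qed.
Lemma chain_order_BB b b' : (g b < g b')%N ->
  poset_le chain_order (inr b') (inr b) = false.
Proof. by rewrite /poset_le /= ffunE /ler /=; lia. Qed.

Lemma chain_order_ext : linear_extension (poset_of H) chain_order.
Proof.
apply/andP; split; apply/forallP => x; apply/forallP => y.
  apply/implyP; rewrite poset_ofE => /orP[/eqP->|]; first exact: poset_lexx.
  case: x y => [a|//] [//|b]; rewrite chain_order_AB leqNgt.
  by apply: contra => /fg.
rewrite /poset_le /= !ffunE /ler /=; case: (ht x) (ht y) => [u v] [u' v']; lia.
Qed.

End Extension.

(** The linear extensions that reverse the chain graphs of a cover reverse all
    incomparable pairs across the two sides. They also deal with the pairs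
    inside one side: if [H (a, b)] holds and [H (a', b)] fails, the extension in
    which [inr b] is below [inl a] has [inl a'] below [inr b]. *)
Lemma dim_le_cover n (H : graph n) d : (1 < n)%N -> (0 < d)%N -> sides_separated H -> coverable H d ->
  (poset_dim (poset_of H) <= d)%N.
Proof.
move=> n1 d0 [sepA sepB] [f [g [fg cov]]]; rewrite /poset_dim; case: ex_minnP => k _ kmin.
apply: kmin; rewrite d0 /=; apply/existsP.
exists [ffun i => chain_order (f i) (g i)]; apply/andP; split.
  by apply/forallP => i; rewrite ffunE; exact: chain_order_ext.
have sAA a a' : a != a' -> exists i, poset_le (chain_order (f i) (g i)) (inl a) (inl a') = false.
  move=> /sepA[b /andP[hab hnb]]; have [i gi] := cov _ _ hab; exists i.
  apply: chain_order_AA; apply: leq_ltn_trans gi; rewrite leqNgt.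
  by apply: contra hnb => /fg.
have sBB b b' : b != b' -> exists i, poset_le (chain_order (f i) (g i)) (inr b') (inr b) = false.
  move=> /sepB[a /andP[hab hnb]]; have [i gi] := cov _ _ hab; exists i.
  apply: chain_order_BB; apply: leq_trans gi _; rewrite leqNgt.
  by apply: contra hnb => /fg.
apply/forallP => x; apply/forallP => y; apply/eqP; apply/idP/forallP => [xy i|h].
  rewrite ffunE; have /andP[/forallP/(_ x)/forallP/(_ y)/implyP] := chain_order_ext (fg i).
  by move=> h _; apply: h.
have {}h i : poset_le (chain_order (f i) (g i)) x y by have := h i; rewrite ffunE.
rewrite poset_ofE; case: eqVneq => //= xy; move: x y xy h => [a|b] [a'|b'] xy h //.
- by have [|i] := sAA a a'; [apply: contraNneq xy => ->|rewrite h].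
- by apply/negP => /cov[i]; have := h i; rewrite chain_order_AB leqNgt => /negbTE->.
- (* Some [inl a] is below [inr b], hence below [inl a'] in every extension. *)
  have [b' b'b] : exists b', b' != b.
    have n0 : (0 < n)%N by rewrite ltnW.
    by case: (eqVneq b (Ordinal n0)) => [->|bn]; [exists (Ordinal n1)|exists (Ordinal n0); rewrite eq_sym].
  have [a /andP[_ hab]] := sepB _ _ b'b.
  have ab i : poset_le (chain_order (f i) (g i)) (inl a) (inr b).
    by rewrite chain_order_AB leqNgt; apply: contra hab => /fg.
  have [aa'|/sAA[i]] := eqVneq a a'; last by rewrite (poset_le_trans (ab i) (h i)).
  have i := Ordinal d0; have := poset_le_anti (ab i); rewrite aa' => /(_ (h i)).
  by [].
- by have [|i] := sBB b' b; [apply: contraNneq xy => ->|rewrite h].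
Qed.

Section ChainOfPath.
Variables (n : nat) (H : graph n) (a0 b0 : 'I_n) (s : seq 'I_n).

Definition path_f (a : 'I_n) : nat :=
  if a == a0 then (size s).+3 else
  if a \in s then (size s + 2 - index a s)%N else H (a, b0).

Definition path_g (y : 'I_n) : nat :=
  if y == b0 then 0%N else
  if H (a0, y) then (size s + 2 - find (fun x => ~~ H (x, y)) s)%N
  else (size s).+3.

(** The neighbourhoods are nested: that of [a0] is the one in [H]; that of an
    element of [s] consists of the neighbours of [a0] that are adjacent to all
    entries of [s] up to this element; that of any other neighbour of [b0] is
    [b0] alone, which belongs to all of them. *)
Lemma path_chain : H (a0, b0) -> {in s, forall a, H (a, b0)} ->
  chain_in H path_f path_g.
Proof.
move=> h0 hs a y; rewrite /path_f /path_g.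
have fs := find_size (fun x => ~~ H (x, y)) s.
case: (eqVneq a a0) => [->|aa0]; case: (eqVneq y b0) => [->|yb0] //.
- by case: ifP => // _; rewrite ltnn.
- by case: ifPn => [/hs|_] //; case: (H _).
- have [as_|nas] := boolP (a \in s).
    case: ifP => [h1 lt|_ lt]; last by exfalso; lia.
    have : (index a s < find (fun x => ~~ H (x, y)) s)%N by lia.
    by move=> /(before_find a0)/negbFE; rewrite nth_index.
  have H1 : (H (a, b0) <= 1)%N by case: (H _).
  case: ifP => _ lt; last by have := leq_trans lt H1.
  have := leq_trans lt H1; rewrite ltnS leqn0 subn_eq0 leqNgt.
  by rewrite (leq_ltn_trans fs)// addn2.
Qed.

Lemma path_cover_left y : H (a0, y) -> (path_g y < path_f a0)%N.
Proof. by rewrite /path_f /path_g eqxx => ->; case: eqP => // _; lia. Qed.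

Lemma path_cover_right a : H (a, b0) -> (path_g b0 < path_f a)%N.
Proof.
rewrite /path_f /path_g eqxx => ->; case: eqP => // _; case: ifP => // as_.
by rewrite subn_gt0 (leq_ltn_trans (index_size _ _))// addn2.
Qed.

Lemma path_cover_mid a y : a \in s -> H (a0, y) ->
  all (fun x => H (x, y)) (take (index a s).+1 s) -> (path_g y < path_f a)%N.
Proof.
rewrite /path_f /path_g => as_ -> al; case: (eqVneq y b0) => [_|_].
  by case: eqP => // _; rewrite as_ subn_gt0 (leq_ltn_trans (index_size _ _))// addn2.
have fs := find_size (fun x => ~~ H (x, y)) s.
case: eqP => _; first by lia.
rewrite as_; suff lt : (index a s < find (fun x => ~~ H (x, y)) s)%N.
  by apply: ltn_sub2l; rewrite // addn2 ltnS ltnW// ltnS index_size.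
rewrite ltnNge; apply/negP => fle.
have ins : (find (fun x => ~~ H (x, y)) s < size s)%N by rewrite (leq_ltn_trans fle)// index_mem.
have hh : has (fun x => ~~ H (x, y)) s by rewrite has_find.
have := nth_find a0 hh; apply/negP/negPn.
apply: (allP al); rewrite -(nth_take a0 (n0 := (index a s).+1)) ?ltnS//.
by apply: mem_nth; rewrite size_take; case: ifP => // _; rewrite ltnS.
Qed.

End ChainOfPath.

(** One chain graph for every edge [(x, mu x)] of the matching: it contains the
    stars at both ends, and the sequence [s x] is used to cover edges between
    the complements of [X] and [Y]. *)
Lemma cover_of_matching n (H : graph n) (X Y : {set 'I_n})
    (mu : 'I_n -> 'I_n) (s : 'I_n -> seq 'I_n) :
  #|X| = #|Y| -> {in X &, injective mu} ->
  {in X, forall x, mu x \in Y /\ H (x, mu x)} ->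
  (forall x a, x \in X -> a \in s x -> H (a, mu x)) ->
  (forall a y, a \notin X -> y \notin Y -> H (a, y) ->
     exists x, [/\ x \in X, a \in s x, H (x, y) &
       all (fun a' => H (a', y)) (take (index a (s x)).+1 (s x))]) ->
  coverable H #|X|.
Proof.
move=> XY muI muX sX cov.
exists (fun i => path_f H (enum_val i) (mu (enum_val i)) (s (enum_val i))).
exists (fun i => path_g H (enum_val i) (mu (enum_val i)) (s (enum_val i))); split.
  move=> i; have iX := enum_valP i; apply: path_chain; first by case: (muX _ iX).
  by move=> a; apply: sX.
have muY : mu @: X = Y.
  apply/eqP; rewrite eqEcard card_in_imset// XY leqnn andbT.
  by apply/subsetP => y /imsetP[x /muX[h _] ->].
move=> a y hay; have [aX|aX] := boolP (a \in X).
  by exists (enum_rank_in aX a); rewrite enum_rankK_in//; exact: path_cover_left.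
have [yY|yY] := boolP (y \in Y).
  move: yY; rewrite -muY => /imsetP[x xX yx]; exists (enum_rank_in xX x).
  by rewrite enum_rankK_in// -yx; apply: path_cover_right.
have [x [xX as_ hxy al]] := cov _ _ aX yY hay; exists (enum_rank_in xX x).
by rewrite enum_rankK_in//; exact: path_cover_mid.
Qed.

Definition matchable n (H : graph n) (X Y : {set 'I_n}) :=
  exists mu : 'I_n -> 'I_n, {in X &, injective mu} /\
    {in X, forall x, mu x \in Y /\ H (x, mu x)}.

Lemma subset_of_card (T : finType) (A : {set T}) k : (k <= #|A|)%N ->
  exists2 B : {set T}, B \subset A & #|B| = k.
Proof.
move=> kA; exists [set x in take k (enum A)].
  by apply/subsetP => x; rewrite inE => /mem_take; rewrite mem_enum.
rewrite cardsE; have /card_uniqP -> : uniq (take k (enum A)) by rewrite take_uniq// enum_uniq.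
by rewrite size_take -cardE; case: ltngtP kA.
Qed.

(** A violator of Hall's condition and its common non-neighbours form the hole. *)
Lemma matching_or_hole n (H : graph n) (X Y : {set 'I_n}) : #|X| = #|Y| ->
  matchable H X Y \/ exists I J : {set 'I_n},
    [/\ I \subset X, J \subset Y, (#|I| + #|J|)%N = #|Y|.+1 &
      forall x y, x \in I -> y \in J -> ~~ H (x, y)].
Proof.
move=> XY.
have [hall|] := pselect (forall I : {set 'I_n}, I \subset X ->
  (#|I| <= #|[set y | [exists x in I, (y \in Y) && H (x, y)]]|)%N).
  left; have [f [fi fX]] := hall_marriage hall.
  exists (fun x => odflt x (f x)); split => [x y xX yX|x xX].
    have [u fu _] := fX _ xX; have [v fv _] := fX _ yX.
    by rewrite fu fv /= => uv; apply: fi => //; rewrite fu fv uv.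
  by have [u -> /andP[uY hu]] := fX _ xX.
rewrite -existsNP => -[I] /not_implyP[IX /negP]; rewrite -ltnNge => hI; right.
set N := [set _ | _] in hI.
have NY : N \subset Y by apply/subsetP => y; rewrite inE => /exists_inP[x _ /andP[]].
have IY : (#|I| <= #|Y|)%N by rewrite -XY subset_leq_card.
have [|J JYN cJ] := @subset_of_card _ (Y :\: N) (#|Y|.+1 - #|I|).
  by rewrite cardsD (setIidPr NY); lia.
exists I, J; split => //.
- exact: subset_trans JYN (subsetDl _ _).
- by rewrite cJ subnKC// ltnW.
- move=> x y xI yJ; have := subsetP JYN _ yJ; rewrite !inE => /andP[+ yY].
  by rewrite negb_exists_in => /forall_inP/(_ x xI); rewrite yY.
Qed.


(** * Independent random bits *)

Section RandomBits.
Variables (R : realType) (I : finType) (q : R).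
Implicit Types (F G : {ffun I -> bool} -> R) (f g : {ffun I -> bool}) (D : {set I}).

Definition bits_mass f : R := \prod_i (if f i then q else 1 - q).

Definition Ex F : R := \sum_f bits_mass f * F f.

Definition Pr (E : {ffun I -> bool} -> Prop) : R := Ex (fun f => `[< E f >]%:R).

Definition mix D f g : {ffun I -> bool} := [ffun i => if i \in D then f i else g i].

Definition depends_on D F := forall f g, {in D, f =1 g} -> F f = F g.

Lemma Ex_ext F G : F =1 G -> Ex F = Ex G.
Proof. by move=> FG; apply: eq_bigr => f _; rewrite FG. Qed.

Lemma bits_mass_sum : \sum_f bits_mass f = 1.
Proof.
rewrite /bits_mass -(bigA_distr_bigA (fun _ (b : bool) => if b then q else 1 - q)).
by rewrite big1// => i _; rewrite big_bool /= addrC subrK.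
Qed.

Lemma Ex_cst (c : R) : Ex (fun=> c) = c.
Proof. by rewrite /Ex -big_distrl /= bits_mass_sum mul1r. Qed.

Lemma ExZ (c : R) F : Ex (fun f => c * F f) = c * Ex F.
Proof. by rewrite /Ex big_distrr /=; apply: eq_bigr => f _; rewrite mulrCA. Qed.

Lemma ExD F G : Ex (fun f => F f + G f) = Ex F + Ex G.
Proof. by rewrite /Ex -big_split /=; apply: eq_bigr => f _; rewrite mulrDr. Qed.

Lemma ExB F G : Ex (fun f => F f - G f) = Ex F - Ex G.
Proof.
rewrite /Ex -sumrB /=; apply: eq_bigr => f _; by rewrite mulrBr.
Qed.

Lemma Ex_sum (J : finType) (P : pred J) (F : J -> {ffun I -> bool} -> R) :
  Ex (fun f => \sum_(j | P j) F j f) = \sum_(j | P j) Ex (F j).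
Proof.
rewrite /Ex exchange_big /=; apply: eq_bigr => f _; by rewrite big_distrr.
Qed.

(** Swapping two independent samples outside [D] preserves their joint mass, so
    the bits outside [D] may be resampled. *)
Lemma Ex_mix D F : Ex (fun f => Ex (fun g => F (mix D f g))) = Ex F.
Proof.
rewrite /Ex; under eq_bigr do rewrite big_distrr /=.
rewrite pair_big /=.
pose sw (p : {ffun I -> bool} * {ffun I -> bool}) := (mix D p.1 p.2, mix D p.2 p.1).
have swK : involutive sw.
  by move=> [f g]; rewrite /sw /=; congr (_, _); apply/ffunP => i; rewrite !ffunE; case: (i \in D).
rewrite (reindex_inj (inv_inj swK)) /=.
have E p : bits_mass (mix D p.1 p.2) * (bits_mass (mix D p.2 p.1) *
    F (mix D (mix D p.1 p.2) (mix D p.2 p.1))) = (bits_mass p.1 * F p.1) * bits_mass p.2.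
  have -> : mix D (mix D p.1 p.2) (mix D p.2 p.1) = p.1.
    by apply/ffunP => i; rewrite !ffunE; case: (i \in D).
  rewrite mulrA [RHS]mulrAC; congr (_ * _); rewrite /bits_mass -!big_split /=.
  by apply: eq_bigr => i _; rewrite !ffunE; case: (i \in D); rewrite // mulrC.
under eq_bigr do rewrite E.
rewrite -(pair_big predT predT (fun f g => bits_mass f * F f * bits_mass g)) /=.
by apply: eq_bigr => f _; rewrite -big_distrr /= bits_mass_sum mulr1.
Qed.

Lemma Ex_indep D F G : depends_on D F -> depends_on (~: D) G ->
  Ex (fun f => F f * G f) = Ex F * Ex G.
Proof.
move=> dF dG; rewrite -(Ex_mix D).
have E f g : F (mix D f g) * G (mix D f g) = F f * G g.
  congr (_ * _); first by apply: dF => i iD; rewrite ffunE iD.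
  by apply: dG => i; rewrite inE ffunE => /negbTE->.
under Ex_ext do under Ex_ext do rewrite E.
under Ex_ext do rewrite ExZ mulrC; by rewrite ExZ mulrC.
Qed.

Lemma depends_prod (J : eqType) (r : seq J) (D : J -> {set I})
    (F : J -> {ffun I -> bool} -> R) (A : {set I}) :
  {in r, forall j, depends_on (D j) (F j) /\ D j \subset A} ->
  depends_on A (fun f => \prod_(j <- r) F j f).
Proof.
move=> h f g fg; apply: eq_big_seq => j /h[dj DA].
by apply: dj => i /(subsetP DA)/fg.
Qed.

Lemma Ex_indep_prod (J : eqType) (r : seq J) (D : J -> {set I})
    (F : J -> {ffun I -> bool} -> R) : uniq r ->
  {in r, forall j, depends_on (D j) (F j)} ->
  {in r &, forall j k, j != k -> [disjoint D j & D k]} ->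
  Ex (fun f => \prod_(j <- r) F j f) = \prod_(j <- r) Ex (F j).
Proof.
elim: r => [|j r IH] /=; first by move=> _ _ _; under Ex_ext do rewrite big_nil; rewrite Ex_cst big_nil.
move=> /andP[jr ur] dF disj; rewrite big_cons -IH//; first last.
- by move=> k l kr lr; apply: disj; rewrite inE ?kr ?lr orbT.
- by move=> k kr; apply: dF; rewrite inE kr orbT.
under Ex_ext do rewrite big_cons.
apply: (@Ex_indep (D j)); first by apply: dF; rewrite mem_head.
apply: (@depends_prod _ r D) => k kr; split; first by apply: dF; rewrite inE kr orbT.
rewrite -disjoints_subset; apply: disj; rewrite ?inE ?eqxx ?kr ?orbT//.
by apply: contraNneq jr => <-.
Qed.

Lemma Ex_bit i (u : bool -> R) : Ex (fun f => u (f i)) = q * u true + (1 - q) * u false.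
Proof.
rewrite /Ex.
have E f : bits_mass f * u (f i) =
    \prod_j (if f j then q * (if j == i then u true else 1) else (1 - q) * (if j == i then u false else 1)).
  rewrite /bits_mass (bigD1 i) //= [RHS](bigD1 i) //= eqxx mulrAC; congr (_ * _).
    by case: (f i).
  by apply: eq_bigr => j /negbTE->; case: (f j); rewrite mulr1.
under eq_bigr do rewrite E.
rewrite -(bigA_distr_bigA (fun j (b : bool) => if b then q * (if j == i then u true else 1) else (1 - q) * (if j == i then u false else 1))).
rewrite (bigD1 i) //= big_bool /= eqxx [X in _ * X]big1 ?mulr1//.
by move=> j /negbTE ->; rewrite big_bool /= !mulr1 addrC subrK.
Qed.

Lemma Ex_prod_bits (A : {set I}) (u : bool -> R) :
  Ex (fun f => \prod_(i in A) u (f i)) = (q * u true + (1 - q) * u false) ^+ #|A|.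
Proof.
under Ex_ext do rewrite -big_enum /=.
rewrite (@Ex_indep_prod _ _ (fun i => [set i])) ?enum_uniq//.
- under eq_bigr do rewrite Ex_bit.
  by rewrite big_enum prodr_const.
- by move=> i _ f g h; rewrite h// inE.
- by move=> i j _ _ ij; rewrite disjoints1 inE.
Qed.

Section Probability.
Hypothesis q01 : 0 <= q <= 1.

Lemma bits_mass_ge0 f : 0 <= bits_mass f.
Proof.
by apply: prodr_ge0 => i _; case: ifP; case/andP: q01 => ? ?; rewrite ?subr_ge0.
Qed.

Lemma le_Ex F G : (forall f, F f <= G f) -> Ex F <= Ex G.
Proof. by move=> FG; apply: ler_sum => f _; rewrite ler_wpM2l// bits_mass_ge0. Qed.

Lemma Ex_ge0 F : (forall f, 0 <= F f) -> 0 <= Ex F.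
Proof. by move=> F0; rewrite -(Ex_cst 0); apply: le_Ex. Qed.

Lemma Pr_ge0 E : 0 <= Pr E.
Proof. by apply: Ex_ge0 => f; rewrite ler0n. Qed.

Lemma le_Pr (E E' : {ffun I -> bool} -> Prop) : (forall f, E f -> E' f) -> Pr E <= Pr E'.
Proof.
move=> EE; apply: le_Ex => f; rewrite ler_nat.
by case: asboolP => // Ef; rewrite asboolT//; exact: EE.
Qed.

Lemma Pr_le1 E : Pr E <= 1.
Proof. by rewrite -[leRHS](Ex_cst 1); apply: le_Ex => f; rewrite lern1 leq_b1. Qed.

Lemma PrC E : Pr (fun f => ~ E f) = 1 - Pr E.
Proof.
rewrite /Pr -[X in X - _](Ex_cst 1) -ExB; apply: Ex_ext => f.
by rewrite asbool_neg; case: asboolP; rewrite ?subrr ?subr0.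
Qed.

Lemma Pr_or E E' : Pr (fun f => E f \/ E' f) <= Pr E + Pr E'.
Proof.
rewrite /Pr -ExD; apply: le_Ex => f; rewrite asbool_or -natrD ler_nat.
by case: (asbool (E f)); case: asbool.
Qed.

(** The weights need not be indicators, so that products over disjoint sets of
    bits can be used, the expectations of which are explicit. *)
Lemma Pr_le_sum (J : finType) (P : pred J) (F : J -> {ffun I -> bool} -> R)
    (E : {ffun I -> bool} -> Prop) :
  (forall j f, P j -> 0 <= F j f) ->
  (forall f, E f -> exists2 j, P j & 1 <= F j f) ->
  Pr E <= \sum_(j | P j) Ex (F j).
Proof.
move=> F0 EF; rewrite -Ex_sum; apply: le_Ex => f.
case: asboolP => [/EF[j Pj Fj]|_]; last by apply: sumr_ge0 => j /F0.
by rewrite (bigD1 j) //= (le_trans Fj)// lerDl sumr_ge0// => k /andP[/F0].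
Qed.

Lemma Pr_prod_bits (A : {set I}) (b : bool) :
  Ex (fun f => [forall i in A, f i == b]%:R) = (if b then q else 1 - q) ^+ #|A|.
Proof.
have E f : [forall i in A, f i == b]%:R = \prod_(i in A) ((f i == b)%:R : R).
  have [/forall_inP h|] := boolP [forall i in A, f i == b].
    by rewrite big1// => i /h ->.
  rewrite negb_forall_in => /exists_inP[i iA /negbTE fi].
  by rewrite (bigD1 i)//= fi mul0r.
under Ex_ext do rewrite E.
rewrite (Ex_prod_bits A (fun x => (x == b)%:R)); congr (_ ^+ _).
by case: b {E} => /=; rewrite !(mulr0, mulr1) ?addr0 ?add0r.
Qed.

(** The second moment method: Cauchy-Schwarz applied to [F] and the indicator of
    [E]. *)
Lemma second_moment F (E : {ffun I -> bool} -> Prop) :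
  (forall f, F f != 0 -> E f) -> Ex F ^+ 2 <= Ex (fun f => F f ^+ 2) * Pr E.
Proof.
move=> FE; set a := Ex F; set b := Ex (fun f => F f ^+ 2); set p := Pr E.
(* [quad x] is the expectation of the square of [F] minus [x] times the indicator. *)
have quad x : 0 <= b - 2 * x * a + x ^+ 2 * p.
  have -> : b - 2 * x * a + x ^+ 2 * p =
      Ex (fun f => (F f - x * `[< E f >]%:R) ^+ 2).
    rewrite /a /b /p /Pr -!ExZ -ExB -ExD; apply: Ex_ext => f.
    case: asboolP => [_|nE]; first by rewrite /=; ring.
    have -> : F f = 0 by apply/eqP/negPn/negP => /FE.
    by rewrite /=; ring.
  by apply: Ex_ge0 => f; rewrite sqr_ge0.
have p0 : 0 <= p := Pr_ge0 E.
have [p00|pn0] := eqVneq p 0.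
  rewrite p00 mulr0; have [->|an0] := eqVneq a 0; first by rewrite expr0n.
  have := quad ((b + 1) / (2 * a)); rewrite p00.
  have -> : b - 2 * ((b + 1) / (2 * a)) * a + ((b + 1) / (2 * a)) ^+ 2 * 0 = -1 by field.
  by rewrite oppr_ge0 ler10.
have pp : 0 < p by rewrite lt_def pn0.
have := quad (a / p).
have -> : b - 2 * (a / p) * a + (a / p) ^+ 2 * p = b - a ^+ 2 / p by field.
by rewrite subr_ge0 ler_pdivrMr.
Qed.

(** * Concentration under Lipschitz conditions *)

Lemma symmetric_ratio (kappa x : R) : 0 < kappa -> 0 < x ->
  x <= kappa -> x^-1 <= kappa -> x + x^-1 <= kappa + kappa^-1.
Proof.
move=> k0 x0 xk; rewrite -lef_pV2 ?posrE ?invr_gt0// invrK => kx.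
rewrite -subr_ge0.
have -> : kappa + kappa^-1 - (x + x^-1) = (kappa - x) * (x - kappa^-1) / x.
  by field; rewrite !gt_eqF.
by rewrite divr_ge0 ?(ltW x0)// mulr_ge0 ?subr_ge0.
Qed.

(** For independent samples [f] and [g], twice the left hand side is the
    expectation of [U f / U g + U g / U f]. *)
Lemma Ex_inv_ratio (kappa : R) (U : {ffun I -> bool} -> R) : 0 < kappa ->
  (forall f, 0 < U f) -> (forall f g, U f <= kappa * U g) ->
  Ex U * Ex (fun f => (U f)^-1) <= (kappa + kappa^-1) / 2.
Proof.
move=> k0 U0 Uk; rewrite ler_pdivlMr//.
have -> : Ex U * Ex (fun f => (U f)^-1) * 2 =
    Ex (fun f => Ex (fun g => U f / U g + U g / U f)).
  rewrite mulrDr !mulr1.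
  have -> : Ex (fun f => Ex (fun g => U f / U g + U g / U f)) =
     Ex (fun f => U f * Ex (fun g => (U g)^-1) + (U f)^-1 * Ex U).
    by apply: Ex_ext => f; rewrite ExD; congr (_ + _); rewrite -ExZ//;
      apply: Ex_ext => g; rewrite mulrC.
  rewrite ExD; congr (_ + _).
    by rewrite [LHS]mulrC -ExZ; apply: Ex_ext => f; rewrite mulrC.
  by rewrite -ExZ; apply: Ex_ext => f; rewrite mulrC.
rewrite -[leRHS](Ex_cst (kappa + kappa^-1)); apply: le_Ex => f.
rewrite -[leRHS](Ex_cst (kappa + kappa^-1)); apply: le_Ex => g.
rewrite -[U g / U f]invf_div symmetric_ratio ?divr_gt0//.
  by rewrite ler_pdivrMr.
by rewrite invf_div ler_pdivrMr.
Qed.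

Lemma Ex_gt0 F : (forall f, 0 < F f) -> 0 < Ex F.
Proof.
move=> F0; rewrite /Ex; have m0 : \sum_f bits_mass f != 0 by rewrite bits_mass_sum oner_eq0.
have /existsP[f f0] : [exists f, bits_mass f != 0].
  apply: contraNT m0; rewrite negb_exists => /forallP h.
  by rewrite big1// => f _; apply/eqP; rewrite -[_ == _]negbK.
rewrite (bigD1 f)//= ltr_wpDr//; last by rewrite mulr_gt0// lt_def f0 bits_mass_ge0.
by apply: sumr_ge0 => g _; rewrite mulr_ge0 ?bits_mass_ge0// ltW.
Qed.

(** Bounding the product of the two exponential moments, rather than each of
    them, avoids any reference to the mean of the underlying function; the
    blocks are resampled one at a time. *)
Lemma Ex_inv_lipschitz (J : eqType) (D : J -> {set I}) (kappa : R) (r : seq J) G :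
  0 < kappa -> (forall f, 0 < G f) ->
  (forall j f g, {in ~: D j, f =1 g} -> G f <= kappa * G g) ->
  depends_on (\bigcup_(j <- r) D j) G ->
  Ex G * Ex (fun f => (G f)^-1) <= ((kappa + kappa^-1) / 2) ^+ size r.
Proof.
move=> k0; elim: r G => [|j r IH] G G0 Glip Gdep.
  pose f0 : {ffun I -> bool} := [ffun=> true].
  have E f : G f = G f0 by apply: Gdep => i; rewrite big_nil inE.
  rewrite (Ex_ext E) (Ex_ext (fun f => congr1 _ (E f))).
  by rewrite !Ex_cst divff// gt_eqF.
(* The average over the block [D j] inherits the Lipschitz condition for the
   other blocks. *)
pose avg F f := Ex (fun g => F (mix (~: D j) f g)).
have Eavg F : Ex (avg F) = Ex F by apply: Ex_mix.
have G10 f : 0 < avg G f by apply: Ex_gt0.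
have step f : avg (fun f => (G f)^-1) f <= (kappa + kappa^-1) / 2 * (avg G f)^-1.
  rewrite ler_pdivlMr// mulrC; apply: (Ex_inv_ratio k0) => // g h.
  by apply: (Glip j) => i ij; rewrite !ffunE ij.
have c0 : 0 <= (kappa + kappa^-1) / 2 by rewrite divr_ge0// addr_ge0 ?invr_ge0 ?ltW.
rewrite -(Eavg G) -(Eavg (fun f => (G f)^-1)).
apply: (@le_trans _ _ (Ex (avg G) * ((kappa + kappa^-1) / 2 * Ex (fun f => (avg G f)^-1)))).
  by rewrite ler_wpM2l ?Ex_ge0// -?ExZ; [move=> f; exact: ltW|exact: le_Ex].
rewrite mulrCA exprS ler_wpM2l//; apply: IH => //.
  move=> l f g fg; rewrite /avg -ExZ; apply: le_Ex => h; apply: (Glip l) => i il.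
  by rewrite !ffunE; case: ifP => // _; apply: fg.
move=> f g fg; apply: Ex_ext => h; apply: Gdep => i; rewrite big_cons inE !ffunE inE.
by case: (i \in D j) => //= /fg.
Qed.

Lemma cosh_le (x : R) : 0 <= x -> x <= 1 / 2 -> (expR x + (expR x)^-1) / 2 <= expR (2 * x ^+ 2).
Proof.
move=> x0 x1.
have h1 : expR x <= (1 - x)^-1.
  rewrite -[expR x]invrK lef_pV2 ?posrE ?invr_gt0 ?expR_gt0//; last by lra.
  by rewrite -expRN expR_ge1Dx.
have h2 : (expR x)^-1 <= (1 + x)^-1.
  by rewrite lef_pV2 ?posrE ?expR_gt0 ?expR_ge1Dx//; lra.
apply: (@le_trans _ _ (1 + 2 * x ^+ 2)); last exact: expR_ge1Dx.
apply: (@le_trans _ _ (((1 - x)^-1 + (1 + x)^-1) / 2)).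
  by rewrite ler_pM2r// lerD.
have -> : ((1 - x)^-1 + (1 + x)^-1) / 2 = (1 - x ^+ 2)^-1.
  have -> : 1 - x ^+ 2 = (1 - x) * (1 + x) by ring.
  by field; rewrite !gt_eqF//; lra.
rewrite -[leRHS]invrK lef_pV2 ?posrE; try nra.
  rewrite -[leLHS]mul1r ler_pdivrMr; last by nra.
  have : x ^+ 2 <= 1 / 4 by nra.
  by have : 0 <= x ^+ 2 := sqr_ge0 x; nra.
by rewrite invr_gt0; nra.
Qed.

(** Markov's inequality bounds the two probabilities by the exponential moments
    of [F] and of [- F], the product of which is controlled by
    [Ex_inv_lipschitz]; [l] is the exponent that minimises the result. *)
Lemma lipschitz_concentration (m : nat) (D : 'I_m -> {set I}) F (u t : R) :
  (0 < m)%N -> 0 <= t <= 2 * m%:R ->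
  (forall j f g, {in ~: D j, f =1 g} -> F f <= F g + 1) ->
  (forall i, exists j, i \in D j) ->
  Pr (fun f => u + t <= F f) * Pr (fun f => F f <= u) <= expR (- (t ^+ 2 / (8 * m%:R))).
Proof.
move=> m0 /andP[t0 tm] Flip cov.
have mR : 0 < m%:R :> R by rewrite ltr0n.
set l : R := t / (4 * m%:R).
have l0 : 0 <= l by rewrite divr_ge0// mulr_ge0// ltW.
have l1 : l <= 1 / 2 by rewrite ler_pdivrMr ?mulr_gt0//; lra.
pose G f := expR (l * F f).
have lip := @Ex_inv_lipschitz _ D (expR l) (enum 'I_m) G (expR_gt0 _) (fun f => expR_gt0 _).
apply: (@le_trans _ _ (expR (- (l * (u + t))) * Ex G * (expR (l * u) * Ex (fun f => (G f)^-1)))).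
  apply: ler_pM; rewrite ?Pr_ge0// -ExZ; apply: le_Ex => f; rewrite /G -?expRN -expRD.
    case: asboolP => [h|_]; last exact: expR_ge0.
    rewrite -expR0 ler_expR; have : l * (u + t) <= l * F f by rewrite ler_wpM2l.
    lra.
  case: asboolP => [h|_]; last exact: expR_ge0.
  rewrite -expR0 ler_expR; have : l * F f <= l * u by rewrite ler_wpM2l.
  lra.
rewrite mulrACA -expRD.
apply: (@le_trans _ _ (expR (- (l * (u + t)) + l * u) * expR (2 * l ^+ 2) ^+ m)).
  rewrite ler_wpM2l ?expR_ge0//.
  apply: le_trans (lip _ _) _.
  - move=> j f g fg; rewrite -expRD ler_expR -[X in X + _]mulr1 -mulrDr ler_wpM2l//.
    by rewrite addrC; exact: (Flip j).
  - move=> f g fg; congr expR; congr (_ * _); congr F; apply/ffunP => i; apply: fg.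
    have [j ij] := cov i; rewrite big_enum /=; apply/bigcupP; by exists j.
  - rewrite size_enum_ord lerXn2r ?nnegrE ?expR_ge0 ?divr_ge0 ?addr_ge0 ?invr_ge0 ?expR_ge0//.
    exact: cosh_le.
rewrite -expRM_natl -expRD ler_expR /l le_eqVlt; apply/orP; left; apply/eqP.
by field; rewrite gt_eqF.
Qed.

End Probability.
End RandomBits.


(** * Separated sides and matchings in the random graph *)

Lemma Omega_probE (R : realType) n (q : R) (E : pred (poset (ground n))) :
  Omega_prob (1 - q) E = Pr q (fun H : graph n => E (poset_of H)).
Proof.
rewrite /Omega_prob (reindex_onto (@poset_of n) (@incomp n)) /=; last first.
  by move=> P /andP[PO _]; exact: incompK.
rewrite /Pr /Ex big_mkcond /=; apply: eq_bigr => H _.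
rewrite poset_of_Omega poset_ofK eqxx andbT /= asboolb.
case: (E _); rewrite ?mulr0// mulr1 /Omega_mass /bits_mass pair_big /=.
have -> : 1 - (1 - q) = q by ring.
by apply: eq_bigr => -[a b] _; rewrite poset_ofE /=; case: (H _).
Qed.

Lemma bin_leq_exp m k : ('C(m, k) <= m ^ k)%N.
Proof.
elim: k m => [|k IH] [|m]; rewrite ?bin0//.
rewrite -(leq_pmul2l (ltn0Sn k)) -mul_bin_diag expnS.
have := IH m; have : (m ^ k <= m.+1 ^ k)%N by case: (k) => // l; rewrite leq_exp2r.
rewrite /=; move: 'C(m, k) (m ^ k)%N (m.+1 ^ k)%N => u v w.
nia.
Qed.

Lemma onem_expR (R : realType) (q : R) k : q <= 1 ->
  (1 - q) ^+ k <= expR (- (q * k%:R)).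
Proof.
move=> q1; rewrite -mulNr mulrC expRM_natl lerXn2r ?nnegrE ?expR_ge0 ?subr_ge0//.
exact: expR_ge1Dx.
Qed.

Section Holes.
Variables (R : realType) (n : nat) (q : R).
Hypothesis q01 : 0 <= q <= 1.

(** For two given vertices of one side, each vertex of the other side distinguishes
    them in the required way with probability [q * (1 - q)], independently. *)
Lemma sides_separated_prob : Pr q (fun H : graph n => ~ sides_separated H) <=
  2 * n%:R ^+ 2 * expR (- (q * (1 - q) * n%:R)).
Proof.
have pq : 0 <= q * (1 - q) <= 1 by case/andP: q01 => h0 h1; apply/andP; split; nra.
pose bad (tr : bool) (p : 'I_n * 'I_n) (b : 'I_n) (H : graph n) : R :=
  if tr then 1 - (H (p.1, b))%:R * (1 - (H (p.2, b))%:R)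
  else 1 - (H (b, p.1))%:R * (1 - (H (b, p.2))%:R).
have bad01 tr p b H : bad tr p b H = (~~ if tr then H (p.1, b) && ~~ H (p.2, b)
   else H (b, p.1) && ~~ H (b, p.2))%:R.
  have E (u v : bool) : 1 - u%:R * (1 - v%:R) = (~~ (u && ~~ v))%:R :> R.
    by case: u v => [] []; rewrite /=; ring.
  by rewrite /bad; case: tr; rewrite E.
pose F (x : bool * ('I_n * 'I_n)) H := \prod_(b <- enum 'I_n) bad x.1 x.2 b H.
have EF x : x.2.1 != x.2.2 -> Ex q (F x) = (1 - q * (1 - q)) ^+ n.
  case: x => tr [a a'] /= aa'.
  pose e1 b := if tr then (a, b) else (b, a).
  pose e2 b := if tr then (a', b) else (b, a').
  have e12 b : e1 b != e2 b.
    by rewrite /e1 /e2; case: (tr); rewrite xpair_eqE negb_and aa' ?orbT.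
  have badE b H : bad tr (a, a') b H = 1 - (H (e1 b))%:R * (1 - (H (e2 b))%:R).
    by rewrite /bad /e1 /e2; case: (tr).
  rewrite /F /= (@Ex_indep_prod _ _ _ _ _ (fun b => [set e1 b; e2 b])) ?enum_uniq//.
  - rewrite big_enum /= -[in RHS](card_ord n) -[RHS]prodr_const; apply: eq_bigr => b _.
    rewrite (Ex_ext q (badE b)) ExB Ex_cst; congr (_ - _).
    rewrite (@Ex_indep _ _ _ [set e1 b]) ?ExB ?Ex_cst.
    + rewrite (Ex_bit q (e1 b) (fun x => x%:R)) (Ex_bit q (e2 b) (fun x => x%:R)) /=.
      by rewrite !mulr0 !mulr1 !addr0.
    + by move=> f g; move=> fg; rewrite fg// inE.
    + by move=> f g fg; rewrite fg// !inE eq_sym.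
  - by move=> b _ f g fg; rewrite !badE !fg// !inE eqxx ?orbT.
  - move=> b b' _ _ bb'; rewrite -setI_eq0; apply/eqP/setP => -[u v].
    rewrite !inE /e1 /e2; case: (tr); rewrite !xpair_eqE.
      by case: (eqVneq v b) => [->|]; rewrite ?(negbTE bb') ?andbF ?orbF.
    by case: (eqVneq u b) => [->|]; rewrite ?(negbTE bb') ?andbF ?orbF.
apply: le_trans (Pr_le_sum q01 (P := fun x => x.2.1 != x.2.2) (F := F) _ _) _.
- by move=> x H _; apply: prodr_ge0 => b _; rewrite bad01 ler0n.
- move=> H; have main tr a a' : a != a' -> ~ (exists b, if tr then H (a, b) && ~~ H (a', b)
      else H (b, a) && ~~ H (b, a')) -> exists2 x, x.2.1 != x.2.2 & 1 <= F x H.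
    move=> aa' nex; exists (tr, (a, a')) => //; rewrite /F big1// => b _.
    rewrite bad01 /=; case: (boolP (if tr then _ else _)) => // h; case: nex; exists b.
    by case: (tr) h.
  rewrite /sides_separated => /not_andP[]; rewrite -existsNP => -[a]; rewrite -existsNP => -[a'] /not_implyP[aa' h].
    exact: (main true a a').
  exact: (main false a a').
rewrite (eq_bigr _ (fun x (h : x.2.1 != x.2.2) => EF x h)) sumr_const.
rewrite -[leLHS]mulr_natl ler_pM ?ler0n ?exprn_ge0 ?subr_ge0//; try by case/andP: pq.
  have -> : 2 * n%:R ^+ 2 = #|{: bool * ('I_n * 'I_n)}|%:R :> R.
    by rewrite !card_prod card_bool card_ord natrM natrM expr2.
  by rewrite ler_nat max_card.
by apply: onem_expR; case/andP: pq.
Qed.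

(** The holes with [#|p.1| = i] contribute at most [x ^+ j], where [j] is the
    smaller of [i] and [m.+1 - i] and [x] is the quantity assumed to be at most
    [1]: there are at most [m ^ (2 j)] of them, and each consists of
    [i (m.+1 - i)] pairs, which is at least [j m / 2]. *)
Lemma hole_bound (X Y : {set 'I_n}) m : (0 < m)%N -> #|X| = m -> #|Y| = m ->
  m%:R ^+ 2 * expR (- (q * m%:R / 2)) <= 1 ->
  \sum_(p : {set 'I_n} * {set 'I_n} | [&& p.1 \subset X, p.2 \subset Y &
      (#|p.1| + #|p.2| == m.+1)%N]) (1 - q) ^+ (#|p.1| * #|p.2|)
  <= m%:R ^+ 3 * expR (- (q * m%:R / 2)).
Proof.
case: m => // m _ cX cY x1; set x := m.+1%:R ^+ 2 * _ in x1.
have q1 : 0 <= 1 - q by case/andP: q01 => _ ?; rewrite subr_ge0.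
have q0 : 0 <= q by case/andP: q01.
have xge0 : 0 <= x by rewrite mulr_ge0 ?exprn_ge0 ?expR_ge0.
have -> : m.+1%:R ^+ 3 * expR (- (q * m.+1%:R / 2)) = \sum_(k < m.+1) x.
  by rewrite sumr_const card_ord /x -[RHS]mulr_natl; ring.
rewrite (partition_big (fun p : {set 'I_n} * {set 'I_n} => inord #|p.1|.-1 : 'I_m.+1) predT) //=.
apply: ler_sum => k _.
pose A := setX [set I : {set 'I_n} | I \subset X & #|I| == k.+1]
   [set J : {set 'I_n} | J \subset Y & #|J| == (m.+1 - k)%N].
have km := ltn_ord k.
apply: (@le_trans _ _ (\sum_(p in A) (1 - q) ^+ (k.+1 * (m.+1 - k)))).
  rewrite [leLHS]big_mkcond [leRHS]big_mkcond /=; apply: ler_sum => -[I J] _ /=.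
  case: ifPn => [/andP[/and3P[IX JY IJ] ik]|_]; last by case: ifP => // _; rewrite exprn_ge0.
  have cI : (#|I| <= m.+1)%N by rewrite -cX subset_leq_card.
  have cJ : (#|J| <= m.+1)%N by rewrite -cY subset_leq_card.
  have Ik : #|I| = k.+1.
    have I0 : (0 < #|I|)%N by case: (posnP #|I|) IJ => // -> /eqP h; move: cJ; rewrite -ltnS -h ltnn.
    by move/eqP: ik => /(congr1 val) /=; rewrite inordK ?prednK// => <-; rewrite prednK.
  have Jk : #|J| = (m.+1 - k)%N.
    by move: IJ; rewrite Ik addSn eqSS => /eqP h; rewrite -(addKn k #|J|) h.
  by rewrite !inE /= IX JY Ik Jk !eqxx.
rewrite sumr_const cardsX !cards_draws cX cY -mulr_natl.
pose j := minn k.+1 (m.+1 - k).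
have j0 : (0 < j)%N by rewrite /j; lia.
apply: (@le_trans _ _ (x ^+ j)); last first.
  by rewrite -(prednK j0) exprS ler_piMr// exprn_ile1.
rewrite /x exprMn; apply: ler_pM; rewrite ?ler0n ?exprn_ge0//.
  rewrite -natrX -natrX ler_nat -expnM mul2n -addnn expnD.
  have b1 : ('C(m.+1, k.+1) <= m.+1 ^ k.+1)%N := bin_leq_exp _ _.
  have b2 : ('C(m.+1, m.+1 - k) <= m.+1 ^ (m.+1 - k))%N := bin_leq_exp _ _.
  have b3 : ('C(m.+1, k.+1) <= m.+1 ^ (m.+1 - k))%N.
    rewrite -bin_sub; last by lia.
    by rewrite (leq_trans (bin_leq_exp _ _))// leq_pexp2l//; lia.
  have b4 : ('C(m.+1, m.+1 - k) <= m.+1 ^ k.+1)%N.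
    rewrite bin_sub; last by lia.
    by rewrite (leq_trans (bin_leq_exp _ _))// leq_pexp2l//; lia.
  by rewrite /j minnE; case: (leqP k.+1 (m.+1 - k)) => h;
    [have -> : (k.+1 - (k.+1 - (m.+1 - k)) = k.+1)%N by lia
    |have -> : (k.+1 - (k.+1 - (m.+1 - k)) = m.+1 - k)%N by lia]; apply: leq_mul.
apply: (le_trans (onem_expR _ _)); first by case/andP: q01.
rewrite -expRM_natl ler_expR mulrN lerN2.
have : (j * m.+1 <= 2 * (k.+1 * (m.+1 - k)))%N.
  rewrite /j; case: (leqP k.+1 (m.+1 - k)) => h; nia.
rewrite -(ler_nat R) !natrM => h.
have := ler_wpM2l q0 h; move: (k.+1%:R * _) => u; move: (j%:R) (m.+1%:R) => v w.
by lra.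
Qed.

(** If there is no matching, the hole that prevents it and [B] are disjoint sets
    of pairs without edges, so the probabilities multiply. *)
Lemma empty_box_no_matching (B : {set 'I_n * 'I_n}) (X Y : {set 'I_n}) m :
  (0 < m)%N -> #|X| = m -> #|Y| = m -> [disjoint B & setX X Y] ->
  m%:R ^+ 2 * expR (- (q * m%:R / 2)) <= 1 ->
  Pr q (fun H : graph n => [forall e in B, H e == false] /\ ~ matchable H X Y) <=
  (1 - q) ^+ #|B| * (m%:R ^+ 3 * expR (- (q * m%:R / 2))).
Proof.
move=> m0 cX cY BXY x1.
pose P (p : {set 'I_n} * {set 'I_n}) := [&& p.1 \subset X, p.2 \subset Y & (#|p.1| + #|p.2| == m.+1)%N].
pose F (p : {set 'I_n} * {set 'I_n}) (H : graph n) : R :=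
  [forall e in B :|: setX p.1 p.2, H e == false]%:R.
apply: le_trans (Pr_le_sum q01 (P := P) (F := F) _ _) _.
- by move=> p H _; rewrite ler0n.
- move=> H [/forall_inP HB nm].
  have [//|[I [J [IX JY IJ hole]]]] := matching_or_hole H (etrans cX (esym cY)).
  exists (I, J); first by rewrite /P /= IX JY IJ cY eqxx.
  rewrite /F ler1n lt0b; apply/forall_inP => -[a b] /=; rewrite !inE => /orP[/HB//|/andP[aI bJ]].
  by rewrite (negbTE (hole _ _ aI bJ)).
apply: le_trans (ler_wpM2l _ (hole_bound m0 cX cY x1)); last first.
  by rewrite exprn_ge0// subr_ge0; case/andP: q01.
rewrite big_distrr /=; apply: ler_sum => -[I J] /and3P[/= IX JY _].
rewrite Pr_prod_bits// -exprD cardsU -cardsX.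
suff -> : B :&: setX I J = set0 by rewrite cards0 subn0.
apply/eqP; rewrite setI_eq0; apply: disjointWr BXY.
by apply/subsetP => -[a b]; rewrite !inE /= => /andP[/(subsetP IX)-> /(subsetP JY)->].
Qed.

End Holes.


(** * Empty boxes: the second moment *)

Section Agreement.
Variables (R : realType) (s r : nat).
Implicit Types phi psi : {ffun 'I_s -> 'I_r}.

(** The number of common vertices of two transversals; for a random [psi] it is
    a sum of independent indicators, hence the use of transversals instead of
    all sets of [s] vertices. *)
Definition agree phi psi := #|[set u | phi u == psi u]|.

Lemma agree_le phi psi : (agree phi psi <= s)%N.
Proof. by rewrite -[X in (_ <= X)%N]card_ord max_card. Qed.

Lemma agree_mgf phi (y : R) :
  \sum_psi y ^+ agree phi psi = (r%:R - 1 + y) ^+ s.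
Proof.
have E psi : y ^+ agree phi psi = \prod_u (if phi u == psi u then y else 1).
  rewrite -big_mkcond /= /agree -prodr_const; apply: eq_bigl => u; by rewrite inE.
under eq_bigr do rewrite E.
rewrite -(bigA_distr_bigA (fun u v => if phi u == v then y else 1)).
rewrite -[in RHS](card_ord s) -prodr_const; apply: eq_bigr => u _.
rewrite (bigD1 (phi u)) //= eqxx (eq_bigr (fun=> 1)); last first.
  by move=> v; rewrite eq_sym => /negbTE->.
rewrite sumr_const cardC1 card_ord addrC; congr (_ + _).
by case: r phi u {E} => [|r'] phi u; [case: (phi u)|rewrite /= -addn1 natrD addrK].
Qed.

Lemma agree_mgf_le phi (y : R) : (0 < r)%N -> 0 <= y ->
  \sum_psi y ^+ agree phi psi <= r%:R ^+ s * expR ((y - 1) * (s%:R / r%:R)).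
Proof.
move=> r0 y0; have rR : 0 < r%:R :> R by rewrite ltr0n.
have -> : (y - 1) * (s%:R / r%:R) = s%:R * ((y - 1) / r%:R) by rewrite mulrCA.
rewrite agree_mgf expRM_natl -exprMn.
rewrite lerXn2r ?nnegrE ?mulr_ge0 ?expR_ge0 ?ler0n//.
  by rewrite addr_ge0// subr_ge0 ler1n.
rewrite -ler_pdivrMl//; apply: le_trans (expR_ge1Dx _).
by rewrite le_eqVlt; apply/orP; left; apply/eqP; field; rewrite gt_eqF.
Qed.

End Agreement.

Lemma onem_bernoulli (R : realType) (q : R) k : 0 <= q <= 1 ->
  1 - q * k%:R <= (1 - q) ^+ k.
Proof.
move=> /andP[q0 q1]; elim: k => [|k IH]; first by rewrite mulr0 subr0.
rewrite exprS; apply: le_trans (ler_wpM2l _ IH); last by rewrite subr_ge0.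
by rewrite -natr1; have := mulr_ge0 (mulr_ge0 q0 q0) (ler0n R k); nra.
Qed.

(** The summand is the probability that two boxes are both empty, divided by the
    square of the probability for one box: the number of pairs they share is the
    product of the two agreements. An agreement is binomial with mean about
    [rho], in the applications much smaller than [1 / q]. While the first one is
    at most [1 / q], the factor is moderate and the exponential moment of the
    second one can be used; beyond [1 / q] the weight [expR (i - 1 / q)] can be
    inserted and is paid for by the small probability of so many agreements. *)
Lemma second_moment_sum (R : realType) (q rho : R) s r (phi psi : {ffun 'I_s -> 'I_r}) :
  (0 < r)%N -> 0 < q <= 1 / 2 -> rho = s%:R / r%:R ->
  \sum_phi' \sum_psi' ((1 - q)^-1) ^+ (agree phi phi' * agree psi psi') <=
  (r%:R ^+ s) ^+ 2 * (expR (rho * (expR (expR 2 * q * rho) - 1))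
     + expR (expR 3 * rho - q^-1)
     + expR (expR (1 + q / (1 - q) * s%:R / 2) * rho - q^-1) ^+ 2).
Proof.
move=> r0 /andP[q0 q2] rhoE.
have rho0 : 0 <= rho by rewrite rhoE divr_ge0.
set b := (1 - q)^-1.
have q1 : 0 < 1 - q by lra.
have b1 : 1 <= b by rewrite /b invf_ge1//; lra.
have b0 : 0 <= b by apply: le_trans b1.
have bE (x : R) : q / (1 - q) <= x -> forall k, b ^+ k <= expR (x * k%:R).
  move=> qx k; rewrite mulrC expRM_natl lerXn2r ?nnegrE ?expR_ge0//.
  apply: le_trans (expR_ge1Dx _).
  have -> : b = 1 + q / (1 - q) by rewrite /b; field; rewrite gt_eqF.
  by rewrite lerD2l.
have q1q : q / (1 - q) <= 2 * q by rewrite ler_pdivrMr//; nra.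
(* [F1], [F2] and [F3] dominate the summand where [i <= 1/q], where
   [j <= 1/q < i], and where both exceed [1/q]; the last one uses
   [2 i j <= s (i + j)]. *)
pose F1 (i j : nat) := if i%:R <= q^-1 then b ^+ (i * j) else 0.
pose F2 (i j : nat) := if j%:R <= q^-1 then b ^+ (i * j) * expR (i%:R - q^-1) else 0.
pose B := expR (q / (1 - q) * s%:R / 2).
pose F3 (i j : nat) := (B ^+ i * expR (i%:R - q^-1)) * (B ^+ j * expR (j%:R - q^-1)).
have F123 i j : (i <= s)%N -> (j <= s)%N -> b ^+ (i * j) <= F1 i j + F2 i j + F3 i j.
  move=> is_ js.
  have f10 : 0 <= F1 i j by rewrite /F1; case: ifP => // _; rewrite exprn_ge0.
  have f20 : 0 <= F2 i j by rewrite /F2; case: ifP => // _; rewrite mulr_ge0 ?exprn_ge0 ?expR_ge0.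
  have f30 : 0 <= F3 i j by rewrite !mulr_ge0 ?exprn_ge0 ?expR_ge0.
  case: (lerP i%:R q^-1) => hi.
    by rewrite -addrA -[leLHS]addr0 lerD ?addr_ge0// /F1 hi.
  have ei : 1 <= expR (i%:R - q^-1) by rewrite -[X in X <= _]expR0 ler_expR subr_ge0 ltW.
  case: (lerP j%:R q^-1) => hj.
    rewrite addrAC -[leLHS]add0r lerD ?addr_ge0// /F2 hj.
    by rewrite ler_peMr ?exprn_ge0.
  have ej : 1 <= expR (j%:R - q^-1) by rewrite -[X in X <= _]expR0 ler_expR subr_ge0 ltW.
  rewrite -[leLHS]add0r lerD ?addr_ge0// /F3 mulrACA -exprD.
  apply: (@le_trans _ _ (B ^+ (i + j) * 1)); last first.
    by rewrite ler_wpM2l ?exprn_ge0 ?expR_ge0// mulr_ege1.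
  rewrite mulr1; apply: le_trans (bE _ (lexx _) _) _.
  rewrite /B -expRM_natl ler_expR.
  rewrite -(mulrA (q / (1 - q))) mulrCA ler_wpM2l ?divr_ge0 ?(ltW q0) ?(ltW q1)//.
  rewrite mulrA ler_pdivlMr// -!natrM ler_nat.
  rewrite muln2 -addnn mulnDl leq_add ?leq_mul2l ?js ?orbT//.
  by rewrite mulnC leq_mul2l is_ orbT.
apply: (@le_trans _ _ (\sum_phi' \sum_psi' (F1 (agree phi phi') (agree psi psi') +
    F2 (agree phi phi') (agree psi psi') + F3 (agree phi phi') (agree psi psi')))).
  by do 2![apply: ler_sum => ? _]; apply: F123; exact: agree_le.
under eq_bigr do rewrite 2!big_split /=.
rewrite 2!big_split /= [leRHS]mulrDr [X in _ <= X + _]mulrDr; have rs0 : 0 <= r%:R ^+ s :> R by rewrite exprn_ge0.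
apply: lerD; first apply: lerD.
- have step phi' : \sum_psi' F1 (agree phi phi') (agree psi psi') <=
      r%:R ^+ s * (expR (expR 2 * q * rho)) ^+ agree phi phi'.
    rewrite /F1; case: (boolP ((agree phi phi')%:R <= q^-1)) => [h|_]; last by rewrite big1 ?mulr_ge0 ?exprn_ge0 ?expR_ge0.
    under eq_bigr do rewrite exprM.
    apply: le_trans (agree_mgf_le _ r0 _) _; first by rewrite exprn_ge0.
    rewrite ler_wpM2l// -expRM_natl ler_expR -rhoE mulrC.
    set i := agree _ _ in h *.
    rewrite [leRHS](_ : _ = rho * (expR 2 * (q * i%:R))); last by ring.
    rewrite ler_wpM2l//.
    have -> : b ^+ i - 1 = b ^+ i * (1 - (1 - q) ^+ i).
      by rewrite mulrBr mulr1 -exprMn /b mulVf ?gt_eqF// expr1n.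
    apply: ler_pM; rewrite ?exprn_ge0 ?subr_ge0 ?exprn_ile1//; try lra.
      apply: le_trans (bE _ q1q _) _; rewrite ler_expR -mulrA -[leRHS]mulr1 ler_wpM2l//.
      by rewrite mulrC -ler_pdivlMr// div1r.
    by rewrite lerBlDr -lerBlDl; apply: onem_bernoulli; apply/andP; split; lra.
  apply: le_trans (ler_sum _ (fun phi' _ => step phi')) _.
  rewrite -mulr_sumr [r%:R ^+ s ^+ 2]expr2 -[r%:R ^+ s * _ * _]mulrA; apply: ler_wpM2l => //.
  have := agree_mgf_le phi r0 (expR_ge0 (expR 2 * q * rho)).
  by rewrite -rhoE [rho * (_ - 1)]mulrC.
- rewrite exchange_big /=.
  have step psi' : \sum_phi' F2 (agree phi phi') (agree psi psi') <=
      r%:R ^+ s * expR (expR 3 * rho - q^-1).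
    rewrite /F2; case: (boolP ((agree psi psi')%:R <= q^-1)) => [h|_]; last by rewrite big1 ?mulr_ge0 ?exprn_ge0 ?expR_ge0.
    set j := agree _ _ in h *.
    have E phi' : b ^+ (agree phi phi' * j) * expR ((agree phi phi')%:R - q^-1) =
        expR (- q^-1) * (b ^+ j * expR 1) ^+ agree phi phi'.
      by rewrite exprMn -expRM_natl mulr1 expRD mulnC exprM; ring.
    under eq_bigr do rewrite E.
    rewrite -big_distrr /= expRD [X in _ <= _ * X]mulrC mulrCA ler_wpM2l ?expR_ge0//.
    have y0 : 0 <= b ^+ j * expR 1 by rewrite mulr_ge0 ?exprn_ge0 ?expR_ge0.
    apply: le_trans (agree_mgf_le _ r0 y0) _.
    rewrite -rhoE ler_wpM2l// ler_expR ler_wpM2r//.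
    have -> : 3 = 2 + 1 :> R by ring.
    rewrite expRD lerBlDr.
    have : b ^+ j <= expR 2.
      apply: le_trans (bE _ q1q _) _; rewrite ler_expR -mulrA -[leRHS]mulr1 ler_wpM2l//.
      by rewrite mulrC -ler_pdivlMr// div1r.
    by move=> /(ler_wpM2r (expR_ge0 1)); lra.
  apply: le_trans (ler_sum _ (fun psi' _ => step psi')) _.
  rewrite sumr_const card_ffun !card_ord [r%:R ^+ s ^+ 2]expr2 -[r%:R ^+ s * _ * _]mulrA.
  by rewrite -[X in _ <= X * _]natrX mulr_natl.
- rewrite /F3; under eq_bigr do rewrite -big_distrr /=.
  rewrite -big_distrl /= -exprMn expr2.
  have step (ph : {ffun 'I_s -> 'I_r}) : 0 <= \sum_ph' (B ^+ agree ph ph' * expR ((agree ph ph')%:R - q^-1)) <=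
     r%:R ^+ s * expR (expR (1 + q / (1 - q) * s%:R / 2) * rho - q^-1).
    rewrite sumr_ge0 /=; last by move=> *; rewrite mulr_ge0 ?exprn_ge0 ?expR_ge0.
    have E ph' : B ^+ agree ph ph' * expR ((agree ph ph')%:R - q^-1) =
        expR (- q^-1) * (B * expR 1) ^+ agree ph ph'.
      by rewrite exprMn -[expR 1 ^+ _]expRM_natl mulr1 expRD; ring.
    under eq_bigr do rewrite E.
    rewrite -big_distrr /= expRD [X in _ <= _ * X]mulrC mulrCA ler_wpM2l ?expR_ge0//.
    have y0 : 0 <= B * expR 1 by rewrite mulr_ge0 ?expR_ge0.
    apply: le_trans (agree_mgf_le _ r0 y0) _.
    rewrite -rhoE ler_wpM2l// ler_expR ler_wpM2r//.
    by rewrite lerBlDr [expR (1 + _)]expRD mulrC lerDl.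
  by apply: ler_pM; case/andP: (step phi) (step psi) => ? ? /andP[].
Qed.

Section EmptyBox.
Variables (R : realType) (n s r : nat).
Hypotheses (srn : (s * r <= n)%N).

Lemma block_lt (u : 'I_s) (v : 'I_r) : (u * r + v < n)%N.
Proof. by apply: leq_trans srn; have := ltn_ord u; have := ltn_ord v; nia. Qed.

Definition block (u : 'I_s) (v : 'I_r) : 'I_n := Ordinal (block_lt u v).

Lemma block_inj u v u' v' : block u v = block u' v' -> u = u' /\ v = v'.
Proof.
move=> /(congr1 val) /= h; have vr := ltn_ord v; have vr' := ltn_ord v'.
have uu : u = u' :> nat.
  have := congr1 (divn^~ r) h; rewrite !divnMDl ?divn_small ?addn0//; lia.
by split; apply/val_inj => //=; move: h; rewrite uu; lia.
Qed.

Definition block_transversal (phi : {ffun 'I_s -> 'I_r}) : {set 'I_n} :=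
  [set block u (phi u) | u : 'I_s].

Lemma card_block_transversal phi : #|block_transversal phi| = s.
Proof. by rewrite card_imset ?card_ord// => u u' /block_inj[]. Qed.

Lemma card_block_transversalI phi psi :
  #|block_transversal phi :&: block_transversal psi| = agree phi psi.
Proof.
rewrite /agree -(card_imset _ (f := fun u => block u (phi u))); last first.
  by move=> u u' /block_inj[].
congr #|pred_of_set _|; apply/setP => x; rewrite inE; apply/andP/imsetP.
  move=> [/imsetP[u _ ->] /imsetP[u' _ /block_inj[uu h]]].
  by exists u; rewrite // inE h uu.
move=> [u]; rewrite inE => /eqP h ->; split; apply/imsetP; exists u => //.
by rewrite h.
Qed.

Definition box (p : {ffun 'I_s -> 'I_r} * {ffun 'I_s -> 'I_r}) : {set 'I_n * 'I_n} :=
  setX (block_transversal p.1) (block_transversal p.2).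

Lemma card_boxU p p' : (#|box p :|: box p'| =
  s ^ 2 + s ^ 2 - agree p.1 p'.1 * agree p.2 p'.2)%N.
Proof.
rewrite cardsU !cardsX !card_block_transversal -!mulnn; congr (_ - _)%N.
rewrite -!card_block_transversalI -cardsX; congr #|pred_of_set _|.
by apply/setP => -[a b]; rewrite !inE /= andbACA.
Qed.

Definition box_empty (H : graph n) p := [forall e in box p, H e == false].

(** The second moment method for the number of empty boxes that leave a
    perfect matching; [eta] is the proportion of the first moment lost by
    requiring the matching, and the second moment is bounded by that of the
    number of all empty boxes. *)
Lemma empty_box_prob (q rho eta : R) :
  (0 < r)%N -> (0 < s < n)%N -> 0 < q <= 1 / 2 -> rho = s%:R / r%:R ->
  eta = (n - s)%:R ^+ 3 * expR (- (q * (n - s)%:R / 2)) -> eta <= 1 ->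
  (1 - eta) ^+ 2 <=
  (expR (rho * (expR (expR 2 * q * rho) - 1)) + expR (expR 3 * rho - q^-1)
     + expR (expR (1 + q / (1 - q) * s%:R / 2) * rho - q^-1) ^+ 2) *
  Pr q (fun H : graph n => exists p,
    box_empty H p /\ matchable H (~: block_transversal p.1) (~: block_transversal p.2)).
Proof.
move=> r0 /andP[s0 sn] q02 rhoE etaE eta1.
have q01 : 0 <= q <= 1 by case/andP: q02 => *; apply/andP; split; lra.
have q1 : 0 < 1 - q by case/andP: q02 => *; lra.
pose good (H : graph n) p := box_empty H p && `[< matchable H (~: block_transversal p.1) (~: block_transversal p.2) >].
pose X (H : graph n) : R := \sum_p (good H p)%:R.
pose N : R := #|{: {ffun 'I_s -> 'I_r} * {ffun 'I_s -> 'I_r}}|%:R.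
have NE : N = (r%:R ^+ s) ^+ 2 by rewrite /N card_prod card_ffun !card_ord natrM natrX expr2.
have N0 : 0 < N by rewrite NE !exprn_gt0// ltr0n.
have ns0 : (0 < n - s)%N by rewrite subn_gt0.
have cC phi : #|~: block_transversal phi| = (n - s)%N by rewrite cardsCs setCK card_block_transversal card_ord.
have EX : N * ((1 - q) ^+ (s ^ 2) * (1 - eta)) <= Ex q X.
  rewrite /X Ex_sum /N mulr_natl -sumr_const; apply: ler_sum => p _.
  have -> : Ex q (fun H => (good H p)%:R) =
    Ex q (fun H => [forall e in box p, H e == false]%:R) -
    Pr q (fun H : graph n => [forall e in box p, H e == false] /\
         ~ matchable H (~: block_transversal p.1) (~: block_transversal p.2)).
    rewrite /Pr -ExB; apply: Ex_ext => H; rewrite /good /box_empty asbool_and asboolb asbool_neg.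
    set u := [forall e in box p, _]; set v := asbool _.
    by case: u; case: v; rewrite /=; ring.
  rewrite Pr_prod_bits// /box cardsX !card_block_transversal mulnn mulrBr mulr1 lerB// etaE.
  apply: le_trans (empty_box_no_matching q01 ns0 (cC _) (cC _) _ _) _.
  - by rewrite -setI_eq0; apply/eqP/setP => -[a b]; rewrite !inE; case: (a \in _) => //=; rewrite andbF.
  - apply: le_trans eta1; rewrite etaE ler_wpM2r ?expR_ge0//.
    by rewrite ler_weXn2l// ler1n.
  - by rewrite cardsX !card_block_transversal mulnn.
have EX2 : Ex q (fun H => X H ^+ 2) <= N * ((1 - q) ^+ (2 * s ^ 2) * (N * 
    (expR (rho * (expR (expR 2 * q * rho) - 1)) + expR (expR 3 * rho - q^-1)
     + expR (expR (1 + q / (1 - q) * s%:R / 2) * rho - q^-1) ^+ 2))).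
  apply: (@le_trans _ _ (\sum_p \sum_p' (1 - q) ^+ #|box p :|: box p'|)).
    apply: (@le_trans _ _ (Ex q (fun H : graph n => \sum_p \sum_p'
        [forall e in box p :|: box p', H e == false]%:R))).
      apply: (le_Ex q01) => H; rewrite /X expr2 big_distrlr /=.
      do 2![apply: ler_sum => ? _]; rewrite -natrM ler_nat.
      case: (boolP (good H _)) => //= /andP[/forall_inP h1 _].
      case: (boolP (good H _)) => //= /andP[/forall_inP h2 _].
      rewrite lt0b; apply/forall_inP => e; rewrite inE => /orP[]; [exact: h1|exact: h2].
    rewrite Ex_sum; apply: ler_sum => p _; rewrite Ex_sum; apply: ler_sum => p' _.
    by rewrite Pr_prod_bits.
  rewrite /N mulr_natl -sumr_const; apply: ler_sum => -[phi psi] _.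
  have := second_moment_sum phi psi r0 q02 rhoE.
  rewrite -NE => /(ler_wpM2l (exprn_ge0 (2 * s ^ 2) (ltW q1))); apply: le_trans.
  rewrite pair_big big_distrr /=; apply: ler_sum => -[phi' psi'] _ /=.
  have ij : (agree phi phi' * agree psi psi' <= s ^ 2)%N.
    by rewrite -mulnn leq_mul// agree_le.
  rewrite card_boxU /= addnn -mul2n exprVn -{2}(subnK (leq_trans ij (leq_pmull _ (ltn0Sn 1)))).
  by rewrite exprD mulfK// expf_neq0// gt_eqF.
have M2 := second_moment q01 (F := X) (E := fun H : graph n => exists p,
    box_empty H p /\ matchable H (~: block_transversal p.1) (~: block_transversal p.2)).
set P := Pr q _; set M := _ + _ + _ in EX2 *.
have E1 : 0 <= N * ((1 - q) ^+ (s ^ 2) * (1 - eta)).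
  by rewrite !mulr_ge0 ?exprn_ge0 ?(ltW q1) ?(ltW N0)// subr_ge0.
have c0 : 0 < N ^+ 2 * (1 - q) ^+ (2 * s ^ 2) by rewrite mulr_gt0// exprn_gt0.
rewrite -(ler_pM2l c0).
have -> : N ^+ 2 * (1 - q) ^+ (2 * s ^ 2) * (1 - eta) ^+ 2 =
    (N * ((1 - q) ^+ (s ^ 2) * (1 - eta))) ^+ 2.
  by rewrite mulnC exprM !exprMn; ring.
apply: (@le_trans _ _ (Ex q X ^+ 2)).
  by rewrite lerXn2r// ?nnegrE// (le_trans E1)//.
apply: le_trans (M2 _) _.
  move=> H; have [[p [h1 h2]] _|nex] := pselect (exists p, box_empty H p /\
      matchable H (~: block_transversal p.1) (~: block_transversal p.2)); first by exists p.
  rewrite /X big1 ?eqxx// => p _; rewrite /good; case: (boolP (box_empty H p)) => //= h1.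
  by case: asboolP => // h2; case: nex; exists p.
rewrite mulrA ler_wpM2r ?Pr_ge0//.
by apply: le_trans EX2 _; rewrite le_eqVlt; apply/orP; left; apply/eqP; ring.
Qed.

Lemma empty_box_cover (H : graph n) p : box_empty H p ->
  matchable H (~: block_transversal p.1) (~: block_transversal p.2) -> coverable H (n - s).
Proof.
move=> /forall_inP be [mu [mui muX]].
have cC phi : #|~: block_transversal phi| = (n - s)%N by rewrite cardsCs setCK card_block_transversal card_ord.
rewrite -(cC p.1); apply: (@cover_of_matching _ _ _ (~: block_transversal p.2) mu (fun=> [::])) => //.
  by rewrite !cC.
move=> a y; rewrite !inE !negbK => ap yp hay.
have /be /eqP h : (a, y) \in box p by rewrite inE ap yp.
by rewrite h in hay.
Qed.

End EmptyBox.

(** * The least number of chain graphs *)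

Section CoverNumber.
Variable n : nat.
Implicit Types H : graph n.

Lemma coverableW H d d' : (d <= d')%N -> coverable H d -> coverable H d'.
Proof.
move=> dd [f [g [fg cov]]].
exists (fun i => if insub (val i) is Some j then f j else fun=> 0%N).
exists (fun i => if insub (val i) is Some j then g j else fun=> 0%N); split.
  by move=> i; case: insubP => [j _ _|_]; [exact: fg|move=> a b].
move=> a b /cov[i gi]; exists (widen_ord dd i) => /=.
by rewrite (valK i).
Qed.

Lemma coverable_stars H : coverable H n.
Proof.
exists (fun i a => (a == i)%N); exists (fun i b => (~~ H (i, b))%N); split.
  by move=> i a b; case: eqP => //= ->; case: (H _).
by move=> a b hab; exists a; rewrite hab eqxx.
Qed.

Lemma coverable_ex H : exists d, `[< coverable H d >].
Proof. by exists n; apply/asboolP/coverable_stars. Qed.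

Definition cover_number H : nat := ex_minn (coverable_ex H).

Lemma cover_number_le H d : coverable H d <-> (cover_number H <= d)%N.
Proof.
rewrite /cover_number; case: ex_minnP => m /asboolP cm mmin; split.
  by move=> cd; apply: mmin; apply/asboolP.
by move=> md; exact: coverableW cm.
Qed.

Definition row_pairs (a : 'I_n) : {set 'I_n * 'I_n} := [set e | e.1 == a].

(** The star at [a] repairs a cover spoiled by a change in row [a]. *)
Lemma cover_number_lipschitz a H H' : {in ~: row_pairs a, H =1 H'} ->
  (cover_number H' <= (cover_number H).+1)%N.
Proof.
move=> HH; apply/cover_number_le.
have /cover_number_le [f [g [fg cov]]] := leqnn (cover_number H).
set d := cover_number H in f g fg cov *.
have eqH x y : x != a -> H (x, y) = H' (x, y) by move=> xa; apply: HH; rewrite !inE.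
exists (fun i x => if unlift ord_max i is Some j then (if x == a then 0%N else f j x) else (x == a)%N).
exists (fun i y => if unlift ord_max i is Some j then g j y else (~~ H' (a, y))%N); split.
  move=> i x y; case: unliftP => [j _|_]; last by case: eqP => // ->; case: (H' _).
  by case: eqVneq => // xa /fg; rewrite eqH.
move=> x y hxy; have [xa|xa] := eqVneq x a.
  by exists ord_max; rewrite unlift_none -xa hxy.
have [i gi] := cov x y (etrans (eqH _ _ xa) hxy).
by exists (lift ord_max i); rewrite liftK.
Qed.

Lemma cover_number_concentration (R : realType) (q : R) (u t : nat) :
  0 <= q <= 1 -> (0 < n)%N -> (t <= 2 * n)%N ->
  Pr q (fun H => ~ coverable H (u + t)) * Pr q (fun H => coverable H u) <=
  expR (- (t%:R ^+ 2 / (8 * n%:R))).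
Proof.
move=> q01 n0 tn.
apply: le_trans (@lipschitz_concentration R _ q q01 n row_pairs
  (fun H => (cover_number H)%:R) u%:R t%:R n0 _ _ _).
- apply: ler_pM; rewrite ?Pr_ge0//; apply: le_Pr => // H.
    move=> nc; rewrite -natrD ler_nat leqNgt; apply/negP => lt.
    by apply: nc; apply/cover_number_le/ltnW.
  by move=> /cover_number_le; rewrite ler_nat.
- by rewrite ler0n /= -natrM ler_nat.
- move=> a H H' HH; rewrite natr1 ler_nat; apply: (@cover_number_lipschitz a) => e ea.
  by rewrite HH.
- by move=> [a b]; exists a; rewrite inE.
Qed.

End CoverNumber.


(** * Spreading the left-over box over the other chain graphs *)

Section Tuples.
Variables (n t' N K : nat) (c : 'I_N -> 'I_K -> 'I_t'.+1).
Let t := t'.+1.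
Hypothesis tn : (t <= n)%N.

Definition tuple_index : finType := ('I_t'.+1 * 'I_N)%type.

Definition corner : {set 'I_n} := [set widen_ord tn x | x : 'I_t'.+1].

Definition entry (i : tuple_index) (k : 'I_K) : 'I_t'.+1 := i.1 + c i.2 k.

Definition entry_vertex i k : 'I_n := widen_ord tn (entry i k).

(** The differences of the family members are all distinct, which bounds the
    overlap of translates: different tuples through [s] have no entry before [s]
    in common. *)
Definition difference_family :=
  (forall j, injective (c j)) /\
  forall j j' (k l k' l' : 'I_K), (l < k)%N -> (l' < k')%N ->
    c j k - c j l = c j' k' - c j' l' -> [/\ j = j', k = k' & l = l'].

Hypothesis cdiff : difference_family.

Lemma widen_inj : injective (widen_ord tn).
Proof. by move=> x y /(congr1 val) /= h; apply: val_inj. Qed.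

Lemma card_corner : #|corner| = t.
Proof. by rewrite card_imset ?card_ord//; exact: widen_inj. Qed.

Lemma card_cornerC : #|~: corner| = (n - t)%N.
Proof. by rewrite cardsCs setCK card_corner card_ord. Qed.

Lemma entry_inj i : injective (entry i).
Proof. by move=> k l /addrI; apply: cdiff.1. Qed.

Lemma entry_vertex_corner i k : entry_vertex i k \in corner.
Proof. by apply/imsetP; exists (entry i k). Qed.

(** The translate of [c jk.1] that has [s] at position [jk.2]. *)
Definition through (s : 'I_t'.+1) (jk : 'I_N * 'I_K) : tuple_index :=
  (s - c jk.1 jk.2, jk.1).

Lemma entry_through s jk : entry (through s jk) jk.2 = s.
Proof. by rewrite /entry /= subrK. Qed.

Lemma entry_through_inj s (jk jk' : 'I_N * 'I_K) (l l' : 'I_K) : (l < jk.2)%N -> (l' < jk'.2)%N ->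
  entry (through s jk) l = entry (through s jk') l' -> jk = jk'.
Proof.
case: jk jk' => [j k] [j' k'] /= lk lk'; rewrite /entry /= -!addrA => /addrI h.
have E : c j k - c j l = c j' k' - c j' l'.
  by apply: oppr_inj; rewrite !opprB addrC h addrC.
by have [-> -> _] := cdiff.2 _ _ _ _ _ _ lk lk' E.
Qed.

Lemma through_inj s : injective (through s).
Proof.
move=> [j k] [j' k'] /[dup] /(congr1 fst) /= /addrI/oppr_inj h /(congr1 snd) /= jj.
by move: h; rewrite -jj => /(cdiff.1 j) ->.
Qed.

Definition tuple_matching (H : graph n) (tau : tuple_index -> 'I_n) :=
  injective tau /\ forall i, tau i \in ~: corner /\ forall k, H (entry_vertex i k, tau i).

(** [rho i] is the vertex the chain graph of which uses the tuple [i]: an edge is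
    missed if it belongs to none of the chain graphs that use tuples through
    [s]. *)
Definition missed (H : graph n) (rho : tuple_index -> 'I_n) (s y : 'I_t'.+1) :=
  H (widen_ord tn s, widen_ord tn y) /\
  forall jk, ~ (H (rho (through s jk), widen_ord tn y) /\
    forall l : 'I_K, (l < jk.2)%N ->
      H (entry_vertex (through s jk) l, widen_ord tn y)).

Lemma cover_of_tuples (H : graph n) (mu : 'I_n -> 'I_n) tau rho :
  {in ~: corner &, injective mu} ->
  {in ~: corner, forall x, mu x \in ~: corner /\ H (x, mu x)} ->
  tuple_matching H tau ->
  (forall i, rho i \in ~: corner /\ mu (rho i) = tau i) ->
  (forall s y, ~ missed H rho s y) -> coverable H (n - t).
Proof.
move=> mui muX [taui tauY] rhoE nomiss; rewrite -card_cornerC.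
pose tup i : seq 'I_n := [seq entry_vertex i k | k <- enum 'I_K].
pose sq x := if [pick i | tau i == mu x] is Some i then tup i else [::].
have sqE i : sq (rho i) = tup i.
  rewrite /sq (rhoE i).2; case: pickP => [i' /eqP/taui->//|/(_ i)].
  by rewrite eqxx.
apply: (@cover_of_matching _ _ _ (~: corner) mu sq) => //.
  move=> x a xX; rewrite /sq; case: pickP => // i /eqP <- /mapP[k _ ->].
  exact: (tauY i).2.
move=> a y; rewrite !inE !negbK => /imsetP[s _ ->] /imsetP[z _ ->] hsz.
have [jk] : exists jk, H (rho (through s jk), widen_ord tn z) /\
    forall l : 'I_K, (l < jk.2)%N -> H (entry_vertex (through s jk) l, widen_ord tn z).
  apply: contrapT => /forallNP nex; exact: (nomiss s z).
move=> [h1 h2]; exists (rho (through s jk)).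
have sE : entry_vertex (through s jk) jk.2 = widen_ord tn s.
  by rewrite /entry_vertex entry_through.
split => //; first exact: (rhoE _).1.
  by rewrite sqE; apply/mapP; exists jk.2; rewrite ?mem_enum.
rewrite sqE /tup -sE index_map; last by move=> k l /widen_inj/entry_inj.
rewrite index_enum_ord -map_take; apply/allP => a' /mapP[l lk ->].
have : (l < jk.2.+1)%N.
  by move: lk; rewrite in_take ?mem_enum// index_enum_ord.
rewrite ltnS leq_eqVlt => /orP[/eqP/val_inj->|/h2//].
by rewrite sE.
Qed.

End Tuples.

Section TupleProbability.
Variables (R : realType) (n t' N K : nat) (c : 'I_N -> 'I_K -> 'I_t'.+1) (q : R).
Let t := t'.+1.
Hypotheses (tn : (t <= n)%N) (q01 : 0 <= q <= 1) (cdiff : difference_family c).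

Let full (A : {set 'I_n * 'I_n}) (H : graph n) : R := [forall e in A, H e == true]%:R.

Lemma full_dep A : depends_on A (full A).
Proof.
move=> f g fg; rewrite /full; congr (_%:R : R); congr nat_of_bool.
by apply: eq_forallb_in => e /fg ->.
Qed.

Lemma Ex_not_full A : Ex q (fun H => 1 - full A H) = 1 - q ^+ #|A|.
Proof. by rewrite ExB Ex_cst Pr_prod_bits. Qed.

(** A tuple with [s] at position [k], counted from [0], covers the edge [(s, y)] if
    [k + 1] further pairs of the column of [y] are edges. For different tuples
    these sets of pairs are disjoint by the property of a difference family. *)
Lemma missed_prob (rho : tuple_index t' N -> 'I_n) (s y : 'I_t) :
  injective rho -> (forall i, rho i \in ~: corner tn) ->
  Pr q (fun H => missed c tn H rho s y) <= q * \prod_(k < K) (1 - q ^+ k.+1) ^+ N.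
Proof.
move=> rhoi rhoC; set y' := widen_ord tn y.
pose side jk : {set 'I_n} := rho (through c s jk) |:
  [set entry_vertex c tn (through c s jk) l | l in [set l : 'I_K | (l < jk.2)%N]].
pose E (o : option ('I_N * 'I_K)) : {set 'I_n * 'I_n} :=
  if o is Some jk then setX (side jk) [set y'] else setX [set widen_ord tn s] [set y'].
pose F (o : option ('I_N * 'I_K)) H := if o is Some jk then 1 - full (E o) H else full (E o) H.
have F0 o H : 0 <= F o H.
  by rewrite /F; case: o => [jk|]; rewrite ?ler0n// subr_ge0 lern1 leq_b1.
have cE jk : #|E (Some jk)| = jk.2.+1.
  rewrite /E cardsX cards1 muln1 /side cardsU1 card_imset; last first.
    by move=> k l /(@widen_inj _ _ tn)/(entry_inj cdiff).
  rewrite -sum1dep_card -(big_ord_widen K (fun=> 1%N)) ?sum1_card ?card_ord; last exact/ltnW/ltn_ord.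
  rewrite (_ : _ \notin _) ?add1n//; apply/imsetP => -[l _ h].
  by have := rhoC (through c s jk); rewrite h inE entry_vertex_corner.
pose r := None :: [seq Some jk | jk <- enum {: 'I_N * 'I_K}].
have disjE o o' : o != o' -> [disjoint E o & E o'].
  have disjX (A B C D : {set 'I_n}) : [disjoint A & B] -> [disjoint setX A C & setX B D].
    rewrite -!setI_eq0 => /eqP/setP AB; apply/eqP/setP => -[u v]; rewrite !inE /=.
    by have := AB u; rewrite !inE; case: (u \in A); case: (u \in B) => //=; rewrite ?andbF.
  have None_side jk : [disjoint [set widen_ord tn s] & side jk].
    rewrite disjoints1 !inE negb_or; apply/andP; split.
      apply/eqP => h; have := rhoC (through c s jk); rewrite -h inE => /negP; apply.
      by apply/imsetP; exists s.
    apply/imsetP => -[l]; rewrite inE => lk /(@widen_inj _ _ tn).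
    rewrite -[LHS](entry_through c s jk) => /(entry_inj cdiff) h.
    by rewrite h ltnn in lk.
  case: o o' => [jk|] [jk'|] //= oo; apply: disjX => //; last by rewrite disjoint_sym.
  rewrite -setI_eq0; apply/eqP/setP => a; rewrite !inE; apply/negP => /andP[].
  move=> /orP[/eqP->|/imsetP[l + ->]] /orP[/eqP|/imsetP[l' +]].
  - by move=> /rhoi/(through_inj cdiff) h; rewrite h eqxx in oo.
  - by move=> _ h; have := rhoC (through c s jk); rewrite h inE entry_vertex_corner.
  - by move=> _ h; have := rhoC (through c s jk'); rewrite -h inE entry_vertex_corner.
  - rewrite !inE => lk lk' /(@widen_inj _ _ tn)/(entry_through_inj cdiff lk lk') h.
    by rewrite h eqxx in oo.
have -> : q * \prod_(k < K) (1 - q ^+ k.+1) ^+ N = Ex q (fun H => \prod_(o <- r) F o H).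
  rewrite (@Ex_indep_prod _ _ _ _ _ E).
  - rewrite /r big_cons big_map big_enum /= Pr_prod_bits// cardsX !cards1 expr1; congr (_ * _).
    have EFS jk : Ex q (F (Some jk)) = 1 - q ^+ jk.2.+1 by rewrite -cE -Ex_not_full.
    under [RHS]eq_bigr do rewrite EFS.
    rewrite -(pair_big predT predT (fun (_ : 'I_N) (k : 'I_K) => 1 - q ^+ k.+1)) /=.
    by rewrite prodr_const card_ord prodrXl.
  - rewrite /r /= map_inj_uniq ?enum_uniq ?andbT; last by move=> ? ? [].
    by apply/mapP => -[].
  - move=> o _; rewrite /F; case: o => [jk|]; last exact: full_dep.
    by move=> f g fg; rewrite (full_dep fg).
  - by move=> o o' _ _; exact: disjE.
apply: (le_Ex q01) => H; case: asboolP => [[h1 h2]|_]; last by apply: prodr_ge0.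
rewrite big1// => o _; rewrite /F; case: o => [jk|]; last first.
  rewrite /full (_ : [forall e in _, _])//; apply/forall_inP => -[u v].
  by rewrite !inE /= => /andP[/eqP-> /eqP->]; rewrite h1.
rewrite /full (_ : [forall e in _, _] = false) ?subr0//; apply/negP => /forall_inP h.
apply: (h2 jk); split.
  by have := h (rho (through c s jk), y'); rewrite !inE !eqxx => /(_ isT)/eqP->.
move=> l lk; apply/eqP/(h (entry_vertex c tn (through c s jk) l, y')).
rewrite in_setX set11 andbT in_setU; apply/orP; right.
by apply/imsetP; exists l; rewrite ?inE.
Qed.

Let C := corner tn.

Definition tuple_support (i : tuple_index t' N) : {set 'I_t} := [set entry c i k | k : 'I_K].

Lemma card_bigcup_le (T T' : finType) (A : {set T}) (M : T -> {set T'}) :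
  (#|\bigcup_(a in A) M a| <= \sum_(a in A) #|M a|)%N.
Proof.
elim/big_ind2: _ => [|S a S' b h h'|//]; first by rewrite cards0.
by rewrite cardsU (leq_trans (leq_subr _ _))// leq_add.
Qed.

Definition disjoint_family (A : {set tuple_index t' N}) :=
  [forall i in A, forall i' in A, (i != i') ==> [disjoint tuple_support i & tuple_support i']].

(** Every tuple of [I] meets a member of a maximal disjoint subfamily, and
    each tuple meets at most [K * K * N] tuples. *)
Lemma large_disjoint_family (I : {set tuple_index t' N}) : (0 < K)%N ->
  exists A : {set tuple_index t' N}, [/\ A \subset I, disjoint_family A &
    (#|I| <= #|A| * (K * K * N))%N].
Proof.
move=> K0.
pose P (A : {set tuple_index t' N}) := (A \subset I) && disjoint_family A.
have P0 : P set0 by rewrite /P sub0set; apply/forall_inP => i; rewrite inE.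
case: (@arg_maxnP _ set0 P (fun A => #|A|) P0) => A /andP[AI dA] Amax.
exists A; split => //.
pose M a := [set i : tuple_index t' N | ~~ [disjoint tuple_support a & tuple_support i]].
have cM a : (#|M a| <= K * K * N)%N.
  pose g (x : 'I_K * 'I_K * 'I_N) : tuple_index t' N := (entry c a x.1.1 - c x.2 x.1.2, x.2).
  have : M a \subset [set g x | x : 'I_K * 'I_K * 'I_N].
    apply/subsetP => i; rewrite inE -setI_eq0 => /set0Pn[u]; rewrite inE => /andP[].
    move=> /imsetP[k _ ->] /imsetP[k' _ h]; apply/imsetP; exists (k, k', i.2) => //.
    by rewrite /g /= h /entry addrK; case: (i).
  move=> /subset_leq_card h; apply: leq_trans h (leq_trans (leq_imset_card _ _) _).
  by rewrite !card_prod !card_ord.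
have IM : I \subset \bigcup_(a in A) M a.
  apply/subsetP => i iI; apply/bigcupP; apply: contrapT => nex.
  have iA : i \notin A.
    apply/negP => iA; apply: nex; exists i; rewrite // inE -setI_eq0 setIid.
    by apply/set0Pn; exists (entry c i (Ordinal K0)); rewrite imset_f.
  have dj a : a \in A -> [disjoint tuple_support a & tuple_support i].
    by move=> aA; apply: contrapT => /negP nd; apply: nex; exists a; rewrite // inE.
  have /Amax : P (i |: A).
    rewrite /P subUset sub1set iI AI; apply/forall_inP => x; rewrite !inE => xA.
    apply/forall_inP => y; rewrite !inE => yA; apply/implyP => xy.
    case/predU1P: xA => [xi|xA]; case/predU1P: yA => [yi|yA].
    - by rewrite xi yi eqxx in xy.
    - by rewrite xi disjoint_sym; exact: dj.
    - by rewrite yi; exact: dj.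
    - by have /forall_inP/(_ _ xA)/forall_inP/(_ _ yA)/implyP/(_ xy) := dA.
  by rewrite /geq /= cardsU1 iA add1n ltnn.
apply: leq_trans (subset_leq_card IM) (leq_trans (card_bigcup_le _ _) _).
by rewrite -sum_nat_const; apply: leq_sum.
Qed.

(** A violation of Hall's condition for the tuples yields [l] disjoint tuples and
    many vertices outside the corner each of which misses part of every one of
    these tuples. Disjointness makes the latter events independent. *)
Lemma no_tuple_matching_prob (zeta : R) : (0 < K)%N -> (t * N <= n - t)%N ->
  (forall l, (0 < l <= t * N)%N -> let w := minn (l * (K * K * N)) (t * N) in
     ((t * N) ^ l * 'C(n - t, w))%:R * (1 - q ^+ K) ^+ (l * (n - t - w)) <= zeta) ->
  Pr q (fun H => forall tau, ~ tuple_matching c tn H tau) <= (t * N)%:R * zeta.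
Proof.
move=> K0 tNn hz.
pose w l := minn (l * (K * K * N)) (t * N).
have cQ : #|{: tuple_index t' N}| = (t * N)%N by rewrite card_prod !card_ord.
pose col (i : tuple_index t' N) (b : 'I_n) : {set 'I_n * 'I_n} :=
  setX [set entry_vertex c tn i k | k : 'I_K] [set b].
pose P (p : {set tuple_index t' N} * {set 'I_n}) :=
  [&& (0 < #|p.1|)%N, disjoint_family p.1, p.2 \subset ~: C & #|p.2| == (n - t - w #|p.1|)%N].
pose F (p : {set tuple_index t' N} * {set 'I_n}) H :=
  \prod_(x <- enum (setX p.1 p.2)) (1 - full (col x.1 x.2) H).
have F0 p H : 0 <= F p H by apply: prodr_ge0 => x _; rewrite subr_ge0 lern1 leq_b1.
have EF p : P p -> Ex q (F p) = (1 - q ^+ K) ^+ (#|p.1| * (n - t - w #|p.1|)).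
  case: p => A J /and4P[/= _ dA JC /eqP cJ].
  rewrite /F (@Ex_indep_prod _ _ _ _ _ (fun x => col x.1 x.2)) ?enum_uniq//=.
  - rewrite -cJ -cardsX big_enum /= -prodr_const; apply: eq_bigr => x _.
    rewrite Ex_not_full cardsX cards1 muln1 card_imset ?card_ord//.
    by move=> k l /(@widen_inj _ _ tn)/(entry_inj cdiff).
  - by move=> x _ f g fg; rewrite (full_dep fg).
  - move=> [i b] [i' b']; rewrite !mem_enum !inE /= => /andP[iA bJ] /andP[i'A b'J] ne.
    rewrite -setI_eq0; apply/eqP/setP => -[u v]; rewrite !inE /=; apply/negP.
    move=> /andP[/andP[/imsetP[k _ ->] /eqP->] /andP[/imsetP[k' _ /(@widen_inj _ _ tn) h] /eqP bb]].
    have ii : i != i' by apply: contraNneq ne => ->; rewrite bb.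
    have := forall_inP dA _ iA => /forall_inP/(_ _ i'A)/implyP/(_ ii).
    rewrite -setI_eq0 => /eqP/setP/(_ (entry c i k)); rewrite !inE.
    by rewrite imset_f// h imset_f.
apply: le_trans (Pr_le_sum q01 (P := P) (F := F) _ _) _ => //.
  move=> H nt.
  have := hall_marriage (X := [set: tuple_index t' N])
    (r := fun i b => (b \in ~: C) && [forall k, H (entry_vertex c tn i k, b)]).
  move=> hm; have [hall|] := pselect (forall I : {set tuple_index t' N}, I \subset [set: tuple_index t' N] ->
    (#|I| <= #|[set b | [exists i in I, (b \in ~: C) && [forall k, H (entry_vertex c tn i k, b)]]]|)%N).
    have [f [fi fE]] := hm hall.
    case: (nt (fun i => odflt (widen_ord tn ord0) (f i))); split.
      move=> i i'; have [u fu _] := fE i (in_setT _); have [v fv _] := fE i' (in_setT _).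
      by rewrite fu fv /= => uv; apply: fi; rewrite ?inE// fu fv uv.
    move=> i; have [u -> /andP[uC /forallP uk]] := fE i (in_setT _); by split.
  rewrite -existsNP => -[I] /not_implyP[_ /negP]; rewrite -ltnNge => hI.
  set NI := [set b | _] in hI.
  have [A [AI dA cA]] := large_disjoint_family I K0.
  have NC : NI \subset ~: C by apply/subsetP => b; rewrite inE => /exists_inP[i _ /andP[]].
  have Iw : (#|I| <= w #|A|)%N by rewrite leq_min cA -cQ max_card.
  have [|J JN cJ] := @subset_of_card _ (~: C :\: NI) (n - t - w #|A|).
    by rewrite cardsD (setIidPr NC) card_cornerC leq_sub2l// (leq_trans (ltnW hI)).
  exists (A, J).
    rewrite /P /= dA cJ eqxx (subset_trans JN (subsetDl _ _)) !andbT.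
    by case: posnP cA hI => // ->; rewrite mul0n leqn0 => /eqP->.
  rewrite /F big_seq big1// => -[i b]; rewrite mem_enum inE /= => /andP[iA bJ].
  rewrite /full (_ : [forall e in _, _] = false) ?subr0//; apply/negP => /forall_inP h.
  have := subsetP JN _ bJ; rewrite in_setD => /andP[/negP bN bC]; apply: bN.
  rewrite inE; apply/exists_inP; exists i; first exact: (subsetP AI).
  rewrite bC; apply/forallP => k; apply/eqP/h.
  by rewrite !inE /= eqxx andbT imset_f.
rewrite (eq_bigr _ EF).
have [Q0|Q0] := posnP (t * N).
  rewrite big1 ?Q0 ?mul0r// => -[A J] /and4P[/= A0 _ _ _].
  by have := leq_trans A0 (max_card A); rewrite cQ Q0.
have Q1 := prednK Q0; set M := (t * N).-1 in Q1.
rewrite (partition_big (fun p : {set tuple_index t' N} * {set 'I_n} => inord #|p.1|.-1 : 'I_M.+1) predT) //=.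
rewrite mulr_natl -Q1 -[X in _ *+ X](card_ord M.+1) -sumr_const.
apply: ler_sum => l _.
have qK : 0 <= 1 - q ^+ K by rewrite subr_ge0 exprn_ile1//; case/andP: q01.
pose B := setX [set A : {set tuple_index t' N} | A \subset setT & #|A| == l.+1]
   [set J : {set 'I_n} | J \subset ~: C & #|J| == (n - t - w l.+1)%N].
apply: (@le_trans _ _ (\sum_(p in B) (1 - q ^+ K) ^+ (l.+1 * (n - t - w l.+1)))).
  rewrite [leLHS]big_mkcond [leRHS]big_mkcond /=; apply: ler_sum => -[A J] _ /=.
  case: ifPn => [/andP[/and4P[/= A0 _ JC /eqP cJ] il]|_]; last by case: ifP => // _; rewrite exprn_ge0.
  have Al : #|A| = l.+1.
    move/eqP: il => /(congr1 val) /=; rewrite inordK => [<-|]; first by rewrite prednK.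
    by rewrite prednK// Q1 -cQ max_card.
  by rewrite !inE /= subsetT JC cJ Al !eqxx.
rewrite sumr_const cardsX !cards_draws cardsT cQ card_cornerC -mulr_natl.
have ll : (0 < l.+1 <= t * N)%N by rewrite /= -Q1 ltn_ord.
apply: le_trans (hz _ ll); rewrite ler_wpM2r ?exprn_ge0// ler_nat leq_mul ?bin_leq_exp//.
by rewrite bin_sub// (leq_trans (geq_minr _ _)).
Qed.

(** The two matchings only involve pairs outside the columns of the corner. Once
    these are fixed, the pairs that decide whether an edge of the corner is
    missed are still independent of them. *)
Lemma tuple_cover_prob (zeta : R) : (0 < K)%N -> (t < n)%N -> (t * N <= n - t)%N ->
  (n - t)%:R ^+ 2 * expR (- (q * (n - t)%:R / 2)) <= 1 ->
  (forall l, (0 < l <= t * N)%N -> let w := minn (l * (K * K * N)) (t * N) in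
     ((t * N) ^ l * 'C(n - t, w))%:R * (1 - q ^+ K) ^+ (l * (n - t - w)) <= zeta) ->
  Pr q (fun H : graph n => ~ coverable H (n - t)) <=
    (n - t)%:R ^+ 3 * expR (- (q * (n - t)%:R / 2)) + (t * N)%:R * zeta +
    t%:R ^+ 2 * (q * \prod_(k < K) (1 - q ^+ k.+1) ^+ N).
Proof.
move=> K0 tlt tNn m1 hz.
pose PM (H : graph n) := matchable H (~: C) (~: C).
pose TM (H : graph n) := exists tau, tuple_matching c tn H tau.
have pm : Pr q (fun H : graph n => ~ PM H) <= (n - t)%:R ^+ 3 * expR (- (q * (n - t)%:R / 2)).
  have := @empty_box_no_matching R n q q01 set0 (~: C) (~: C) (n - t)%N.
  rewrite subn_gt0 card_cornerC cards0 expr0 mul1r => /(_ tlt erefl erefl) h.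
  apply: le_trans (h _ m1); last by rewrite -setI_eq0 set0I.
  by apply: (le_Pr q01) => H nm; split => //; apply/forall_inP => e; rewrite inE.
have tm : Pr q (fun H => ~ TM H) <= (t * N)%:R * zeta.
  apply: le_trans (no_tuple_matching_prob K0 tNn hz).
  by apply: (le_Pr q01) => H nm tau h; apply: nm; exists tau.
set beta := t%:R ^+ 2 * _.
have beta0 : 0 <= beta.
  rewrite mulr_ge0 ?exprn_ge0// mulr_ge0//; first by case/andP: q01.
  apply: prodr_ge0 => k _; rewrite exprn_ge0// subr_ge0 exprn_ile1//; by case/andP: q01.
suff last : Pr q (fun H => (PM H /\ TM H) /\ ~ coverable H (n - t)) <= beta.
  apply: (@le_trans _ _ (Pr q (fun H => (~ PM H \/ ~ TM H) \/ ((PM H /\ TM H) /\ ~ coverable H (n - t))))).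
    apply: (le_Pr q01) => H nc.
    by have [hp|hp] := pselect (PM H); [have [ht|ht] := pselect (TM H)|]; [right|left; right|left; left].
  apply: le_trans (Pr_or q01 _ _) _; rewrite lerD//.
  by apply: le_trans (Pr_or q01 _ _) _; rewrite lerD.
pose D : {set 'I_n * 'I_n} := [set e | e.2 \in ~: C].
rewrite /Pr -(Ex_mix _ D) -[leRHS](Ex_cst ('I_n * 'I_n)%type q beta); apply: (le_Ex q01) => f.
have mixD g x y : y \in ~: C -> mix D f g (x, y) = f (x, y).
  by move=> yC; rewrite ffunE !inE /=; move: yC; rewrite inE => ->.
have mixC g x y : mix D f g (x, widen_ord tn y) = g (x, widen_ord tn y).
  by rewrite ffunE !inE /= imset_f.
have [[mu [mui muX]]|nP] := pselect (PM f); last first.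
  rewrite -[leRHS](Ex_cst ('I_n * 'I_n)%type q beta); apply: (le_Ex q01) => g.
  case: asboolP => // -[[[mu [mui muX]] _] _]; case: nP; exists mu; split => // x /muX[h].
  by rewrite mixD.
have [[tau [taui tauY]]|nT] := pselect (TM f); last first.
  rewrite -[leRHS](Ex_cst ('I_n * 'I_n)%type q beta); apply: (le_Ex q01) => g.
  case: asboolP => // -[[_ [tau [taui tauY]]] _]; case: nT; exists tau; split => // i.
  by have [h1 h2] := tauY i; split => // k; have := h2 k; rewrite mixD.
have muC : mu @: (~: C) = ~: C.
  apply/eqP; rewrite eqEcard card_in_imset// leqnn andbT.
  by apply/subsetP => y /imsetP[x /muX[h _] ->].
have rhoex i : exists x, x \in ~: C /\ mu x = tau i.
  have /imsetP[x xC tx] : tau i \in mu @: (~: C) by rewrite muC; exact: (tauY i).1.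
  by exists x.
have [rho rhoP] := choice rhoex.
apply: le_trans (Pr_le_sum q01 (P := predT)
  (F := fun (p : 'I_t * 'I_t) g => `[< missed c tn g rho p.1 p.2 >]%:R)
  (E := fun g => (PM (mix D f g) /\ TM (mix D f g)) /\ ~ coverable (mix D f g) (n - t)) _ _) _.
- by move=> p g _; rewrite ler0n.
- move=> g [_ nc]; apply: contrapT => nex; apply: nc.
  apply: (@cover_of_tuples _ _ _ _ c tn cdiff (mix D f g) mu tau rho) => //.
    by move=> x xC; have [h1 h2] := muX x xC; rewrite mixD.
    by split => // i; have [h1 h2] := tauY i; split => // k; rewrite mixD.
  move=> s y [h1 h2]; apply: nex; exists (s, y) => //=; rewrite asboolT//; split.
    by rewrite -(mixC g).
  move=> jk [h3 h4]; apply: (h2 jk); split; first by rewrite mixC.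
  by move=> l /h4; rewrite mixC.
apply: (@le_trans _ _ (\sum_(p : 'I_t * 'I_t) (q * \prod_(k < K) (1 - q ^+ k.+1) ^+ N))).
  apply: ler_sum => -[s y] _ /=; apply: missed_prob => [i i' h|i]; last exact: (rhoP i).1.
  by apply: taui; rewrite -(rhoP i).2 -(rhoP i').2 h.
by rewrite sumr_const card_prod !card_ord -mulr_natl natrM /beta expr2.
Qed.

End TupleProbability.


(** * A difference family *)

Lemma pow2_diff_inj k l k' l' : (l < k)%N -> (l' < k')%N ->
  (2 ^ k - 2 ^ l = 2 ^ k' - 2 ^ l')%N -> k = k' /\ l = l'.
Proof.
have aux a b a' b' : (b < a)%N -> (b' < a')%N -> (b < b')%N ->
    (2 ^ a - 2 ^ b = 2 ^ a' - 2 ^ b')%N -> False.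
  move=> ba ba' bb E.
  have h1 : (2 ^ b < 2 ^ a)%N by rewrite ltn_exp2l.
  have h2 : (2 ^ b' < 2 ^ a')%N by rewrite ltn_exp2l.
  have E1 : (2 ^ a + 2 ^ b' = 2 ^ a' + 2 ^ b)%N by lia.
  have p c : (b < c)%N -> (2 ^ c = 2 ^ b * (2 * 2 ^ (c - b.+1)))%N.
    by move=> bc; rewrite mulnA -expnSr -expnD subnKC.
  move: E1; rewrite (p a)// (p b')// (p a') ?(ltn_trans bb)//.
  have : (0 < 2 ^ b)%N by rewrite expn_gt0.
  move: (2 ^ b)%N (2 ^ (a - b.+1))%N (2 ^ (b' - b.+1))%N (2 ^ (a' - b.+1))%N => x u v w x0.
  move=> h; have {}h : (x * (u.*2 + v.*2) == x * w.*2.+1)%N by apply/eqP; rewrite -!mul2n; nia.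
  by move: h; rewrite eqn_pmul2l// => /eqP; lia.
move=> lk lk' E; have ll : l = l'.
  by case: (ltngtP l l') => // h; [case: (aux _ _ _ _ lk lk' h E)|case: (aux _ _ _ _ lk' lk h (esym E))].
split=> //; move: E; rewrite -ll => E.
have h1 : (2 ^ l < 2 ^ k)%N by rewrite ltn_exp2l.
have h2 : (2 ^ l < 2 ^ k')%N by rewrite ltn_exp2l// ll.
have /eqP : (2 ^ k = 2 ^ k')%N by lia.
by rewrite eqn_exp2l// => /eqP.
Qed.

(** In the family [N * K * 2 ^ k + j * k] the first summand of a difference
    determines [k] and [l], and then the second one determines [j]. *)
Lemma difference_family_exists N K t' : (0 < K)%N -> (N * K * 2 ^ K <= t'.+1)%N ->
  exists c : 'I_N -> 'I_K -> 'I_t'.+1, difference_family c.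
Proof.
move=> K0 hM.
pose v (j : 'I_N) (k : 'I_K) := (N * K * 2 ^ k + j * k)%N.
have vlt j k : (v j k < t'.+1)%N.
  apply: leq_trans hM; rewrite /v.
  have h1 : (2 ^ k.+1 <= 2 ^ K)%N by rewrite leq_exp2l// ltn_ord.
  have h2 : (j * k < N * K)%N.
    by have := ltn_ord j; have := ltn_ord k; nia.
  have h3 : (0 < 2 ^ k)%N by rewrite expn_gt0.
  move: h1; rewrite expnS; nia.
pose c j k : 'I_t'.+1 := inord (v j k).
have cv j k : c j k = v j k :> nat by rewrite inordK.
have vk j (l k : 'I_K) : (l < k)%N -> (v j l < v j k)%N.
  move=> lk; rewrite /v; have h1 : (2 ^ l < 2 ^ k)%N by rewrite ltn_exp2l.
  have NK0 : (0 < N * K)%N by rewrite muln_gt0 (leq_ltn_trans _ (ltn_ord j)).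
  by rewrite -addSn leq_add ?ltn_pmul2l// leq_mul// ltnW.
have cB j (k l : 'I_K) : (l < k)%N -> c j k - c j l = inord (v j k - v j l).
  move=> lk; apply/eqP; rewrite subr_eq; apply/eqP/val_inj => /=.
  rewrite !inordK//; last by rewrite (leq_ltn_trans (leq_subr _ _)).
  by rewrite subnK ?modn_small// ltnW// vk.
exists c; split.
  move=> j k l /(congr1 val) /=; rewrite !inordK// => h.
  apply/val_inj; case: (ltngtP k l) => // kl; by have := vk j _ _ kl; rewrite h ltnn.
move=> j j' k l k' l' lk lk'; rewrite !cB// => /(congr1 val) /=.
have sub_lt jj (kk ll : 'I_K) : (v jj kk - v jj ll < t'.+1)%N.
  by rewrite (leq_ltn_trans (leq_subr _ _)).
rewrite !inordK// => E.
have vE jj (kk ll : 'I_K) : (ll < kk)%N -> (v jj kk - v jj ll = (2 ^ kk - 2 ^ ll) * (N * K) + jj * (kk - ll))%N.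
  move=> lkk; rewrite /v; have h1 : (2 ^ ll < 2 ^ kk)%N by rewrite ltn_exp2l.
  rewrite mulnBl mulnBr ![(_ * (N * K))%N]mulnC; nia.
have small (jj : 'I_N) (kk ll : 'I_K) : (jj * (kk - ll) < N * K)%N.
  by have := ltn_ord jj; have := ltn_ord kk; nia.
have NK0 : (0 < N * K)%N by rewrite (leq_ltn_trans _ (small j k l)).
move: E; rewrite !vE// => E.
have E1 := congr1 (divn^~ (N * K)%N) E; have E2 := congr1 (modn^~ (N * K)%N) E.
move: E1 E2; rewrite !divnMDl// !modnMDl !divn_small// !modn_small// !addn0 => E1 E2.
have [/val_inj kk /val_inj ll] := pow2_diff_inj lk lk' E1.
split => //; apply/val_inj/eqP; move: E2; rewrite -kk -ll => /eqP.
by rewrite eqn_pmul2r// subn_gt0.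
Qed.

Lemma difference_family1 N t' : difference_family (fun (_ : 'I_N) (_ : 'I_1) => ord0 : 'I_t'.+1).
Proof.
split=> [j k l _|j j' k l k' l']; first by rewrite [k]ord1 [l]ord1.
by rewrite [k]ord1 [l]ord1.
Qed.

(** * Estimates for the exponential function and for [phi] *)

Section Estimates.
Variable R : realType.
Implicit Types x y q : R.

Lemma poly_le_exp k (C c : R) : 0 < c -> exists x0, forall x, x0 <= x -> C * x ^+ k <= expR (c * x).
Proof.
move=> c0; exists (Num.max 0 (C * k.+1`!%:R / c ^+ k.+1)) => x; rewrite ge_max => /andP[x0 xC].
apply: le_trans (expR_ge1Dxn k (mulr_ge0 (ltW c0) x0)).
rewrite -[leLHS]add0r lerD// ler_pdivlMr ?ltr0n ?fact_gt0// exprMn [x ^+ k.+1]exprSr.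
move: xC; rewrite ler_pdivrMr ?exprn_gt0// => /(ler_wpM2l (exprn_ge0 k x0)).
move: (c ^+ k.+1) (x ^+ k) (_`!%:R) => u v f h.
have -> : C * v * f = v * (C * f) by ring.
by have -> : u * (v * x) = v * (x * u) by ring.
Qed.

Lemma expR1_le3 : expR 1 <= 3 :> R.
Proof.
(* Eighth roots, because the fourth root only gives [(4/3)^4 > 3]. *)
have h : expR (1/8) <= 8/7 :> R.
  rewrite -[expR _]invrK -expRN -[leRHS]invrK lef_pV2 ?posrE ?expR_gt0 ?invr_gt0//.
  by apply: le_trans (expR_ge1Dx _); lra.
have -> : 1 = 8%:R * (1/8) :> R by field.
rewrite expRM_natl; apply: (@le_trans _ _ ((8/7) ^+ 8)).
  by rewrite lerXn2r ?nnegrE ?expR_ge0//; lra.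
by rewrite !exprS expr0; lra.
Qed.

Lemma expR_le1D2 x : 0 <= x <= 1 / 2 -> expR x <= 1 + 2 * x.
Proof.
move=> /andP[x0 x1].
have h1 : expR x <= (1 - x)^-1.
  rewrite -[expR x]invrK lef_pV2 ?posrE ?invr_gt0 ?expR_gt0//; last by lra.
  by rewrite -expRN expR_ge1Dx.
by apply: le_trans h1 _; rewrite -[leLHS]mul1r ler_pdivrMr; nra.
Qed.

Lemma expRN2_le x : 0 <= x <= 1 / 2 -> expR (- (2 * x)) <= 1 - x.
Proof.
move=> /andP[x0 x1]; rewrite expRN.
apply: (@le_trans _ _ (1 + 2 * x)^-1).
  by rewrite lef_pV2 ?posrE ?expR_gt0 ?expR_ge1Dx//; lra.
by rewrite -[leLHS]mul1r ler_pdivrMr; nra.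
Qed.

(** A single term of the expansion of [(1 + y) ^ m]. *)
Lemma binom_exp (m w : nat) y : 0 < y -> 'C(m, w)%:R <= expR (y * m%:R) / y ^+ w.
Proof.
move=> y0; rewrite ler_pdivlMr ?exprn_gt0//.
have [wm|wm] := leqP w m; last by rewrite bin_small// mul0r expR_ge0.
apply: (@le_trans _ _ ((1 + y) ^+ m)).
  rewrite exprDn_comm; last by rewrite /GRing.comm mul1r mulr1.
  rewrite (bigD1 (Ordinal (wm : w < m.+1)%N)) //= expr1n mul1r mulr_natl lerDl.
  by apply: sumr_ge0 => i _; rewrite expr1n mul1r mulrn_wge0// exprn_ge0// ltW.
by rewrite mulrC expRM_natl lerXn2r ?nnegrE ?expR_ge0 ?expR_ge1Dx// addr_ge0// ltW.
Qed.

Definition euler_prod q N := \prod_(k < N) (1 - q ^+ k.+1).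

Lemma euler_prod_gt0 q N : 0 < q <= 1 / 2 -> 0 < euler_prod q N.
Proof.
move=> /andP[q0 q2]; apply: prodr_gt0 => k _; rewrite subr_gt0 exprn_ilt1//; lra.
Qed.

(** Every factor [1 - x] is at least [expR (- (2 * x))], and [2 * x] is at most
    [4 * (x - q * x)], which telescopes over the powers of [q]. *)
Lemma euler_prod_tail q K N : 0 < q <= 1 / 2 -> (K <= N)%N ->
  euler_prod q K * expR (- (4 * (q ^+ K.+1 - q ^+ N.+1))) <= euler_prod q N.
Proof.
move=> q02 /subnKC <-; move: (N - K)%N => d; have /andP[q0 q2] := q02.
elim: d => [|d IH]; first by rewrite addn0 subrr mulr0 oppr0 expR0 mulr1.
rewrite addnS /euler_prod big_ord_recr /= -/(euler_prod _ _).
set x := q ^+ (K + d).+1.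
have x0 : 0 < x by rewrite exprn_gt0.
have x2 : x <= 1 / 2.
  rewrite /x exprS; apply: le_trans q2; rewrite ler_piMr ?(ltW q0)// exprn_ile1//; lra.
have xq : q ^+ (K + d).+2 = q * x by rewrite exprS.
have -> : expR (- (4 * (q ^+ K.+1 - q ^+ (K + d).+2))) =
    expR (- (4 * (q ^+ K.+1 - x))) * expR (- (4 * (x - q * x))).
  by rewrite -expRD xq; congr expR; ring.
have P0 := ltW (euler_prod_gt0 K q02).
rewrite mulrA; apply: ler_pM; rewrite ?mulr_ge0 ?expR_ge0//.
apply: (@le_trans _ _ (expR (- (2 * x)))); last by apply: expRN2_le; rewrite (ltW x0) x2.
by rewrite ler_expR; nra.
Qed.

Lemma phi_cvg q : 0 < q <= 1 / 2 ->
  (fun N => \prod_(1 <= i < N.+1) (1 - q ^+ i)) = euler_prod q /\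
  cvgn (euler_prod q).
Proof.
move=> q02; have /andP[q0 q2] := q02; split.
  by apply/funext => N; rewrite big_add1 /= big_mkord.
apply: nonincreasing_is_cvgn.
  apply/nonincreasing_seqP => N; rewrite /euler_prod big_ord_recr /= -/(euler_prod q N).
  by rewrite ler_piMr ?(ltW (euler_prod_gt0 _ q02))// gerBl exprn_ge0// ltW.
by exists 0 => _ [N _ <-]; rewrite ltW// euler_prod_gt0.
Qed.

Lemma phi_le q K : 0 < q <= 1 / 2 -> phi q <= euler_prod q K.
Proof.
move=> q02; have [E cv] := phi_cvg q02; rewrite /phi E.
apply: limr_le => //; near=> N.
have /andP[q0 q2] := q02.
have : (K <= N)%N by near: N; exact: nbhs_infty_ge.
move=> /subnKC <-; elim: (N - K)%N => [|d IH]; first by rewrite addn0.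
rewrite addnS /euler_prod big_ord_recr /=; apply: le_trans IH.
by rewrite ler_piMr ?(ltW (euler_prod_gt0 _ q02))// gerBl exprn_ge0// ltW.
Unshelve. all: by end_near. Qed.

Lemma phi_ge q K : 0 < q <= 1 / 2 -> euler_prod q K * expR (- (4 * q ^+ K.+1)) <= phi q.
Proof.
move=> q02; have [E cv] := phi_cvg q02; rewrite /phi E.
apply: limr_ge => //; near=> N.
have KN : (K <= N)%N by near: N; exact: nbhs_infty_ge.
apply: le_trans (euler_prod_tail q02 KN); rewrite ler_wpM2l ?(ltW (euler_prod_gt0 _ q02))//.
have /andP[q0 _] := q02.
by rewrite ler_expR lerN2 ler_pM2l// gerBl exprn_ge0// ltW.
Unshelve. all: by end_near. Qed.

End Estimates.


(** * Small [q]: one empty box *)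

Section SmallQ.
Variable R : realType.
Implicit Types (q eps e L l rho eta M P delta : R).

Lemma log_scale n q : 1 <= ln n%:R :> R -> ln n%:R ^+ 2 <= q * n%:R -> q <= 1 ->
  [/\ (0 < n)%N, n%:R = expR (ln n%:R) :> R, 0 < q,
    q * n%:R = expR (ln (q * n%:R)) & q = expR (ln (q * n%:R) - ln n%:R)].
Proof.
move=> L1 LD q1; have n0 : (0 < n)%N by case: n L1 {LD} => // /=; rewrite ln0// ler10.
have nR : 0 < n%:R :> R by rewrite ltr0n.
have D0 : 0 < q * n%:R by apply: lt_le_trans LD; rewrite exprn_gt0//; lra.
have q0 : 0 < q by move: D0; rewrite pmulr_lgt0.
split; rewrite ?lnK ?posrE//.
by rewrite lnM ?posrE// addrK lnK ?posrE.
Qed.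

Lemma ln_scale_le n q : 1 <= ln n%:R :> R -> ln n%:R ^+ 2 <= q * n%:R -> q <= 1 ->
  ln (q * n%:R) <= ln n%:R.
Proof.
move=> L1 LD q1; have [n0 nE q0 DE qE] := log_scale L1 LD q1.
by move: q1; rewrite {1}qE -[leRHS]expR0 ler_expR subr_le0.
Qed.

Lemma ln_scale_ge n q x : 1 <= ln n%:R :> R -> ln n%:R ^+ 2 <= q * n%:R -> q <= 1 ->
  expR x <= ln n%:R -> x <= ln (q * n%:R).
Proof.
move=> L1 LD q1 xL; have [n0 nE q0 DE qE] := log_scale L1 LD q1.
rewrite -ler_expR -DE; apply: le_trans LD; apply: (le_trans xL).
by rewrite expr2 ler_peMr//; lra.
Qed.

(** Three quarters of the vertices are enough for a failure probability of at
    most [1 / n], because [q * n] is at least [ln n ^ 2]. *)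
Lemma matching_error (n m : nat) q L : 11 <= L -> n%:R = expR L -> L ^+ 2 <= q * n%:R ->
  0 < q -> (m <= n)%N -> (3 * n <= 4 * m)%N ->
  m%:R ^+ 3 * expR (- (q * m%:R / 2)) <= expR (- L) /\
  m%:R ^+ 2 * expR (- (q * m%:R / 2)) <= 1.
Proof.
move=> L11 nE LD q0 mn nm.
have mR : m%:R <= expR L by rewrite -nE ler_nat.
have mq : 3 / 4 * L ^+ 2 <= q * m%:R.
  have : 3 * n%:R <= 4 * m%:R :> R by rewrite -!natrM ler_nat.
  by move: LD; set N := n%:R; set M := m%:R => LD h; nra.
have k (j : nat) (x : R) : j%:R * L - 3 / 8 * L ^+ 2 <= x -> m%:R ^+ j * expR (- (q * m%:R / 2)) <= expR x.
  move=> h; apply: (@le_trans _ _ (expR L ^+ j * expR (- (q * m%:R / 2)))).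
    by rewrite ler_wpM2r ?expR_ge0// lerXn2r ?nnegrE ?expR_ge0.
  rewrite -expRM_natl -expRD ler_expR; move: h mq; move: (q * m%:R) (j%:R * L) => u v; lra.
have LL : 11 * L <= L ^+ 2 by rewrite expr2 ler_wpM2r//; lra.
split; first by apply: k; move: LL; move: (L ^+ 2) => u; lra.
by rewrite -[leRHS]expR0; apply: k; move: LL; move: (L ^+ 2) => u; lra.
Qed.

(** Since [q * rho] is at most [8 l^2 e^(-l)], it is small even when multiplied
    by [expR ((1 - eps / 8) * l)]: this is where the side of the boxes has to
    stay below [2 l / q] by a constant factor. *)
Lemma second_moment_factor_le q rho l eps x0s : 0 < q -> 0 <= rho -> 0 < eps < 1 -> 1 <= l ->
  432 * l ^+ 2 <= expR l -> 48 * l ^+ 2 <= expR (eps / 8 * l) ->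
  q * rho <= 8 * l ^+ 2 / expR l -> x0s <= (1 - eps / 8) * l ->
  expR (rho * (expR (expR 2 * q * rho) - 1)) + expR (expR 3 * rho - q^-1)
     + expR (expR (1 + x0s) * rho - q^-1) ^+ 2 <=
  expR (18 * q * rho ^+ 2) + 2 * expR (- (2 * q)^-1).
Proof.
move=> q0 rho0 /andP[e0 e1] l1 h1 h2 qr hx.
have e2 : expR 2 <= 9 :> R.
  have -> : 2 = 2%:R * 1 :> R by rewrite mulr1.
  rewrite expRM_natl; apply: (@le_trans _ _ (3 ^+ 2)); last by rewrite expr2; lra.
  by rewrite lerXn2r ?nnegrE ?expR_ge0 ?expR1_le3.
have e3 : expR 3 <= 27 :> R.
  have -> : 3 = 3%:R * 1 :> R by rewrite mulr1.
  rewrite expRM_natl; apply: (@le_trans _ _ (3 ^+ 3)); last by rewrite !exprS expr0; lra.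
  by rewrite lerXn2r ?nnegrE ?expR_ge0 ?expR1_le3.
have qrho0 : 0 <= q * rho by rewrite mulr_ge0// ltW.
have qr54 : q * rho <= 1 / 54.
  apply: (le_trans qr); rewrite ler_pdivrMr ?expR_gt0//.
  by move: h1; move: (l ^+ 2) (expR l) => u v; lra.
have rq : rho <= 1 / 54 / q by rewrite ler_pdivlMr// mulrC.
have q2 : (2 * q)^-1 = q^-1 / 2 by rewrite invfM mulrC.
have qi0 : 0 < q^-1 by rewrite invr_gt0.
have M1 : expR (rho * (expR (expR 2 * q * rho) - 1)) <= expR (18 * q * rho ^+ 2).
  rewrite ler_expR.
  have -> : 18 * q * rho ^+ 2 = rho * (18 * (q * rho)) by ring.
  apply: ler_wpM2l => //.
  have : expR (expR 2 * q * rho) <= 1 + 2 * (expR 2 * q * rho).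
    apply: expR_le1D2; rewrite -mulrA mulr_ge0 ?expR_ge0//=.
    by move: e2 (expR_ge0 (2 : R)) qr54 qrho0; move: (expR 2) (q * rho) => u v; nra.
  have : expR 2 * q * rho <= 9 * (q * rho) by rewrite -mulrA ler_wpM2r.
  by move: (expR (expR 2 * q * rho)) (expR 2 * q * rho) (q * rho) => w u v; lra.
have M2 : expR (expR 3 * rho - q^-1) <= expR (- (2 * q)^-1).
  rewrite ler_expR q2; move: rq e3 qi0 rho0 (expR_ge0 (3 : R)); move: (expR 3) (q^-1) => u v; nra.
have M3 : expR (expR (1 + x0s) * rho - q^-1) <= expR (- (2 * q)^-1).
  rewrite ler_expR q2; suff : expR (1 + x0s) * rho <= q^-1 / 2 by move: (q^-1) => v; lra.
  rewrite -(ler_pM2l q0).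
  have -> : q * (q^-1 / 2) = 1 / 2 by rewrite mulrA divff ?gt_eqF.
  rewrite mulrCA.
  apply: (@le_trans _ _ (3 * expR ((1 - eps / 8) * l) * (8 * l ^+ 2 / expR l))).
    apply: ler_pM; rewrite ?expR_ge0// expRD.
    by apply: ler_pM; rewrite ?expR_ge0 ?expR1_le3// ler_expR.
  have -> : 3 * expR ((1 - eps / 8) * l) * (8 * l ^+ 2 / expR l) =
      24 * l ^+ 2 * expR (- (eps / 8 * l)).
    have -> : (1 - eps / 8) * l = l + - (eps / 8 * l) by ring.
    by rewrite expRD; field; rewrite gt_eqF ?expR_gt0.
  rewrite expRN ler_pdivrMr ?expR_gt0//.
  by move: h2; move: (l ^+ 2) (expR _) => u v; lra.
have M3' : expR (expR (1 + x0s) * rho - q^-1) ^+ 2 <= expR (- (2 * q)^-1).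
  apply: (le_trans _ M3); rewrite expr2 ler_piMr ?expR_ge0//.
  apply: (le_trans M3); rewrite -expR0 ler_expR oppr_le0 invr_ge0 mulr_ge0// ltW//.
by move: M1 M2 M3'; move: (expR _) (expR _) (expR _) (expR _) (_ ^+ 2) => *; lra.
Qed.

Lemma block_count (s n : nat) : (0 < s)%N -> (4 * s <= n)%N ->
  [/\ (s < n)%N, (0 < n %/ s)%N, (s * (n %/ s) <= n)%N & (3 * n <= 4 * (s * (n %/ s)))%N].
Proof.
move=> s0 sn; split; first by lia.
- by rewrite divn_gt0//; lia.
- by rewrite mulnC leq_trunc_div.
- have := divn_eq n s; have := @ltn_pmod n s s0; rewrite mulnC.
  by move: (n %% s)%N (s * (n %/ s))%N => u v; lia.
Qed.

(** The side [s] is about [(2 - eps / 2) l / q], and [r = n / s] leaves room for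
    [s] blocks. *)
Lemma box_parameters n q l eps : 0 < eps < 1 -> 0 < q <= eps / 100 -> 1 <= l ->
  432 * l ^+ 2 <= expR l -> q * n%:R = expR l ->
  exists s r : nat, [/\ (0 < s < n)%N, (0 < r)%N, (s * r <= n)%N, (4 * s <= n)%N &
    [/\ (2 - eps / 2) * l / q < s%:R, q * (s%:R / r%:R) <= 8 * l ^+ 2 / expR l &
     q / (1 - q) * s%:R / 2 <= (1 - eps / 8) * l]].
Proof.
move=> /andP[e0 e1] /andP[q0 qe] l1 h1 DE.
set a := (2 - eps / 2) * l / q.
have a0 : 0 <= a by rewrite divr_ge0 ?(ltW q0)// mulr_ge0; lra.
have [s [s0 as_ sa]] : exists s : nat, [/\ (0 < s)%N, a < s%:R & s%:R <= a + 1].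
  exists (Num.truncn a).+1; split; rewrite ?truncnS_gt//.
  by rewrite -natr1 lerD2r truncn_le.
have qs : q * s%:R <= (2 - eps / 2) * l + q.
  have -> : (2 - eps / 2) * l + q = q * (a + 1) by rewrite /a; field; rewrite gt_eqF.
  by rewrite ler_pM2l.
have qs2 : q * s%:R <= 2 * l by nra.
have sn4 : (4 * s <= n)%N.
  rewrite -(ler_nat R) natrM -(ler_pM2l q0) DE; apply: le_trans h1.
  have -> : q * (4 * s%:R) = 4 * (q * s%:R) by ring.
  by rewrite expr2; nra.
have [sn r0 srn srn'] := block_count s0 sn4.
exists s, (n %/ s)%N; split; rewrite ?s0//.
have n0 : (0 < n)%N := ltn_trans s0 sn.
have rR : 0 < (n %/ s)%:R :> R by rewrite ltr0n.
have qr : q <= 1 / 100 by lra.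
split => //.
  rewrite -(ler_pM2l q0); set x := s%:R; set y := (n %/ s)%:R.
  have x0 : 0 < x by rewrite ltr0n.
  have xy : 3 * n%:R <= 4 * (x * y) by rewrite -!natrM ler_nat.
  have -> : q * (q * (x / y)) = (q * x) ^+ 2 / (x * y) by field; rewrite !gt_eqF.
  have -> : q * (8 * l ^+ 2 / expR l) = 8 * l ^+ 2 / n%:R.
    by rewrite -DE; field; rewrite !gt_eqF// ltr0n.
  have nR : 0 < n%:R :> R by rewrite ltr0n.
  rewrite ler_pdivrMr ?mulr_gt0// mulrAC ler_pdivlMr//.
  have : (q * x) ^+ 2 <= 4 * l ^+ 2.
    have -> : 4 * l ^+ 2 = (2 * l) ^+ 2 by ring.
    by rewrite lerXn2r ?nnegrE ?mulr_ge0 ?(ltW q0) ?(ltW x0)//; lra.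
  have : 0 <= l ^+ 2 := sqr_ge0 l.
  by move: xy nR; move: (x * y) (n%:R) ((q * x) ^+ 2) (l ^+ 2) => u v w z; nra.
have -> : q / (1 - q) * s%:R / 2 = (q * s%:R) / (2 * (1 - q)) by field; rewrite gt_eqF//; lra.
rewrite ler_pdivrMr; last by lra.
apply: (le_trans qs).
have h : 2 * (q * l) <= eps / 50 * l.
  by rewrite mulrA ler_wpM2r//; lra.
have h2 : eps <= eps * l by rewrite ler_peMr// ltW.
have h3 : 0 <= eps * (q * l) by rewrite !mulr_ge0 ?ltW//; lra.
have -> : (1 - eps / 8) * l * (2 * (1 - q)) = 2 * l - eps * l / 4 - 2 * (q * l) + eps * (q * l) / 4 by field.
have -> : (2 - eps / 2) * l = 2 * l - eps * l / 2 by field.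
by move: h h2 h3 qe; rewrite mulrAC; move: (eps * (q * l)) (q * l) (eps * l) => u v w; lra.
Qed.

Lemma prob_lower eta M P delta : 0 <= eta <= 1 -> (1 - eta) ^+ 2 <= M * P -> 0 <= P <= 1 ->
  M <= 1 + delta -> 0 <= delta -> 1 - 2 * eta - delta <= P.
Proof.
move=> /andP[e0 e1] h /andP[P0 P1] hM d0.
have : M * P <= (1 + delta) * P by rewrite ler_wpM2r.
have : delta * P <= delta by rewrite ler_piMr.
have : 0 <= eta ^+ 2 := sqr_ge0 eta.
by move: h; rewrite expr2; nra.
Qed.

Lemma box_counts (s n tau : nat) : (0 < s < n)%N -> (4 * s <= n)%N -> (tau <= s)%N ->
  [/\ (3 * n <= 4 * (n - s))%N, (0 < n - s + tau)%N, (s <= n)%N & (tau <= 2 * n)%N].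
Proof. by move=> /andP[s0 sn] s4 ts; split; lia. Qed.

(** The slack [tau] between the side [s] and the required saving
    [(2 - eps) l / q] is left for the concentration inequality. *)
Lemma empty_box_summary n q l L eps : 0 < eps < 1 -> 0 < q <= eps / 100 -> 1 <= l ->
  11 <= L -> n%:R = expR L -> L ^+ 2 <= q * n%:R -> q * n%:R = expR l ->
  432 * l ^+ 2 <= expR l -> 48 * l ^+ 2 <= expR (eps / 8 * l) ->
  exists (s tau : nat) (rho eta P : R),
  [/\ [/\ (0 < n - s + tau)%N, (tau <= 2 * n)%N,
       (n - s + tau)%:R < n%:R - (2 - eps) * l / q & eps / 4 * l / q - 1 <= tau%:R],
   0 <= q * rho <= 8 * l ^+ 2 / expR l, 0 <= P <= 1,
     P <= Pr q (fun H : graph n => coverable H (n - s)) &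
   0 <= eta <= expR (- L) /\
   (1 - eta) ^+ 2 <= (expR (18 * q * rho ^+ 2) + 2 * expR (- (2 * q)^-1)) * P].
Proof.
move=> eps01 q0e l1 L11 nE LD DE H1 H2.
have /andP[ep0 ep1] := eps01; have /andP[q0 qe] := q0e.
have qs : q <= 1 / 100 by clear - qe ep1; lra.
have q02 : 0 < q <= 1 / 2 by rewrite q0; clear - qs; lra.
have q01 : 0 <= q <= 1 by rewrite (ltW q0); clear - qs; lra.
have [s [r [sn r0 srn s4 [sl qr x0s]]]] := box_parameters eps01 q0e l1 H1 DE.
set rho := s%:R / r%:R in qr.
have rho0 : 0 <= rho by rewrite divr_ge0.
have MB := second_moment_factor_le q0 rho0 eps01 l1 H1 H2 qr x0s.
pose tau := Num.truncn (eps / 4 * l / q).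
have l0 : 0 < l by apply: lt_le_trans l1.
have x0 : 0 <= eps / 4 * l / q by rewrite !mulr_ge0 ?invr_ge0 ?(ltW q0) ?(ltW l0) ?(ltW ep0).
have tau1 : tau%:R <= eps / 4 * l / q by rewrite truncn_le.
have tau2 : eps / 4 * l / q - 1 <= tau%:R.
  by rewrite lerBlDr natr1; apply/ltW/truncnS_gt.
move: (tau) tau1 tau2 => {}tau tau1 tau2.
have taus : (tau <= s)%N.
  rewrite -(ler_nat R); apply: (le_trans tau1); apply: le_trans (ltW sl).
  by rewrite ler_pM2r ?invr_gt0// ler_pM2r//; clear - ep1; lra.
have [mn d0 s_n tn] := box_counts sn s4 taus.
have [E1 _] := matching_error L11 nE LD q0 (leq_subr s n) mn.
pose eta := (n - s)%:R ^+ 3 * expR (- (q * (n - s)%:R / 2)).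
have eta0 : 0 <= eta by rewrite mulr_ge0 ?exprn_ge0 ?expR_ge0.
have eta1 : eta <= 1.
  by apply: (le_trans E1); rewrite -[leRHS]expR0 ler_expR; clear - L11; lra.
have EB := empty_box_prob srn r0 sn q02 (erefl rho) (erefl eta) eta1.
exists s, tau, rho, eta, (Pr q (fun H : graph n => exists p : {ffun 'I_s -> 'I_r} * {ffun 'I_s -> 'I_r},
    box_empty srn H p /\ matchable H (~: block_transversal srn p.1) (~: block_transversal srn p.2))).
split => //.
- split => //; rewrite natrD natrB//.
  have : (2 - eps) * l / q + eps / 4 * l / q < (2 - eps / 2) * l / q.
    by rewrite -mulrDl -mulrDl ltr_pM2r ?invr_gt0// ltr_pM2r//; clear - ep0; lra.
  by clear - tau1 sl; move: (_ / q) (_ / q) (_ / q) tau1 sl => u v w; lra.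
- by rewrite qr mulr_ge0// ltW.
- by rewrite Pr_ge0// Pr_le1.
- by apply: le_Pr => // H [p [be ma]]; exact: (empty_box_cover be ma).
split; first by rewrite eta0.
by apply: (le_trans EB); rewrite ler_wpM2r ?Pr_ge0.
Qed.

Lemma exponent_bound q rho l : 0 < q -> 0 <= q * rho <= 8 * l ^+ 2 / expR l ->
  18 * q * rho ^+ 2 <= 1152 * l ^+ 4 / (expR l ^+ 2 * q).
Proof.
move=> q0 /andP[qrho0 qr].
have -> : 18 * q * rho ^+ 2 = 18 * (q * rho) ^+ 2 / q by field; rewrite gt_eqF.
apply: (@le_trans _ _ (18 * (8 * l ^+ 2 / expR l) ^+ 2 / q)).
  rewrite ler_pM2r ?invr_gt0// ler_pM2l// lerXn2r ?nnegrE//.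
  by rewrite divr_ge0 ?expR_ge0// mulr_ge0// sqr_ge0.
by rewrite le_eqVlt; apply/orP; left; apply/eqP; field; rewrite !gt_eqF ?expR_gt0.
Qed.

(** If [q] is not too small the second moment alone suffices. *)
Lemma empty_box_high q l L rho eta P : 0 < q -> q = expR (l - L) -> 1 <= l -> l <= L -> 11 <= L ->
  expR (- (3 / 5 * L)) <= q ->
  expR (- (2 * q)^-1) <= expR (- (1 / 10 * L)) ->
  1152 * L ^+ 4 <= expR (1 / 10 * L) -> 0 <= q * rho <= 8 * l ^+ 2 / expR l ->
  0 <= P <= 1 -> 0 <= eta <= expR (- L) ->
  (1 - eta) ^+ 2 <= (expR (18 * q * rho ^+ 2) + 2 * expR (- (2 * q)^-1)) * P ->
  1 - P <= 6 * expR (- (1 / 10 * L)).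
Proof.
move=> q0 qE l1 lL L11 qA e2q HL qr P01 /andP[eta0 E1] EB.
set v := expR (- (1 / 10 * L)) in e2q *.
have v0 : 0 <= v by exact: expR_ge0.
have v1 : v <= 1 / 2.
  have h : 2 <= expR (1 / 10 * L) by apply: le_trans (expR_ge1Dx _); clear - L11; lra.
  rewrite /v expRN -[leRHS]invrK lef_pV2 ?posrE ?expR_gt0 ?invr_gt0//.
  by rewrite div1r invrK.
have E10 : expR (- L) <= v by rewrite ler_expR; clear - L11; lra.
have u1 : 18 * q * rho ^+ 2 <= v.
  apply: (le_trans (exponent_bound q0 qr)); rewrite ler_pdivrMr ?mulr_gt0 ?exprn_gt0 ?expR_gt0//.
  apply: (@le_trans _ _ (expR (1 / 10 * L))).
    apply: (le_trans _ HL); apply: ler_wpM2l; first exact: ler0n.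
    by rewrite lerXn2r ?nnegrE//; clear - l1 lL; lra.
  rewrite {1}qE /v -expRM_natl -!expRD ler_expR.
  have : - (3 / 5 * L) <= l - L by rewrite -ler_expR -qE.
  by clear; lra.
have M1 : expR (18 * q * rho ^+ 2) + 2 * expR (- (2 * q)^-1) <= 1 + 4 * v.
  have : expR (18 * q * rho ^+ 2) <= 1 + 2 * v.
    by apply: (@le_trans _ _ (expR v)); [rewrite ler_expR|apply: expR_le1D2; rewrite v0].
  by clear - e2q; move: (expR _) (expR _) e2q => x y; lra.
have eta01 : 0 <= eta <= 1 by rewrite eta0; clear - v1 E1 E10; lra.
have d0 : 0 <= 4 * v by rewrite mulr_ge0.
have := prob_lower eta01 EB P01 M1 d0.
by clear - E1 E10; lra.
Qed.

(** Otherwise [P] is only known to be at least a constant times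
    [expR (- (18 q rho ^ 2))], but the exponent [tau ^ 2 / (8 n)] in the
    concentration inequality exceeds [18 q rho ^ 2] by at least [L]. *)
Lemma empty_box_low q l L rho eta P Q tau (n : nat) eps : 0 < eps < 1 -> 0 < q <= eps / 100 ->
  q = expR (l - L) -> n%:R = expR L -> 1 <= l -> 11 <= L -> q < expR (- (3 / 5 * L)) ->
  1152 * 1024 / eps ^+ 2 * l ^+ 2 <= expR l ->
  1024 / eps ^+ 2 * L <= expR (1 / 5 * L) ->
  0 <= q * rho <= 8 * l ^+ 2 / expR l ->
  0 <= P <= 1 -> 0 <= eta <= expR (- L) ->
  (1 - eta) ^+ 2 <= (expR (18 * q * rho ^+ 2) + 2 * expR (- (2 * q)^-1)) * P ->
  eps / 4 * l / q - 1 <= tau -> 0 <= Q -> Q * P <= expR (- (tau ^+ 2 / (8 * n%:R))) ->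
  Q <= 12 * expR (- L).
Proof.
move=> /andP[ep0 ep1] /andP[q0 qe] qE nE l1 L11 qB HC HL qr /andP[P0 P1] /andP[eta0 E1] EB ht Q0 QP.
have l0 : 0 < l by apply: lt_le_trans l1.
have qrho0 : 0 <= q * rho by case/andP: qr.
set u := 18 * q * rho ^+ 2 in EB.
have u0 : 0 <= u.
  by rewrite /u mulr_ge0 ?sqr_ge0// mulr_ge0// ltW.
have Plow : expR (- u) <= 12 * P.
  have h1 : 1 / 4 <= (1 - eta) ^+ 2.
    have : eta <= 1 / 2.
      apply: (le_trans E1); rewrite expRN -[leRHS]invrK lef_pV2 ?posrE ?expR_gt0 ?invr_gt0//.
      by rewrite div1r invrK; apply: le_trans (expR_ge1Dx _); clear - L11; lra.
    by clear; move=> h; rewrite expr2; nra.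
  have h2 : expR u + 2 * expR (- (2 * q)^-1) <= 3 * expR u.
    have : 1 <= expR u by rewrite -[leLHS]expR0 ler_expR.
    have : expR (- (2 * q)^-1) <= 1.
      by rewrite -[leRHS]expR0 ler_expR oppr_le0 invr_ge0 mulr_ge0// ltW.
    by clear; move: (expR _) (expR _) => x y; lra.
  rewrite expRN -[leLHS]mul1r ler_pdivrMr ?expR_gt0//.
  have := ler_wpM2r P0 h2; move: h1 EB; clear.
  have -> : 12 * P * expR u = 12 * (expR u * P) by rewrite -mulrA [P * _]mulrC.
  rewrite -[3 * _ * P]mulrA.
  by move: (_ ^+ 2) (expR u * P) (_ * P) => x y z; lra.
have tau0 : eps / 8 * l / q <= tau.
  apply: le_trans ht.
  have : 1 <= eps / 8 * l / q.
    rewrite ler_pdivlMr// mul1r.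
    by apply: (@le_trans _ _ (eps / 8)); [clear - qe ep0; lra|rewrite ler_peMr//; clear - ep0; lra].
  have -> : eps / 4 * l / q = 2 * (eps / 8 * l / q) by field; rewrite gt_eqF.
  by clear; lra.
pose V := l ^+ 2 / (q ^+ 2 * n%:R).
have nR : 0 < n%:R :> R by rewrite nE expR_gt0.
have V0 : 0 <= V by rewrite divr_ge0 ?sqr_ge0// mulr_ge0 ?sqr_ge0// ltW.
have tV : eps ^+ 2 / 512 * V <= tau ^+ 2 / (8 * n%:R).
  have -> : eps ^+ 2 / 512 * V = (eps / 8 * l / q) ^+ 2 / (8 * n%:R).
    by rewrite /V; field; rewrite !gt_eqF.
  rewrite ler_pM2r ?invr_gt0 ?mulr_gt0//.
  have x0 : 0 <= eps / 8 * l / q by rewrite !mulr_ge0 ?invr_ge0 ?(ltW q0) ?(ltW l0) ?(ltW ep0).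
  by rewrite lerXn2r ?nnegrE// (le_trans x0).
have uV : u <= eps ^+ 2 / 1024 * V.
  apply: (le_trans (exponent_bound q0 qr)).
  have -> : 1152 * l ^+ 4 / (expR l ^+ 2 * q) = V * (1152 * l ^+ 2 / expR l).
    have -> : expR l = q * n%:R by rewrite qE nE -expRD subrK.
    by rewrite /V; field; rewrite !gt_eqF.
  rewrite [leRHS]mulrC; apply: ler_wpM2l => //; rewrite ler_pdivrMr ?expR_gt0//.
  have c0 : 0 < eps ^+ 2 / 1024 by apply: divr_gt0; [rewrite exprn_gt0|exact: ltr0Sn].
  rewrite -(ler_pdivrMl _ _ c0) invf_div; apply: (le_trans _ HC).
  by rewrite le_eqVlt; apply/orP; left; apply/eqP; field; rewrite gt_eqF.
have VL : expR (1 / 5 * L) <= V.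
  rewrite /V ler_pdivlMr ?mulr_gt0 ?exprn_gt0//.
  apply: (@le_trans _ _ 1); last by rewrite expr_ge1// ltW.
  rewrite {1}qE nE -expRM_natl -!expRD -[leRHS]expR0 ler_expR.
  have : l - L < - (3 / 5 * L) by rewrite -ltr_expR -qE.
  by clear; lra.
have : L <= eps ^+ 2 / 1024 * V.
  have c0 : 0 < eps ^+ 2 / 1024 by apply: divr_gt0; [rewrite exprn_gt0|exact: ltr0Sn].
  by rewrite -(ler_pdivrMl _ _ c0) invf_div; apply: (le_trans HL).
move=> LV; have : expR (- (tau ^+ 2 / (8 * n%:R))) <= expR (- u) * expR (- L).
  rewrite -expRD ler_expR; move: tV uV LV; clear.
  have -> : eps ^+ 2 / 512 * V = 2 * (eps ^+ 2 / 1024 * V) by field.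
  by move: (_ / _ * V) (_ / (8 * _)) => x y; lra.
move=> hE; have : Q * expR (- u) <= 12 * (expR (- u) * expR (- L)).
  apply: (@le_trans _ _ (Q * (12 * P))); first by rewrite ler_wpM2l.
  by rewrite mulrCA ler_pM2l// (le_trans QP).
by rewrite mulrC mulrCA ler_pM2l ?expR_gt0.
Qed.

Lemma small_q_cover eps e : 0 < eps < 1 -> 0 < e -> exists L0, forall n q,
  L0 <= ln n%:R -> ln n%:R ^+ 2 <= q * n%:R -> q <= expR (- (ln n%:R / 2)) * ln n%:R ->
  exists d : nat, [/\ (0 < d)%N, d%:R < n%:R - (2 - eps) * ln (q * n%:R) / q &
    Pr q (fun H : graph n => ~ coverable H d) <= e].
Proof.
move=> eps01 e0; have /andP[ep0 ep1] := eps01.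
pose C1 := Num.max 432 (1152 * 1024 / eps ^+ 2).
have [l1 Hl1] := @poly_le_exp R 2 C1 1 ltr01.
have [l2 Hl2] := @poly_le_exp R 2 48 (eps / 8) (divr_gt0 ep0 (ltr0Sn _ _)).
have [L3 HL3] := @poly_le_exp R 1 1 (1 / 4) (divr_gt0 ltr01 (ltr0Sn _ _)).
have [L4 HL4] := @poly_le_exp R 0 (100 / eps) (1 / 4) (divr_gt0 ltr01 (ltr0Sn _ _)).
have [L5 HL5] := @poly_le_exp R 4 1152 (1 / 10) (divr_gt0 ltr01 (ltr0Sn _ _)).
have [L6 HL6] := @poly_le_exp R 0 (12 / e) (1 / 10) (divr_gt0 ltr01 (ltr0Sn _ _)).
have [L7 HL7] := @poly_le_exp R 1 (1024 / eps ^+ 2) (1 / 5) (divr_gt0 ltr01 (ltr0Sn _ _)).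
pose l0 := Num.max l1 (Num.max l2 1).
exists (Num.max (expR l0) (Num.max L3 (Num.max L4 (Num.max L5 (Num.max L6 (Num.max L7 11)))))) => n q.
rewrite !ge_max => /and5P[Ll0 /HL3{HL3}HL3 /HL4{HL4}HL4 /HL5{HL5}HL5 /and3P[/HL6{HL6}HL6 /HL7{HL7}HL7 L11]] LD qs.
have L1 : 1 <= ln n%:R :> R by clear - L11; move: (ln _) L11 => L; lra.
have qq : q <= expR (- (1 / 4 * ln n%:R)).
  apply: (le_trans qs).
  have -> : expR (- (1 / 4 * ln n%:R)) = expR (- (ln n%:R / 2)) * expR (1 / 4 * ln n%:R) :> R.
    by rewrite -expRD; congr expR; field.
  by rewrite ler_wpM2l ?expR_ge0//; move: HL3; rewrite expr1 mul1r.
have qe : q <= eps / 100.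
  apply: (le_trans qq); rewrite expRN -[leRHS]invrK lef_pV2 ?posrE ?expR_gt0 ?invr_gt0 ?divr_gt0//.
  by move: HL4; rewrite expr0 mulr1 invf_div.
have q1 : q <= 1 by clear - qe ep1; lra.
have [n0 nE q0 DE qE] := log_scale L1 LD q1.
have lL := ln_scale_le L1 LD q1.
have ll0 := ln_scale_ge L1 LD q1 Ll0.
move: LD nE DE qE lL ll0 L11 qs qq HL3 HL4 HL5 HL6 HL7; set L := ln n%:R; set l := ln (q * n%:R).
move=> LD nE DE qE lL ll0 L11 qs qq HL3 HL4 HL5 HL6 HL7.
move: ll0; rewrite /l0 !ge_max => /and3P[/Hl1 H1 /Hl2 H2 l_1]; rewrite mul1r in H1.
have H432 : 432 * l ^+ 2 <= expR l by apply: (le_trans _ H1); rewrite ler_wpM2r ?sqr_ge0// le_max lexx.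
have q0e : 0 < q <= eps / 100 by rewrite q0.
have [s [tau [rho [eta [P [[d0 tn db ht] qr P01 Pcov [eta01 EB]]]]]]] :=
  empty_box_summary eps01 q0e l_1 L11 nE LD DE H432 H2.
exists (n - s + tau)%N; split => //.
have q01 : 0 <= q <= 1 by rewrite q1 ltW.
set Q := Pr q _.
have Q0 : 0 <= Q by rewrite Pr_ge0.
have eL : 12 * expR (- (1 / 10 * L)) <= e.
  rewrite expRN ler_pdivrMr ?expR_gt0// -ler_pdivrMl//.
  by move: HL6; rewrite expr0 mulr1 mulrC.
have e2q : expR (- (2 * q)^-1) <= expR (- (1 / 10 * L)).
  rewrite ler_expR lerN2.
  have : L <= q^-1.
    move: HL3; rewrite expr1 mul1r => /le_trans; apply.
    by rewrite -[leLHS]invrK lef_pV2 ?posrE ?invr_gt0 ?expR_gt0// -expRN.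
  by rewrite invfM; clear - L11; move: (q^-1) => v; lra.
have [qA|qB] := lerP (expR (- (3 / 5 * L))) q.
  have := empty_box_high q0 qE l_1 lL L11 qA e2q HL5 qr P01 eta01 EB.
  have : Q <= 1 - P.
    rewrite /Q PrC lerB//; apply: (le_trans Pcov); apply: le_Pr => // H.
    by apply: coverableW; rewrite leq_addr.
  have := expR_ge0 (- (1 / 10 * L)).
  by clear - eL; move: (expR _) eL => v; lra.
have QP : Q * P <= expR (- (tau%:R ^+ 2 / (8 * n%:R))).
  apply: le_trans (cover_number_concentration (n - s) q01 n0 tn).
  by rewrite ler_wpM2l.
have {}H1 : 1152 * 1024 / eps ^+ 2 * l ^+ 2 <= expR l.
  by apply: (le_trans _ H1); rewrite ler_wpM2r ?sqr_ge0// le_max lexx orbT.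
rewrite expr1 in HL7.
have := empty_box_low eps01 q0e qE nE l_1 L11 qB H1 HL7 qr P01 eta01 EB ht Q0 QP.
have : expR (- L) <= expR (- (1 / 10 * L)) by rewrite ler_expR; clear - L11; lra.
by clear - eL; move: (expR _) (expR _) eL => u v; lra.
Qed.

End SmallQ.


(** * Intermediate [q]: single entries *)

Section MidQ.
Variable R : realType.
Implicit Types (q e L l x y : R).

(** The two matchings together fail with probability at most [2 / n] if the
    bound on the holes of the tuple matching is at most [1 / n ^ 2]. *)
Lemma spread_cover (n t' N K : nat) (c : 'I_N -> 'I_K -> 'I_t'.+1) q L :
  0 < q <= 1 -> 11 <= L -> n%:R = expR L -> L ^+ 2 <= q * n%:R ->
  (0 < K)%N -> difference_family c -> (4 * t'.+1 <= n)%N -> (t'.+1 * N <= n - t'.+1)%N ->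
  (forall i, (0 < i <= t'.+1 * N)%N -> let w := minn (i * (K * K * N)) (t'.+1 * N) in
     ((t'.+1 * N) ^ i * 'C(n - t'.+1, w))%:R * (1 - q ^+ K) ^+ (i * (n - t'.+1 - w)) <= expR (- (2 * L))) ->
  Pr q (fun H : graph n => ~ coverable H (n - t'.+1)) <=
    2 * expR (- L) + t'.+1%:R ^+ 2 * (q * euler_prod q K ^+ N).
Proof.
move=> /andP[q0 q1] L11 nE LD K0 cd tn tN hz.
have q01 : 0 <= q <= 1 by rewrite (ltW q0).
have n0 : (0 < n)%N by rewrite -(ltr0n R) nE expR_gt0.
have tlt : (t'.+1 < n)%N by lia.
have mn : (3 * n <= 4 * (n - t'.+1))%N by lia.
have [E1 E2] := matching_error L11 nE LD q0 (leq_subr t'.+1 n) mn.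
apply: le_trans (tuple_cover_prob (ltnW tlt) q01 cd K0 tlt tN E2 hz) _.
rewrite prodrXl -/(euler_prod q K) lerD2r.
have -> : 2 * expR (- L) = expR (- L) + expR L * expR (- (2 * L)).
  by rewrite -expRD (_ : L + - (2 * L) = - L); ring.
rewrite lerD// ler_wpM2r ?expR_ge0// -nE ler_nat.
by apply: (leq_trans tN); rewrite leq_subr.
Qed.

(** The integer exceeds [t0] strictly, because the bound on the dimension is strict. *)
Lemma corner_size (n : nat) (t0 : R) : 1 <= t0 -> 8 * t0 <= n%:R ->
  exists t' : nat, [/\ t0 < t'.+1%:R, t'.+1%:R <= 2 * t0, (4 * t'.+1 <= n)%N &
    n%:R / t0 - n%:R / t0 ^+ 2 <= n%:R / t'.+1%:R].
Proof.
move=> t1 tn; have t00 : 0 < t0 by apply: lt_le_trans t1.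
exists (Num.truncn t0); have h1 : t0 < (Num.truncn t0).+1%:R by exact: truncnS_gt.
have h2 : (Num.truncn t0).+1%:R <= t0 + 1 by rewrite -natr1 lerD2r truncn_le ltW.
split=> //; first by apply: (le_trans h2); clear - t1; lra.
  rewrite -(ler_nat R) natrM; apply: le_trans tn.
  by clear - h2 t1; move: (_%:R) h2 => x; lra.
apply: (@le_trans _ _ (n%:R / (t0 + 1))); last first.
  by rewrite ler_wpM2l// lef_pV2 ?posrE ?ltr0n//; clear - t00; lra.
have -> : n%:R / t0 - n%:R / t0 ^+ 2 = n%:R * ((t0 - 1) / t0 ^+ 2) by field; rewrite gt_eqF.
rewrite ler_wpM2l// ler_pdivrMr ?exprn_gt0// -[_^-1]div1r mulrAC mul1r ler_pdivlMr; last by clear - t00; lra.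
by clear; nra.
Qed.

(** The exponent of the bound on the holes of the tuple matching, with [j] tuples
    and [w] vertices outside the hole. As long as [w] is small compared to [m],
    the binomial coefficient is bounded by [binom_exp] at [y = expR (- l)]. *)
Lemma mid_exponent_few (j N m w n : R) q l L : 0 < q <= 1 -> 0 <= l -> 3 * l <= 2 * L -> 25 <= L ->
  1 <= j -> 0 <= w -> w <= j * N -> q * N <= 8 / 5 * l -> 99 * n <= 100 * m -> m <= n ->
  L ^+ 2 <= q * n * q -> 8 * w <= m -> q * n = expR l ->
  j * L + (expR (- l) * m + l * w) + - (q * (j * (m - w))) <= - (2 * L).
Proof.
move=> /andP[q0 q1] l0 lL L25 j1 w0 wj qN nm mn Dq w8 DE.
have qi : 1 <= q^-1 by rewrite invf_ge1.
have h1 : expR (- l) * m <= j * q^-1.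
  apply: (@le_trans _ _ q^-1); last by rewrite ler_peMl//; clear - qi; lra.
  rewrite expRN -DE invfM -mulrA ler_piMr ?invr_ge0 ?(ltW q0)//.
  have n0 : 0 < n by rewrite -(pmulr_rgt0 _ q0) DE expR_gt0.
  by rewrite mulrC ler_pdivrMr// mul1r.
have h2 : l * w <= j * (8 / 5 * l ^+ 2 * q^-1).
  apply: (@le_trans _ _ (l * (j * N))); first by rewrite ler_wpM2l.
  rewrite mulrCA ler_wpM2l//; first by clear - j1; lra.
  rewrite ler_pdivlMr//.
  have -> : l * N * q = l * (q * N) by ring.
  have -> : 8 / 5 * l ^+ 2 = l * (8 / 5 * l) by field.
  by rewrite ler_wpM2l.
have h3 : j * (433 / 500 * L ^+ 2 * q^-1) <= q * (j * (m - w)).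
  rewrite [leRHS]mulrCA ler_wpM2l//; first by clear - j1; lra.
  rewrite ler_pdivrMr//.
  have : 433 / 500 * (q * n * q) <= q * (m - w) * q.
    have -> : 433 / 500 * (q * n * q) = q * (433 / 500 * n) * q by ring.
    rewrite ler_pM2r// ler_pM2l//; clear - nm w8 w0 mn; lra.
  by clear - Dq; move: (q * n * q) (_ * q) Dq => u v; lra.
have l2 : l ^+ 2 <= 4 / 9 * L ^+ 2.
  have -> : 4 / 9 * L ^+ 2 = (2 / 3 * L) ^+ 2 by field.
  by rewrite lerXn2r ?nnegrE//; clear - l0 lL; lra.
have h4 : j * (q^-1 + 8 / 5 * l ^+ 2 * q^-1 - 433 / 500 * L ^+ 2 * q^-1) <= j * (1 - 3 / 20 * L ^+ 2).
  rewrite ler_wpM2l//; first by clear - j1; lra.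
  have -> : q^-1 + 8 / 5 * l ^+ 2 * q^-1 - 433 / 500 * L ^+ 2 * q^-1 =
    q^-1 * (1 + 8 / 5 * l ^+ 2 - 433 / 500 * L ^+ 2) by ring.
  have : 1 + 8 / 5 * l ^+ 2 - 433 / 500 * L ^+ 2 <= 1 - 3 / 20 * L ^+ 2.
    by move: (sqr_ge0 L) l2; clear; move: (l ^+ 2) (L ^+ 2) => u v; lra.
  have : 1 - 3 / 20 * L ^+ 2 <= 0 by clear - L25; rewrite expr2; nra.
  by clear - qi; move: (1 + _ - _) (1 - _) (q^-1) qi => u v x; nra.
have h5 : j * (L + (1 - 3 / 20 * L ^+ 2)) <= j * (- (2 * L)).
  rewrite ler_wpM2l//; first by clear - j1; lra.
  by clear - L25; rewrite expr2; nra.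
have h6 : j * (- (2 * L)) <= - (2 * L) by clear - j1 L25; nra.
move: h1 h2 h3 h4 h5 h6; rewrite !mulrDr !mulrN; clear.
by move: (expR _ * m) (l * w) => u v; lra.
Qed.

(** The remaining [w] force [j] to be so large that the bound [expR m] on the
    binomial coefficient is good enough. *)
Lemma mid_exponent_many (j N m w n : R) q l L : 0 < q <= 1 -> 0 <= l -> 3 * l <= 2 * L -> 70 <= L ->
  1 <= j -> w <= j * N -> q * N <= 8 / 5 * l -> 99 * n <= 100 * m ->
  L ^+ 2 <= q * n * q -> 5 * w <= 4 * m -> m <= 8 * w ->
  j * L + m + - (q * (j * (m - w))) <= - (2 * L).
Proof.
move=> /andP[q0 q1] l0 lL L70 j1 wj qN nm Dq w5 w8.
have qi : 1 <= q^-1 by rewrite invf_ge1.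
have h1 : m <= j * (9 * L * q^-1).
  apply: (le_trans w8); apply: (@le_trans _ _ (8 * (j * N))); first by rewrite ler_pM2l.
  rewrite mulrCA ler_wpM2l//; first by clear - j1; lra.
  by rewrite ler_pdivlMr// -mulrA [N * q]mulrC; clear - qN lL l0; lra.
have h3 : j * (99 / 500 * L ^+ 2 * q^-1) <= q * (j * (m - w)).
  rewrite [leRHS]mulrCA ler_wpM2l//; first by clear - j1; lra.
  rewrite ler_pdivrMr//.
  have : 99 / 500 * (q * n * q) <= q * (m - w) * q.
    have -> : 99 / 500 * (q * n * q) = q * (99 / 500 * n) * q by ring.
    rewrite ler_pM2r// ler_pM2l//; clear - nm w5; lra.
  by clear - Dq; move: (q * n * q) (_ * q) Dq => u v; lra.
have h4 : j * (9 * L * q^-1 - 99 / 500 * L ^+ 2 * q^-1) <= j * (9 * L - 99 / 500 * L ^+ 2).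
  rewrite ler_wpM2l//; first by clear - j1; lra.
  have -> : 9 * L * q^-1 - 99 / 500 * L ^+ 2 * q^-1 =
    q^-1 * (9 * L - 99 / 500 * L ^+ 2) by ring.
  have : 9 * L - 99 / 500 * L ^+ 2 <= 0 by clear - L70; rewrite expr2; nra.
  by clear - qi; move: (9 * L - _) (q^-1) qi => u x; nra.
have h5 : j * (L + (9 * L - 99 / 500 * L ^+ 2)) <= j * (- (2 * L)).
  rewrite ler_wpM2l//; first by clear - j1; lra.
  by clear - L70; rewrite expr2; nra.
have h6 : j * (- (2 * L)) <= - (2 * L) by clear - j1 L70; nra.
move: h1 h3 h4 h5 h6; rewrite !mulrDr !mulrN; clear.
by lra.
Qed.

(** A fifth of the vertices is not used by the tuples, which leaves room in Hall's
    condition; the factor [4 / 5] is allowed since [q n / t] is close to [2 * l],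
    whereas [ln (t ^ 2 * q)] is at most [3 / 2 * l]. *)
Lemma repetitions (n t : nat) : (0 < t)%N -> (t <= n)%N ->
  let N := (4 * (n - t) %/ (5 * t))%N in
  (5 * (t * N) <= 4 * (n - t))%N /\ (4 * n < 5 * (t * N) + 9 * t)%N.
Proof.
move=> t0 tn; rewrite /=; set N := (_ %/ _)%N.
have h1 : (N * (5 * t) <= 4 * (n - t))%N by exact: leq_trunc_div.
have h2 : (4 * (n - t) < N.+1 * (5 * t))%N by rewrite ltn_ceil// muln_gt0 t0.
by split; nia.
Qed.

Lemma mid_repetitions (n t N t0 : R) q l : 0 < q <= 1 -> 0 < t0 -> t0 < t -> 0 < n -> 0 <= N ->
  5 * (t * N) <= 4 * n -> 4 * n < 5 * (t * N) + 9 * t ->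
  n / t0 - n / t0 ^+ 2 <= n / t -> q * (n / t0) = 2 * l -> q * (n / t0 ^+ 2) <= 1 ->
  8 / 5 * l - 3 <= q * N <= 8 / 5 * l.
Proof.
move=> /andP[q0 q1] t00 tt0 n0 N0 h1 h2 h3 h4 h5.
have t_0 : 0 < t by apply: lt_trans tt0.
have hn : n / t <= n / t0 by rewrite ler_wpM2l ?ltW// ltf_pV2 ?posrE.
apply/andP; split; last first.
  have : N <= 4 / 5 * (n / t) by rewrite mulrA ler_pdivlMr//; clear - h1; lra.
  have : q * (n / t) <= 2 * l by rewrite -h4 ler_wpM2l// ltW.
  clear - q0; move: (n / t) => x hx hN; have := ler_wpM2l (ltW q0) hN.
  by rewrite mulrCA; move: (q * N) (q * x) hx => u v; lra.
have h6 : 4 / 5 * (n / t) - 9 / 5 <= N.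
  rewrite lerBlDr mulrA ler_pdivrMr//; clear - h2; lra.
have := ler_wpM2l (ltW q0) h6; have := ler_wpM2l (ltW q0) h3.
rewrite !mulrBr h4; clear - q1 h5; lra.
Qed.

Lemma mid_q_cover e : 0 < e -> exists L0, forall n q,
  L0 <= ln n%:R -> expR (- (ln n%:R / 2)) * ln n%:R <= q -> q <= expR (- (ln n%:R / 3)) ->
  exists d : nat, [/\ (0 < d)%N, d%:R < n%:R - q * n%:R / (2 * ln (q * n%:R)) &
    Pr q (fun H : graph n => ~ coverable H d) <= e].
Proof.
move=> e0.
have [L1 HL1] := @poly_le_exp R 2 4 (1 / 2) (divr_gt0 ltr01 (ltr0Sn _ _)).
have [L2 HL2] := @poly_le_exp R 0 (2 / e * 2) 1 ltr01.
have [L3 HL3] := @poly_le_exp R 0 (2 / e * expR 3) (1 / 15) (divr_gt0 ltr01 (ltr0Sn _ _)).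
exists (Num.max L1 (Num.max L2 (Num.max L3 300))) => n q.
rewrite !ge_max => /and4P[/HL1{HL1}HL1 /HL2{HL2}HL2 /HL3{HL3}HL3 L300] qlo qhi.
have LL1 : 1 <= ln n%:R :> R by clear - L300; move: (ln _) L300 => L; lra.
have n0 : 0 < n%:R :> R.
  by rewrite ltr0n; case: n LL1 {HL1 HL2 HL3 L300 qlo qhi} => //; rewrite ln0// ler10.
have nE : n%:R = expR (ln n%:R) :> R by rewrite lnK.
have q1 : q <= 1.
  apply: (le_trans qhi); rewrite -[leRHS]expR0 ler_expR oppr_le0 divr_ge0//.
  by apply: le_trans LL1.
have LqD : ln n%:R ^+ 2 <= q * n%:R * q.
  apply: (@le_trans _ _ ((expR (- (ln n%:R / 2)) * ln n%:R) ^+ 2 * n%:R)).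
    rewrite exprMn -expRM_natl {4}nE mulrAC -expRD.
    by rewrite (_ : _ + _ = 0) ?expR0 ?mul1r//; field.
  rewrite [leRHS]mulrAC -expr2 ler_pM2r// lerXn2r ?nnegrE//.
    by rewrite mulr_ge0 ?expR_ge0//; apply: le_trans LL1.
  by apply: le_trans qlo; rewrite mulr_ge0 ?expR_ge0//; apply: le_trans LL1.
have LD : ln n%:R ^+ 2 <= q * n%:R.
  apply: (le_trans LqD); rewrite ler_piMr// mulr_ge0 ?ltW//.
  by apply: lt_le_trans qlo; rewrite mulr_gt0 ?expR_gt0//; apply: lt_le_trans LL1.
have [n_0 _ q0 DE qE] := log_scale LL1 LD q1.
move: nE LqD LD DE qE qlo qhi L300 HL1 HL2 HL3; set L := ln n%:R; set l := ln (q * n%:R).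
move=> nE LqD LD DE qE qlo qhi L300 HL1 HL2 HL3.
have q01 : 0 < q <= 1 by rewrite q0.
have lup : 3 * l <= 2 * L.
  have : l - L <= - (L / 3) by rewrite -ler_expR -qE.
  by clear; lra.
have llo : L / 2 <= l.
  have : expR (- (L / 2)) <= q.
    by apply: le_trans qlo; rewrite ler_peMr ?expR_ge0.
  by rewrite qE ler_expR; clear; lra.
have l1 : 1 <= l by clear - llo L300; lra.
have l0 : 0 < l by clear - l1; lra.
have l2D : 4 * l ^+ 2 <= expR l.
  apply: (@le_trans _ _ (4 * L ^+ 2)).
    by rewrite ler_pM2l// lerXn2r ?nnegrE//; clear - lup l0 L300; lra.
  apply: (le_trans HL1); rewrite ler_expR; clear - llo; lra.
have qs : q <= 1 / 100.
  apply: (le_trans qhi); rewrite expRN -[leRHS]invrK lef_pV2 ?posrE ?expR_gt0 ?invr_gt0 ?divr_gt0//.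
  rewrite div1r invrK; apply: le_trans (expR_ge1Dx _); clear - L300; lra.
have [t0 t0E] : exists t0, t0 = q * n%:R / (2 * l) by eexists.
have t00 : 0 < t0 by rewrite t0E divr_gt0 ?mulr_gt0.
have t01 : 1 <= t0.
  rewrite t0E ler_pdivlMr ?mulr_gt0// mul1r DE; apply: (le_trans _ l2D).
  by clear - l1; rewrite expr2; nra.
have t0n : 200 * t0 <= n%:R.
  rewrite t0E mulrA ler_pdivrMr ?mulr_gt0//.
  have : q * n%:R <= 1 / 100 * n%:R by rewrite ler_pM2r.
  clear - l1 n0; move: n0; move: (q * _) => x; move: (n%:R) => N hN hx; nra.
have t0n8 : 8 * t0 <= n%:R by apply: le_trans t0n; rewrite ler_pM2r//; clear; lra.
have [t' [tt0 tt2 t4 ttn]] := corner_size t01 t0n8.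
have t_n : (t'.+1 <= n)%N by apply: leq_trans t4; rewrite leq_pmull.
have [N [NE1 NE2]] : exists N : nat, (5 * (t'.+1 * N) <= 4 * (n - t'.+1))%N /\ (4 * n < 5 * (t'.+1 * N) + 9 * t'.+1)%N.
  by exists (4 * (n - t'.+1) %/ (5 * t'.+1))%N; exact: repetitions.
have tNn : (t'.+1 * N <= n - t'.+1)%N by clear - NE1; lia.
have NR1 : 5 * (t'.+1%:R * N%:R) <= 4 * n%:R :> R.
  rewrite -!natrM ler_nat; apply: (leq_trans NE1); rewrite leq_mul2l leq_subr orbT//.
have NR2 : 4 * n%:R < 5 * (t'.+1%:R * N%:R) + 9 * t'.+1%:R :> R.
  by rewrite -!natrM -natrD ltr_nat.
have qt0 : q * (n%:R / t0) = 2 * l by rewrite t0E; field; rewrite !gt_eqF.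
have qt02 : q * (n%:R / t0 ^+ 2) <= 1.
  have -> : q * (n%:R / t0 ^+ 2) = 4 * l ^+ 2 / expR l.
    by rewrite -DE t0E; field; rewrite !gt_eqF.
  by rewrite ler_pdivrMr ?expR_gt0// mul1r.
have /andP[qN1 qN2] := mid_repetitions q01 t00 tt0 n0 (ler0n _ N) NR1 NR2 ttn qt0 qt02.
have L11 : 11 <= L by clear - L300; lra.
exists (n - t'.+1)%N; split.
- by rewrite subn_gt0; clear - t4; lia.
- by rewrite natrB// ltrD2l ltrN2 -t0E.
apply: le_trans (spread_cover q01 L11 nE LD (ltn0Sn 0) (difference_family1 N t') t4 tNn _) _.
  move=> j /andP[j0 jN]; cbv zeta; rewrite expr1; set w := minn _ _.
  have w5 : 5 * w%:R <= 4 * (n - t'.+1)%:R :> R.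
    by rewrite -!natrM ler_nat; apply: leq_trans NE1; rewrite leq_mul2l geq_minr orbT.
  have wj : w%:R <= j%:R * N%:R :> R.
    by rewrite -natrM ler_nat; apply: leq_trans (geq_minl _ _) _; rewrite !mul1n.
  have wm : (w <= n - t'.+1)%N by apply: leq_trans (geq_minr _ _) tNn.
  have nm : 99 * n%:R <= 100 * (n - t'.+1)%:R :> R.
    rewrite natrB//; clear - tt2 t0n; move: (n%:R) (t'.+1%:R) tt2 t0n => x y; lra.
  have mn : (n - t'.+1)%:R <= n%:R :> R by rewrite ler_nat leq_subr.
  have j1 : 1 <= j%:R :> R by rewrite ler1n.
  have hj : ((t'.+1 * N) ^ j)%:R <= expR (j%:R * L) :> R.
    rewrite natrX expRM_natl lerXn2r ?nnegrE ?expR_ge0// -nE ler_nat.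
    by apply: (leq_trans tNn); rewrite leq_subr.
  have hq : (1 - q) ^+ (j * (n - t'.+1 - w)) <= expR (- (q * (j%:R * ((n - t'.+1)%:R - w%:R)))).
    by apply: le_trans (onem_expR _ q1) _; rewrite natrM natrB.
  have L70 : 70 <= L by clear - L300; lra.
  have L25 : 25 <= L by clear - L300; lra.
  have main x : 'C(n - t'.+1, w)%:R <= expR x ->
      j%:R * L + x + - (q * (j%:R * ((n - t'.+1)%:R - w%:R))) <= - (2 * L) ->
      ((t'.+1 * N) ^ j * 'C(n - t'.+1, w))%:R * (1 - q) ^+ (j * (n - t'.+1 - w)) <= expR (- (2 * L)).
    move=> hC hx; rewrite natrM; apply: (@le_trans _ _ (expR (j%:R * L) * expR x * expR (- (q * (j%:R * ((n - t'.+1)%:R - w%:R)))))).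
      apply: ler_pM; rewrite ?mulr_ge0 ?exprn_ge0 ?subr_ge0// ler_pM//.
    by rewrite -!expRD ler_expR.
  have [w8|w8] := lerP (8 * w%:R) ((n - t'.+1)%:R : R).
    apply: (main (expR (- l) * (n - t'.+1)%:R + l * w%:R)).
      apply: le_trans (binom_exp _ _ (expR_gt0 (- l))) _.
      by rewrite expRD -exprVn expRN invrK [l * _]mulrC expRM_natl.
    exact: (mid_exponent_few q01 (ltW l0) lup L25 j1 (ler0n _ w) wj qN2 nm mn LqD w8 DE).
  apply: (main (n - t'.+1)%:R).
    by apply: le_trans (binom_exp _ _ ltr01) _; rewrite expr1n divr1 mul1r.
  exact: (mid_exponent_many q01 (ltW l0) lup L70 j1 wj qN2 nm LqD w5 (ltW w8)).
have hA : 2 * expR (- L) <= e / 2.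
  rewrite expRN ler_pdivrMr ?expR_gt0// -ler_pdivrMl ?divr_gt0//.
  by move: HL2; rewrite expr0 mulr1 mul1r invf_div.
have hB : t'.+1%:R ^+ 2 * (q * euler_prod q 1 ^+ N) <= e / 2.
  rewrite /euler_prod big_ord_recl big_ord0 mulr1 expr1.
  have h1 : (1 - q) ^+ N <= expR (3 - 8 / 5 * l).
    apply: le_trans (onem_expR _ q1) _; rewrite ler_expR; clear - qN1; lra.
  have h2 : t'.+1%:R ^+ 2 <= expR (2 * l).
    rewrite expRM_natl lerXn2r ?nnegrE ?expR_ge0//; apply: (le_trans tt2).
    rewrite t0E DE invfM mulrCA [2 * _]mulrA divff// mul1r ler_piMr ?expR_ge0//.
    by rewrite invf_le1.
  apply: (@le_trans _ _ (expR (2 * l) * (expR (l - L) * expR (3 - 8 / 5 * l)))).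
    rewrite {1}qE; apply: ler_pM; rewrite ?exprn_ge0 ?mulr_ge0 ?expR_ge0 ?exprn_ge0 ?subr_ge0//.
    by rewrite ler_wpM2l ?expR_ge0.
  apply: (@le_trans _ _ (expR 3 * expR (- (1 / 15 * L)))).
    by rewrite -!expRD ler_expR; clear - lup; lra.
  rewrite expRN ler_pdivrMr ?expR_gt0// -ler_pdivrMl ?divr_gt0//.
  by move: HL3; rewrite expr0 mulr1 invf_div.
by move: hA hB; clear; lra.
Qed.

End MidQ.


(** * Large [q]: long tuples *)

Section LargeQ.
Variable R : realType.
Implicit Types (q e L Z lam x y : R).

Lemma phi_gt0 q : 0 < q <= 1 / 2 -> 0 < phi q.
Proof.
move=> q02; apply: lt_le_trans (phi_ge 0 q02).
by rewrite /euler_prod big_ord0 mul1r expR_gt0.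
Qed.

Lemma log_phi q : 0 < q <= 1 / 2 ->
  phi q = expR (- ln (1 / phi q)) /\ q <= ln (1 / phi q) <= 4 * q.
Proof.
move=> q02; have p0 := phi_gt0 q02; have /andP[q0 q2] := q02.
have E : ln (1 / phi q) = - ln (phi q) by rewrite div1r lnV ?posrE.
have pE : phi q = expR (- ln (1 / phi q)) by rewrite E opprK lnK ?posrE.
split=> //; apply/andP; split.
  rewrite -lerN2 -ler_expR -pE; have := phi_le 1 q02.
  rewrite /euler_prod big_ord_recl big_ord0 mulr1 expr1 => h.
  by apply: (le_trans h); apply: le_trans (expR_ge1Dx _).
rewrite -lerN2 -ler_expR -pE; have := phi_ge 0 q02.
by rewrite /euler_prod big_ord0 mul1r expr1.
Qed.

(** Long enough for the product of the first [K] factors to be as good as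
    [phi q], short enough for a vertex to be adjacent to [K] given ones with
    probability at least [q / L]. *)
Lemma tuple_length q L : 0 < q <= 1 / 2 -> 1 < L -> exists K : nat,
  [/\ (0 < K)%N, q ^+ K <= L^-1, q / L <= q ^+ K & 2 ^+ K <= 2 * L].
Proof.
move=> /andP[q0 q2] L1; have L0 : 0 < L by apply: lt_trans L1.
have pw k : q ^+ k <= (2 ^+ k)^-1.
  by rewrite -exprVn lerXn2r ?nnegrE ?invr_ge0 ?(ltW q0)//; move: q2; rewrite div1r.
have ex : exists k : nat, q ^+ k <= L^-1.
  exists (Num.truncn L).+1; apply: (le_trans (pw _)).
  rewrite lef_pV2 ?posrE ?exprn_gt0//; apply: (@le_trans _ _ (Num.truncn L).+1%:R).
    exact/ltW/truncnS_gt.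
  by rewrite -natrX ler_nat ltnW// ltn_expl.
case: (ex_minnP ex) => K hK Kmin; exists K.
have K0 : (0 < K)%N.
  by case: K hK {Kmin} => //; rewrite expr0 leNgt invf_lt1// L1.
have hK1 : L^-1 < q ^+ K.-1.
  by rewrite ltNge; apply/negP => /Kmin; rewrite leqNgt prednK ?leqnn.
split=> //; rewrite -(prednK K0) exprS.
  by rewrite ler_pM2l// ltW.
rewrite ler_pM2l//; have := lt_le_trans hK1 (pw _).
by rewrite ltf_pV2 ?posrE ?exprn_gt0// => /ltW.
Qed.

(** A proportion [1 / L] of the vertices is not used by the tuples: enough for
    Hall's condition, and small enough to change the exponent [Z] by a constant
    only. *)
Lemma large_repetitions (m t : nat) L : (0 < t)%N -> 1 < L -> exists N : nat,
  (1 - L^-1) * (m%:R / t%:R) - 1 <= N%:R /\ t%:R * N%:R <= (1 - L^-1) * m%:R.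
Proof.
move=> t0 L1; have tR : 0 < t%:R :> R by rewrite ltr0n.
set x := (1 - L^-1) * (m%:R / t%:R).
have x0 : 0 <= x.
  rewrite mulr_ge0 ?divr_ge0// subr_ge0 invf_le1 ?(ltW L1)//.
  by apply: lt_trans L1.
exists (Num.truncn x); split; first by rewrite lerBlDr natr1; apply/ltW/truncnS_gt.
have : (Num.truncn x)%:R <= x by rewrite truncn_le.
by move=> /(ler_wpM2l (ltW tR)) h; apply: (le_trans h); rewrite /x mulrCA [t%:R * _]mulrC divfK ?gt_eqF.
Qed.

(** The exponent [N * lam] misses its target [n * lam / t0 = Z] by a constant:
    rounding [t0], reserving [t] and a proportion [1 / L] of the vertices,
    rounding [N] and truncating the product to [K] factors each cost [O(1)]. *)
Lemma large_exponent (n m t N t0 : R) q L Z lam qK : 0 < q <= 1 / 2 -> 1 < L -> q <= lam <= 4 * q ->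
  4 / 3 * L <= Z <= 2 * L -> 0 < n -> 0 < t0 -> t0 < t -> m = n - t -> 0 < m ->
  n / t0 = Z / lam -> n / t0 - n / t0 ^+ 2 <= n / t ->
  4 * L ^+ 2 <= n * q -> 0 <= qK <= L^-1 -> 0 <= N -> 
  (1 - L^-1) * (m / t) - 1 <= N -> t * N <= (1 - L^-1) * m ->
  N <= 2 * L / q /\ N * (- lam + 4 * (q * qK)) <= - Z + 15.
Proof.
move=> /andP[q0 q2] L1 /andP[lq l4] /andP[ZL Z2] n0 t00 tt0 mE m0 nt0 ntt LD /andP[qK0 qKL] N0 N1 N2.
have L0 : 0 < L by apply: lt_trans L1.
have lam0 : 0 < lam by apply: lt_le_trans lq.
have t_0 : 0 < t by apply: lt_trans tt0.
have Li0 : 0 < L^-1 by rewrite invr_gt0.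
have Li1 : L^-1 <= 1 by rewrite invf_le1// ltW.
have Z0 : 0 < Z by apply: lt_le_trans ZL; rewrite mulr_gt0.
have Nup : N <= 2 * L / q.
  apply: (@le_trans _ _ (Z / lam)).
    rewrite -nt0; apply: (@le_trans _ _ (n / t)); last first.
      by rewrite ler_wpM2l ?(ltW n0)// lef_pV2 ?posrE// ltW.
    rewrite ler_pdivlMr// mulrC; apply: (le_trans N2); rewrite mE.
    apply: (@le_trans _ _ (1 * (n - t))); first by rewrite ler_wpM2r -?mE ?(ltW m0)//; clear - Li0; lra.
    by rewrite mul1r; clear - t_0; lra.
  apply: ler_pM; rewrite ?invr_ge0 ?(ltW Z0) ?(ltW lam0)//.
  by rewrite lef_pV2 ?posrE.
split=> //.
have h1 : lam * (n / t0) = Z by rewrite nt0 mulrC divfK// gt_eqF.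
have h2 : lam * (n / t0 ^+ 2) <= 1.
  have -> : lam * (n / t0 ^+ 2) = (lam * (n / t0)) ^+ 2 / (n * lam) by field; rewrite !gt_eqF.
  rewrite h1 ler_pdivrMr ?mulr_gt0// mul1r; apply: (@le_trans _ _ (4 * L ^+ 2)).
    have -> : 4 * L ^+ 2 = (2 * L) ^+ 2 by ring.
    by rewrite lerXn2r ?nnegrE ?(ltW Z0) ?mulr_ge0 ?(ltW L0).
  by apply: (le_trans LD); rewrite ler_pM2l.
have h3 : lam * (n / t0 * L^-1) <= 2 by rewrite mulrA h1 ler_pdivrMr.
have hN : n / t0 - n / t0 ^+ 2 - n / t0 * L^-1 - 2 <= N.
  apply: le_trans N1; have -> : m / t = n / t - 1 by rewrite mE; field; rewrite gt_eqF.
  have : n / t * L^-1 <= n / t0 * L^-1.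
    by rewrite ler_pM2r// ler_wpM2l ?(ltW n0)// lef_pV2 ?posrE// ltW.
  rewrite mulrBl mul1r mulrBr mulr1 [L^-1 * _]mulrC.
  by clear - ntt Li0; move: (n / t0 * _) (n / t * _) => u v; lra.
have h4 : Z - 7 <= lam * N.
  have := ler_wpM2l (ltW lam0) hN; rewrite !mulrBr h1; clear - h2 h3 l4 q2.
  by move: (lam * (n / t0 ^+ 2)) (lam * (n / t0 / L)) (lam * N) h2 h3 => u v w; lra.
have h5 : N * (4 * (q * qK)) <= 8.
  apply: (@le_trans _ _ (2 * L / q * (4 * (q * L^-1)))); last first.
    by rewrite le_eqVlt; apply/orP; left; apply/eqP; field; rewrite !gt_eqF.
  by apply: ler_pM; rewrite ?mulr_ge0 ?(ltW q0)// ler_pM2l// ler_pM2l.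
by rewrite mulrDr mulrN [N * lam]mulrC; clear - h4 h5; lra.
Qed.

(** The exponent of the bound on the holes of the tuple matching. The gain
    [qK * j * (m - w)], of order [j n q / L ^ 2], exceeds the entropy terms, of
    order [j L ^ 4 / q], because [n q ^ 2] is at least [22 L ^ 6]. *)
Lemma large_matching_exponent (j K N m w n : R) q L qK : 0 < q <= 1 / 2 -> 1 <= L -> 1 <= j ->
  N <= 2 * L / q -> 0 <= N -> 0 <= K <= 2 * L -> q / L <= qK -> w <= j * (K * K * N) ->
  m / L <= m - w -> n <= 2 * m -> 22 * L ^+ 6 <= n * (q * q) ->
  j * L + L * w + - (qK * (j * (m - w))) <= - (2 * L).
Proof.
move=> /andP[q0 q2] L1 j1 NL N0 /andP[K0 K2] qKL wj mw nm HL.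
have L0 : 0 < L by apply: lt_le_trans L1.
have qK0 : 0 < qK by apply: lt_le_trans qKL; rewrite divr_gt0.
have j0 : 0 <= j by apply: le_trans j1.
have h1 : L * w <= j * (8 * L ^+ 4 / q).
  apply: (@le_trans _ _ (L * (j * ((2 * L) * (2 * L) * (2 * L / q))))).
    rewrite ler_pM2l//; apply: (le_trans wj); rewrite ler_wpM2l//.
    by apply: ler_pM => //; [rewrite mulr_ge0|apply: ler_pM].
  by rewrite le_eqVlt; apply/orP; left; apply/eqP; field; rewrite !gt_eqF.
have h2 : j * (11 * L ^+ 4 / q) <= qK * (j * (m - w)).
  rewrite [leRHS]mulrCA ler_wpM2l//.
  apply: (@le_trans _ _ (q / L * (m / L))); last first.
    apply: ler_pM => //; rewrite divr_ge0 ?(ltW q0) ?(ltW L0)//.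
    have : 0 < n * (q * q) by apply: lt_le_trans HL; rewrite mulr_gt0 ?exprn_gt0.
    by rewrite pmulr_lgt0 ?mulr_gt0//; clear - nm; lra.
  have -> : q / L * (m / L) = (m * (q * q)) / L ^+ 2 / q by field; rewrite !gt_eqF.
  rewrite ler_pM2r ?invr_gt0// ler_pdivlMr ?exprn_gt0//.
  have -> : 11 * L ^+ 4 * L ^+ 2 = 11 * L ^+ 6 by ring.
  have : n * (q * q) <= 2 * m * (q * q) by rewrite ler_pM2r ?mulr_gt0.
  by clear - HL; rewrite -[2 * m * _]mulrA; move: (n * _) (m * _) (L ^+ 6) HL => u v x; lra.
have h3 : j * (3 * L) <= j * (3 * L ^+ 4 / q).
  rewrite ler_wpM2l// -mulrA ler_pM2l// ler_pdivlMr//.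
  apply: (@le_trans _ _ L); first by rewrite ler_piMr ?(ltW L0)//; clear - q2; lra.
  by rewrite -[leLHS]expr1 ler_weXn2l.
have h4 : j * (11 * L ^+ 4 / q) = j * (8 * L ^+ 4 / q) + j * (3 * L ^+ 4 / q) by field; rewrite gt_eqF.
have h5 : 2 * L <= j * (2 * L) by rewrite ler_peMl// mulr_ge0// ltW.
move: h1 h2 h3 h5; rewrite h4; have -> : j * (3 * L) = j * L + j * (2 * L) by ring.
by clear; move: (j * (8 * _ / _)) (j * (3 * _ / _)) (j * L) (j * (2 * _)) (L * w) (qK * _) => *; lra.
Qed.

Lemma large_q_scale (n : nat) q L Z lam : 0 < q <= 1 / 2 -> 300 <= L -> n%:R = expR L ->
  expR (- (L / 3)) <= q -> q <= lam <= 4 * q -> Z = ln (n%:R ^+ 2 * q * lam) ->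
  [/\ 4 / 3 * L <= Z <= 2 * L, expR Z = n%:R ^+ 2 * q * lam & expR (L / 3) <= n%:R * (q * q)].
Proof.
move=> /andP[q0 q2] L300 nE qlo /andP[lq l4] ZE.
have n0 : 0 < n%:R :> R by rewrite nE expR_gt0.
have lam0 : 0 < lam by apply: lt_le_trans lq.
have z0 : 0 < n%:R ^+ 2 * q * lam by rewrite !mulr_gt0 ?exprn_gt0.
have ZX : expR Z = n%:R ^+ 2 * q * lam by rewrite ZE lnK.
have qq : expR (- (2 / 3 * L)) <= q * q.
  have -> : - (2 / 3 * L) = - (L / 3) + - (L / 3) by field.
  by rewrite expRD; apply: ler_pM; rewrite ?expR_ge0.
have n2 : n%:R ^+ 2 = expR (2 * L) by rewrite expRM_natl nE.
split=> //.
  apply/andP; split; rewrite -ler_expR ZX n2.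
    rewrite (_ : 4 / 3 * L = 2 * L + - (2 / 3 * L)); last by field.
    rewrite expRD -[leRHS]mulrA ler_pM2l ?expR_gt0//; apply: (le_trans qq).
    by rewrite ler_pM2l.
  rewrite -mulrA ler_piMr ?expR_ge0//; clear - q0 q2 lq l4; nra.
rewrite (_ : L / 3 = L + - (2 / 3 * L)); last by field.
by rewrite expRD nE ler_pM2l ?expR_gt0.
Qed.

Lemma large_q_cover e : 0 < e -> exists L0, forall n q,
  L0 <= ln n%:R -> expR (- (ln n%:R / 3)) <= q -> q <= 1 / 2 ->
  exists d : nat, [/\ (0 < d)%N, d%:R < n%:R - n%:R * ln (1 / phi q) / ln (zfun n q) &
    Pr q (fun H : graph n => ~ coverable H d) <= e].
Proof.
move=> e0.
have c3 : 0 < 1 / 3 :> R by rewrite divr_gt0 ?ltr0Sn.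
have [L1 HL1] := @poly_le_exp R 2 4 (1 / 3) c3.
have [L2 HL2] := @poly_le_exp R 0 (2 / e * 2) 1 ltr01.
have [L3 HL3] := @poly_le_exp R 6 22 (1 / 3) c3.
have [L4 HL4] := @poly_le_exp R 4 16 (1 / 3) c3.
exists (Num.max L1 (Num.max L2 (Num.max L3 (Num.max L4 (Num.max (16 * expR 15 / e) 300))))) => n q.
rewrite !ge_max => /and5P[/HL1{HL1}HL1 /HL2{HL2}HL2 /HL3{HL3}HL3 /HL4{HL4}HL4 /andP[Le L300]] qlo q2.
have LL1 : 1 <= ln n%:R :> R by clear - L300; move: (ln _) L300 => L; lra.
have n0 : 0 < n%:R :> R.
  by rewrite ltr0n; case: n LL1 {HL1 HL2 HL3 HL4 L300 Le qlo} => //; rewrite ln0// ler10.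
have nE : n%:R = expR (ln n%:R) :> R by rewrite lnK.
move: nE qlo LL1 L300 Le HL1 HL2 HL3 HL4; set L := ln n%:R => nE qlo LL1 L300 Le HL1 HL2 HL3 HL4.
have q0 : 0 < q by apply: lt_le_trans qlo; exact: expR_gt0.
have q02 : 0 < q <= 1 / 2 by rewrite q0.
have q01 : 0 < q <= 1 by rewrite q0; clear - q2; lra.
have L0 : 0 < L by apply: lt_le_trans LL1.
have L11 : 11 <= L by clear - L300; lra.
have L1lt : 1 < L by clear - L300; lra.
have [phiE lamq] := log_phi q02; rewrite /zfun.
move: phiE lamq; set lam := ln (1 / phi q) => phiE lamq; set Z := ln (_ * lam).
have [ZL ZX Dq] := large_q_scale q02 L300 nE qlo lamq (erefl Z).
have /andP[lq l4] := lamq; have /andP[Z1 Z2] := ZL.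
have lam0 : 0 < lam by apply: lt_le_trans lq.
have Z0 : 0 < Z by apply: lt_le_trans Z1; rewrite mulr_gt0.
have exL : expR (1 / 3 * L) = expR (L / 3) by rewrite mul1r mulrC.
move: HL1 HL3 HL4; rewrite exL => /le_trans/(_ Dq) HL1 /le_trans/(_ Dq) HL3 /le_trans/(_ Dq) HL4.
have HD : 4 * L ^+ 2 <= n%:R * q.
  apply: (le_trans HL1); rewrite ler_pM2l// ler_piMr ?(ltW q0)//; clear - q2; lra.
have LD : L ^+ 2 <= q * n%:R.
  by rewrite mulrC; apply: le_trans HD; have := sqr_ge0 L; clear; lra.
have [t0 t0E] : exists t0, t0 = n%:R * lam / Z by eexists.
have t00 : 0 < t0 by rewrite t0E divr_gt0 ?mulr_gt0.
have t0lo : n%:R * q / (2 * L) <= t0.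
  rewrite t0E; apply: ler_pM; rewrite ?invr_ge0 ?mulr_ge0 ?(ltW q0) ?(ltW L0)//.
    by rewrite ler_pM2l.
  by rewrite lef_pV2 ?posrE ?mulr_gt0.
have t01 : 1 <= t0.
  apply: le_trans t0lo; rewrite ler_pdivlMr ?mulr_gt0// mul1r; apply: le_trans HD.
  by clear - LL1; rewrite expr2; nra.
have t0n : 8 * t0 <= n%:R.
  rewrite t0E mulrA ler_pdivrMr// mulrCA ler_pM2l//.
  by clear - l4 q2 Z1 L300; lra.
have [t' [tt0 tt2 t4 ttn]] := corner_size t01 t0n.
have t_n : (t'.+1 < n)%N by clear - t4; lia.
have [K [K0 qKL qKq K2]] := tuple_length q02 L1lt.
have [N [N1 N2]] := large_repetitions (n - t'.+1) (ltn0Sn t') L1lt.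
have mR : (n - t'.+1)%:R = n%:R - t'.+1%:R :> R by rewrite natrB// ltnW.
have m0 : 0 < (n - t'.+1)%:R :> R by rewrite ltr0n subn_gt0.
have nt0 : n%:R / t0 = Z / lam by rewrite t0E; field; rewrite !gt_eqF.
have qK0 : 0 <= q ^+ K by rewrite exprn_ge0// ltW.
have [NL Nexp] : N%:R <= 2 * L / q /\ N%:R * (- lam + 4 * (q * q ^+ K)) <= - Z + 15.
  by apply: (large_exponent q02 L1lt lamq ZL n0 t00 tt0 mR m0 nt0 ttn HD _ (ler0n _ N) N1 N2); rewrite qK0.
have Li : (1 - L^-1) * (n - t'.+1)%:R <= (n - t'.+1)%:R.
  by rewrite ler_piMl// gerBl invr_ge0 ltW.
have tNn : (t'.+1 * N <= n - t'.+1)%N.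
  by rewrite -(ler_nat R) natrM; apply: (le_trans N2).
have KL : K%:R <= 2 * L :> R.
  by apply: le_trans K2; rewrite -natrX ler_nat ltnW// ltn_expl.
have design : (N * K * 2 ^ K <= t'.+1)%N.
  rewrite -(ler_nat R) !natrM natrX; apply: le_trans (ltW tt0); apply: le_trans t0lo.
  apply: (@le_trans _ _ (2 * L / q * (2 * L) * (2 * L))).
    by do 2?apply: ler_pM => //; rewrite ?mulr_ge0 ?exprn_ge0.
  rewrite ler_pdivlMr ?mulr_gt0//.
  have -> : 2 * L / q * (2 * L) * (2 * L) * (2 * L) = 16 * L ^+ 4 / q by ring.
  by rewrite ler_pdivrMr// -mulrA.
have [c cd] := difference_family_exists K0 design.
exists (n - t'.+1)%N; split.
- by rewrite subn_gt0.
- by rewrite mR ltrD2l ltrN2 -t0E.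
apply: le_trans (spread_cover q01 L11 nE LD K0 cd t4 tNn _) _.
  move=> j /andP[j0 jN]; cbv zeta; set w := minn _ _.
  have wj : w%:R <= j%:R * (K%:R * K%:R * N%:R) :> R.
    by rewrite -!natrM ler_nat geq_minl.
  have wt : (w <= t'.+1 * N)%N by exact: geq_minr.
  have wm : (w <= n - t'.+1)%N by apply: leq_trans wt tNn.
  have mw : (n - t'.+1)%:R / L <= (n - t'.+1)%:R - w%:R.
    have : w%:R <= t'.+1%:R * N%:R :> R by rewrite -natrM ler_nat.
    move/le_trans/(_ N2); rewrite mulrBl mul1r mulrC; clear.
    by move: (_%:R / L) => x; lra.
  have n2m : n%:R <= 2 * (n - t'.+1)%:R :> R.
    by rewrite -natrM ler_nat; clear - t4; lia.
  have K2L : 0 <= (K%:R : R) <= 2 * L by rewrite ler0n.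
  have j1 : 1 <= j%:R :> R by rewrite ler1n.
  have main := large_matching_exponent q02 LL1 j1 NL (ler0n _ N) K2L qKq wj mw n2m HL3.
  have hj : ((t'.+1 * N) ^ j)%:R <= expR (j%:R * L) :> R.
    rewrite natrX expRM_natl lerXn2r ?nnegrE ?expR_ge0// -nE ler_nat.
    by apply: (leq_trans tNn); rewrite leq_subr.
  have hC : 'C(n - t'.+1, w)%:R <= expR (L * w%:R).
    rewrite mulrC expRM_natl -nE -natrX ler_nat.
    apply: leq_trans (bin_leq_exp _ _) _; case: (w) => // w'.
    by rewrite leq_exp2r// leq_subr.
  have hq : (1 - q ^+ K) ^+ (j * (n - t'.+1 - w)) <= expR (- (q ^+ K * (j%:R * ((n - t'.+1)%:R - w%:R)))).
    have qK1 : q ^+ K <= 1 by rewrite exprn_ile1 ?(ltW q0)//; case/andP: q01.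
    by apply: le_trans (onem_expR _ qK1) _; rewrite natrM natrB.
  have qK1 : q ^+ K <= 1 by rewrite exprn_ile1 ?(ltW q0)//; case/andP: q01.
  rewrite natrM; apply: (@le_trans _ _ (expR (j%:R * L) * expR (L * w%:R) * expR (- (q ^+ K * (j%:R * ((n - t'.+1)%:R - w%:R)))))).
    apply: ler_pM; rewrite ?mulr_ge0 ?exprn_ge0 ?subr_ge0// ler_pM//.
  by rewrite -!expRD ler_expR.
have hA : 2 * expR (- L) <= e / 2.
  rewrite expRN ler_pdivrMr ?expR_gt0// -ler_pdivrMl ?divr_gt0//.
  by move: HL2; rewrite expr0 mulr1 mul1r invf_div.
have hB : t'.+1%:R ^+ 2 * (q * euler_prod q K ^+ N) <= e / 2.
  have eu : euler_prod q K <= expR (- lam + 4 * (q * q ^+ K)).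
    rewrite expRD -phiE -exprS -ler_pdivrMr ?expR_gt0// -expRN; exact: phi_ge.
  have h1 : euler_prod q K ^+ N <= expR (- Z + 15).
    apply: (@le_trans _ _ (expR (- lam + 4 * (q * q ^+ K)) ^+ N)).
      by rewrite lerXn2r ?nnegrE ?expR_ge0// ltW// euler_prod_gt0.
    by rewrite -expRM_natl ler_expR.
  have h2 : t'.+1%:R ^+ 2 <= (2 * t0) ^+ 2.
    by rewrite lerXn2r ?nnegrE// mulr_ge0// ltW.
  have ZL1 : L <= Z by apply: le_trans Z1; clear - L0; lra.
  apply: (@le_trans _ _ ((2 * t0) ^+ 2 * (q * expR (- Z + 15)))).
    apply: ler_pM; rewrite ?exprn_ge0 ?mulr_ge0 ?exprn_ge0 ?(ltW q0) ?(ltW (euler_prod_gt0 _ _))//.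
    by rewrite ler_pM2l.
  rewrite expRD expRN ZX t0E.
  have -> : (2 * (n%:R * lam / Z)) ^+ 2 * (q * ((n%:R ^+ 2 * q * lam)^-1 * expR 15)) =
    4 * expR 15 * (lam / (Z * Z)) by field; rewrite !gt_eqF.
  apply: (@le_trans _ _ (4 * expR 15 * (2 / L))).
    rewrite ler_pM2l ?mulr_gt0 ?expR_gt0//; apply: ler_pM; rewrite ?invr_ge0 ?mulr_ge0 ?(ltW lam0) ?(ltW Z0)//.
      by clear - l4 q2; lra.
    rewrite lef_pV2 ?posrE ?mulr_gt0//; apply: (le_trans ZL1).
    by rewrite ler_peMl ?(ltW Z0)//; apply: le_trans ZL1.
  rewrite mulrA ler_pdivrMr//; move: Le; rewrite ler_pdivrMr//.
  by clear; move: (expR 15) (e) => x y; rewrite [y / 2 * L]mulrAC [L * y]mulrC; lra.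
by move: hA hB; clear; lra.
Qed.

End LargeQ.



(** * Assembling the three ranges *)

Section Ranges.
Variable R : realType.

Lemma root_powR (n k : nat) : (0 < n)%N -> n%:R `^ (- k%:R^-1) = expR (- (ln n%:R / k%:R)) :> R.
Proof. by move=> n0; rewrite /powR gt_eqF ?ltr0n// mulNr mulrC. Qed.

Lemma cover_below_bound (eps e : R) : 0 < eps < 1 -> 0 < e -> exists L0 : R, forall (n : nat) (q : R),
  L0 <= ln n%:R -> n%:R^-1 * ln n%:R ^+ 2 <= q <= 1 / 2 ->
  exists d : nat, [/\ (0 < d)%N, d%:R < dim_bound eps n q &
    Pr q (fun H : graph n => ~ coverable H d) <= e].
Proof.
move=> eps01 e0.
have [L1 H1] := small_q_cover eps01 e0.
have [L2 H2] := @mid_q_cover R e e0.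
have [L3 H3] := @large_q_cover R e e0.
exists (Num.max 1 (Num.max L1 (Num.max L2 L3))) => n q.
rewrite !ge_max => /and4P[LL1 hL1 hL2 hL3] /andP[qlo q2].
have n0 : (0 < n)%N by case: n LL1 {hL1 hL2 hL3 qlo} => //; rewrite ln0// ler10.
have nR : 0 < n%:R :> R by rewrite ltr0n.
rewrite /dim_bound !root_powR//; case: ifPn => [h1|]; last rewrite -ltNge => h1; first last.
  case: ifPn => [h2|]; last rewrite -ltNge => h2; first exact: H2 (ltW h1) h2.
  exact: H3 (ltW h2) q2.
by apply: H1 => //; rewrite -ler_pdivrMr// mulrC.
Qed.

Lemma sides_separated_whp (e : R) : 0 < e -> exists L0 : R, forall (n : nat) (q : R),
  L0 <= ln n%:R -> n%:R^-1 * ln n%:R ^+ 2 <= q <= 1 / 2 ->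
  Pr q (fun H : graph n => ~ sides_separated H) <= e.
Proof.
move=> e0; have [L1 H1] := @poly_le_exp R 0 (2 / e) 1 ltr01.
exists (Num.max 6 L1) => n q; rewrite ge_max => /andP[L6 /H1{H1}H1] /andP[qlo q2].
have nR : 0 < n%:R :> R.
  by rewrite ltr0n; case: n L6 {H1 qlo} => //; rewrite ln0// lern0.
have nE : n%:R = expR (ln n%:R) :> R by rewrite lnK.
have q0 : 0 <= q by apply: le_trans qlo; rewrite mulr_ge0 ?invr_ge0 ?sqr_ge0 ?ltW.
have q01 : 0 <= q <= 1 by rewrite q0; clear - q2; lra.
have LD : ln n%:R ^+ 2 <= q * n%:R by rewrite -ler_pdivrMr// mulrC.
move: nE L6 H1 LD; set L := ln n%:R => nE L6 H1 LD; clear qlo.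
apply: le_trans (sides_separated_prob n q01) _.
apply: (@le_trans _ _ (2 * expR (- L))).
  rewrite -mulrA ler_pM2l// nE -expRM_natl -nE -expRD ler_expR.
  have : (q * n%:R) * 2^-1 <= q * (1 - q) * n%:R.
    rewrite [leRHS]mulrAC ler_wpM2l ?mulr_ge0 ?(ltW nR)//; clear - q2; lra.
  have : 6 * L <= L ^+ 2 by rewrite expr2 ler_pM2r//; clear - L6; lra.
  by clear - LD; move: (q * n%:R) (q * (1 - q) * n%:R) (L ^+ 2) LD => x y z; lra.
rewrite expRN ler_pdivrMr ?expR_gt0// -ler_pdivrMl// mulrC.
by move: H1; rewrite expr0 mulr1 mul1r.
Qed.

Lemma dim_bound_prob (eps e : R) : 0 < eps < 1 -> 0 < e -> exists L0 : R, forall (n : nat) (q : R),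
  L0 <= ln n%:R -> n%:R^-1 * ln n%:R ^+ 2 <= q <= 1 / 2 ->
  1 - e <= Omega_prob (1 - q)
    (fun P : poset (ground n) => (poset_dim P)%:R < dim_bound eps n q) <= 1.
Proof.
move=> eps01 e0; have e20 : 0 < e / 2 by rewrite divr_gt0.
have [L1 H1] := cover_below_bound eps01 e20.
have [L2 H2] := sides_separated_whp e20.
exists (Num.max 1 (Num.max L1 L2)) => n q.
rewrite !ge_max => /and3P[LL1 /H1{}H1 /H2{}H2] hq.
have n1 : (1 < n)%N.
  rewrite ltnNge; apply/negP => n1; have : ln n%:R <= 0 :> R by rewrite ln_le0// lern1.
  by move/(le_trans LL1); rewrite ler10.
have [d [d0 dlt Hd]] := H1 _ hq.
have q01 : 0 <= q <= 1.
  case/andP: hq => h1 h2; apply/andP; split; last by clear - h2; lra.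
  by apply: le_trans h1; rewrite mulr_ge0 ?invr_ge0 ?sqr_ge0.
rewrite Omega_probE Pr_le1// andbT.
set E := (X in _ <= Pr q X).
have h : Pr q (fun H : graph n => ~ E H) <= e.
  apply: (@le_trans _ _ (Pr q (fun H : graph n => ~ sides_separated H \/ ~ coverable H d))).
    apply: le_Pr => // H nE; apply: contrapT => /not_orP[/contrapT sH /contrapT cH]; apply: nE.
    by apply: le_lt_trans dlt; rewrite ler_nat dim_le_cover.
  apply: le_trans (Pr_or q01 _ _) _.
  by have := lerD (H2 _ hq) Hd; clear; lra.
by move: h; rewrite PrC//; clear; lra.
Qed.

End Ranges.

Unset Implicit Arguments.
Local Open Scope classical_set_scope.
Local Open Scope ring_scope.

Theorem theorem1p9 (R : realType) (eps : R) (q : nat -> R)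
    (heps : 0 < eps < 1)
    (hq : \forall n \near \oo, n%:R^-1 * ln (n%:R : R) ^+ 2 <= q n <= 1 / 2) :
  (fun n : nat => Omega_prob (1 - q n)
     (fun P : poset (ground n) => (poset_dim P)%:R < dim_bound eps n (q n)))
    @ \oo --> (1 : R).
Proof.
apply/cvgrPdist_le => e e0; have [L0 H] := dim_bound_prob heps e0.
have [M ML] : exists M : nat, expR L0 <= M%:R.
  by exists (Num.truncn (expR L0)).+1; exact/ltW/truncnS_gt.
near=> n; have hqn : n%:R^-1 * ln (n%:R : R) ^+ 2 <= q n <= 1 / 2 by near: n.
have Mn : (M <= n)%N by near: n; exact: nbhs_infty_ge.
have nE : expR L0 <= n%:R by apply: (le_trans ML); rewrite ler_nat.
have Ln : L0 <= ln n%:R.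
  by rewrite -ler_expR lnK// posrE (lt_le_trans _ nE)// expR_gt0.
have /andP[h1 h2] := H _ _ Ln hqn.
by rewrite ger0_norm ?subr_ge0// lerBlDr -lerBlDl.
Unshelve. all: by end_near.
Qed.
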